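(* Let $(\ell_\varepsilon)_{\varepsilon\in]0,1]}$ and $(\alpha_\varepsilon)_{\varepsilon\in]0,1]}$ be two sequences of positive real numbers such that $\ell_\varepsilon\searrow0^+$ as $\varepsilon\to0^+$ and $\lambda_\varepsilon:=\alpha_\varepsilon/\ell_\varepsilon\to+\infty$ as $\varepsilon\to0^+$. Let $(\rho^{in}_\varepsilon,m^{in}_\varepsilon)_{\varepsilon\in]0,1]}$ be an admissible family of initial data (see context) with a non-constant reference density profile $\rho_0^{in}$. For any $\varepsilon\in]0,1]$, let $(\rho_\varepsilon,u_\varepsilon)$ be a global in time finite energy weak solution (see context) on $\mathbb{R}_+\times\Omega_\varepsilon$, related to the initial datum $(\rho^{in}_\varepsilon,m^{in}_\varepsilon)$. Then, for any fixed $T>0$, up to the extraction of a suitable subsequence, $\overline{\rho_\varepsilon}\rightharpoonup\rho_0^{in}$ weakly-$*$ in $L^\infty([0,T]\times\mathbb{R}^2)$ and $\overline{\rho_\varepsilon}\to\rho_0^{in}$ in $C^0([0,T];L^p_w(K))$ for any compact $K\subset\mathbb{R}^2$ and any $1\le p<+\infty$; in addition, $\overline{u_\varepsilon}\to0$ strongly in $L^2([0,T];L^2(\mathbb{R}^2))$.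
   Context: Notation. $\mathbb{R}_+=[0,+\infty[$; $x=(x_h,x_3)$ with $x_h\in\mathbb{R}^2$, $v=(v_h,v_3)$, $\nabla_h=(\partial_1,\partial_2)$; $Du$ is the Jacobian matrix, $\nabla u=(Du)^t$, $\mathbb{D}u=(Du+\nabla u)/2$, $A:B=\mathrm{tr}(AB^t)$. The parameter $\varepsilon$ ranges in a sequence in $]0,1]$ tending to $0$ (e.g. $\varepsilon=1/n$). $\Omega_\varepsilon=\mathbb{R}^2\times]-\ell_\varepsilon,\ell_\varepsilon[$, with exterior normal $n=\pm e_3$. For a function $f$ on $\Omega_\varepsilon$ (possibly depending also on time) or a function of $x_3$ only, $\overline f=\frac1{2\ell_\varepsilon}\int_{-\ell_\varepsilon}^{\ell_\varepsilon}f\,dx_3$ is its vertical average; e.g. $\overline{\|f(\cdot,x_3)\|^2_{L^2(\mathbb{R}^2)}}=\frac1{2\ell_\varepsilon}\int_{-\ell_\varepsilon}^{\ell_\varepsilon}\|f(\cdot,x_3)\|^2_{L^2(\mathbb{R}^2)}dx_3$. $C^0([0,T];L^p_w(K))$ is the space of functions continuous in time with values in $L^p(K)$ with the weak topology; convergence means uniform in $t\in[0,T]$ convergence against each fixed element of $L^{p'}(K)$. Weak solutions. The system on $\mathbb{R}_+\times\Omega_\varepsilon$ is $\partial_t\rho_\varepsilon+\mathrm{div}(\rho_\varepsilon u_\varepsilon)=0$, $\partial_t(\rho_\varepsilon u_\varepsilon)+\mathrm{div}(\rho_\varepsilon u_\varepsilon\otimes u_\varepsilon)-\Delta u_\varepsilon+\frac1\varepsilon\nabla\pi_\varepsilon+\frac1\varepsilon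 e_3\times\rho_\varepsilon u_\varepsilon=0$, $\mathrm{div}\,u_\varepsilon=0$, with $u_\varepsilon\cdot n=0$ and $(\mathbb{D}u_\varepsilon)n\times n=-\alpha_\varepsilon u_\varepsilon\times n$ on $\partial\Omega_\varepsilon$. A global in time finite energy weak solution with initial datum $(\rho^{in}_\varepsilon,m^{in}_\varepsilon)$ is a pair $(\rho_\varepsilon,u_\varepsilon)$ such that, for all $T>0$: (i) $0\le\rho_\varepsilon\in L^\infty([0,T[\times\Omega_\varepsilon)$; (ii) $u_\varepsilon\in L^\infty([0,T[;L^2(\Omega_\varepsilon))\cap L^2([0,T[;H^1(\Omega_\varepsilon))$, $\mathrm{div}\,u_\varepsilon=0$, $u_\varepsilon\cdot n=0$ on $\partial\Omega_\varepsilon$; (iii) $-\iint_{\mathbb{R}_+\times\Omega_\varepsilon}\beta(\rho_\varepsilon)(\partial_t\varphi+u_\varepsilon\cdot\nabla\varphi)=\int_{\Omega_\varepsilon}\beta(\rho^{in}_\varepsilon)\varphi(0,\cdot)$ for all $\varphi\in C^\infty_c(\mathbb{R}_+\times\overline{\Omega_\varepsilon})$ and all $\beta\in C^1_b(\mathbb{R})$, as well as for $\beta(s)=s$; (iv) for all $\psi\in C^\infty_c(\mathbb{R}_+\times\overline{\Omega_\varepsilon};\mathbb{R}^3)$ with $\mathrm{div}\,\psi=0$, $\psi\cdot n=0$ on $\partial\Omega_\varepsilon$: $\iint_{\mathbb{R}_+\times\Omega_\varepsilon}(-\rho_\varepsilon u_\varepsilon\cdot\partial_t\psi-\rho_\varepsilon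 u_\varepsilon\otimes u_\varepsilon:\nabla\psi+\frac1\varepsilon e_3\times\rho_\varepsilon u_\varepsilon\cdot\psi+\nabla u_\varepsilon:\nabla\psi)\,dx\,dt+2\alpha_\varepsilon\iint_{\mathbb{R}_+\times\partial\Omega_\varepsilon}u_\varepsilon\cdot\psi\,dx_h\,dt=\int_{\Omega_\varepsilon}m^{in}_\varepsilon\cdot\psi(0,\cdot)\,dx$; (v) for a.e. $t\ge0$: $\frac12\int_{\Omega_\varepsilon}\rho_\varepsilon(t)|u_\varepsilon(t)|^2dx+\iint_{[0,t]\times\Omega_\varepsilon}|Du_\varepsilon|^2dx\,d\tau+2\alpha_\varepsilon\iint_{[0,t]\times\partial\Omega_\varepsilon}|u_\varepsilon|^2dx_h\,d\tau\le\int_{\Omega_\varepsilon}|m^{in}_\varepsilon|^2/\rho^{in}_\varepsilon\,dx$. Admissible families. $(\rho^{in}_\varepsilon,m^{in}_\varepsilon)_\varepsilon$ is admissible with reference profile $\rho_0^{in}$ if: (1) $\rho^{in}_\varepsilon=\rho_0^{in}+\varepsilon r^{in}_\varepsilon$ with $\rho_0^{in}=\rho_0^{in}(x_h)\in C^2(\mathbb{R}^2)\cap W^{2,\infty}(\mathbb{R}^2)$, and for some constant $\rho^*>0$, $0\le\rho_0^{in}\le\rho^*$ and $0\le\rho^{in}_\varepsilon\le2\rho^*$ for all $\varepsilon$; (2) for all $\varepsilon$ there is $\delta_\varepsilon>0$ with $\frac1{\rho^{in}_\varepsilon}\mathbf1_{\{\rho^{in}_\varepsilon\le\delta_\varepsilon\}}\in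 L^1(\Omega_\varepsilon)$, and there is $\delta>0$ (independent of $\varepsilon$) such that the averages $\overline{\frac1{\rho^{in}_\varepsilon}\mathbf1_{\{\rho^{in}_\varepsilon\le\delta\}}}$ are bounded in $L^1(\mathbb{R}^2)$ uniformly in $\varepsilon$; (3) $\overline{r^{in}_\varepsilon}$ is bounded in $L^\infty(\mathbb{R}^2)\cap H^{-2}(\mathbb{R}^2)$ uniformly in $\varepsilon$; (4) $m^{in}_\varepsilon\in L^2(\Omega_\varepsilon;\mathbb{R}^3)$, $m^{in}_\varepsilon=0$ on $\{\rho^{in}_\varepsilon=0\}$, $|m^{in}_\varepsilon|^2/\rho^{in}_\varepsilon\in L^1(\Omega_\varepsilon)$; $\overline{m^{in}_\varepsilon}$ is bounded in $L^2(\mathbb{R}^2)$ uniformly in $\varepsilon$; (5) $\sup_\varepsilon\overline{\|(m^{in}_\varepsilon/\sqrt{\rho^{in}_\varepsilon})(\cdot,x_3)\|^2_{L^2(\mathbb{R}^2)}}<+\infty$; (6) if $\rho_0^{in}$ is not constant, then for every compact $K\subset\mathbb{R}^2$ the Lebesgue measure of $\{x\in K:|\nabla_h\rho_0^{in}(x)|\le\delta\}$ tends to $0$ as $\delta\to0^+$. *)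

(* Defs.v *)
From HB Require Import structures.
From mathcomp Require Import all_boot all_order all_algebra.
From mathcomp Require Import all_classical all_reals all_analysis.

Set Implicit Arguments.
Unset Strict Implicit.
Unset Printing Implicit Defensive.

Import Order.TTheory GRing.Theory Num.Theory.
Import numFieldNormedType.Exports.

Local Open Scope classical_set_scope.
Local Open Scope ring_scope.

(* Points of the plane are pairs x_h : R * R, points of the space are
   x = (x_h, x_3) : R * R * R, and points of space-time are z = (t, x).
   Vector fields take their values in 'rV[R]_3. *)

Lemma product_measure_sigma_finite d1 d2 (T1 : measurableType d1)
    (T2 : measurableType d2) (R : realType)
    (m1 : {sigma_finite_measure set T1 -> \bar R})
    (m2 : {sigma_finite_measure set T2 -> \bar R}) :
  sigma_finite setT (m1 \x m2)%E.
Proof.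
have /sigma_finiteP[F [TF ndF Foo]] := sigma_finiteT m1.
have /sigma_finiteP[G [TG ndG Goo]] := sigma_finiteT m2.
exists (fun n => F n `*` G n).
  rewrite -setXTT TF TG predeqE => -[x y]; split.
    move=> [/= [n _ Fnx] [k _ Gky]]; exists (maxn n k) => //; split.
    - by move: x Fnx; exact/subsetPset/ndF/leq_maxl.
    - by move: y Gky; exact/subsetPset/ndG/leq_maxr.
  by move=> [n _ []/= ? ?]; split; exists n.
move=> k; have [? ?] := Foo k; have [? ?] := Goo k.
split; first exact: measurableX.
by rewrite product_measure1E// lte_mul_pinfty// ge0_fin_numE.
Qed.

(* Lebesgue measure on R^2, R^3, R x R^3 and R x R^2. The constants are needed
   because the instance of sigma-finite measure which is inferred for a bare
   product is the one for subprobabilities. *)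
Section ProductLebesgue.
Context (R : realType).

Local Notation mR := (measurableTypeR R).
Local Notation mu1 := (@lebesgue_measure R).

Definition leb2 : set (mR * mR) -> \bar R := (mu1 \x mu1)%E.

HB.instance Definition _ := Measure.on leb2.
HB.instance Definition _ := Measure_isSigmaFinite.Build _ _ _ leb2
  (product_measure_sigma_finite mu1 mu1).

Definition leb3 : set (mR * mR * mR) -> \bar R := (leb2 \x mu1)%E.

HB.instance Definition _ := Measure.on leb3.
HB.instance Definition _ := Measure_isSigmaFinite.Build _ _ _ leb3
  (product_measure_sigma_finite leb2 mu1).

Definition leb_tx : set (mR * (mR * mR * mR)) -> \bar R := (mu1 \x leb3)%E.

HB.instance Definition _ := Measure.on leb_tx.
HB.instance Definition _ := Measure_isSigmaFinite.Build _ _ _ leb_tx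
  (product_measure_sigma_finite mu1 leb3).

Definition leb_th : set (mR * (mR * mR)) -> \bar R := (mu1 \x leb2)%E.

HB.instance Definition _ := Measure.on leb_th.
HB.instance Definition _ := Measure_isSigmaFinite.Build _ _ _ leb_th
  (product_measure_sigma_finite mu1 leb2).

End ProductLebesgue.

Section SmoothFunctions.
Context {R : realType} {V : normedModType R}.

(* On a finite dimensional V this is the usual class C^k: directional
   derivatives in every direction exist and are of class C^(k-1). *)
Fixpoint Ck (k : nat) (f : V -> R) : Prop :=
  continuous f /\
  if k is k'.+1 then
    forall v : V, (forall x, derivable f x v) /\ Ck k' (fun x => 'D_v f x)
  else True.

Definition smooth (f : V -> R) : Prop := forall k, Ck k f.

Definition supp (f : V -> R) : set V := closure [set x | f x != 0].

Definition test_fun (f : V -> R) : Prop := smooth f /\ compact (supp f).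

End SmoothFunctions.

Section LebesgueSpaces.
Context {d : measure_display} {T : measurableType d} {R : realType}.
Variable mu : {measure set T -> \bar R}.

(* f belongs to L^p(D); its values outside of D are irrelevant. *)
Definition LpOn (D : set T) (p : \bar R) (f : T -> R) : Prop :=
  f \_ D \in Lfun mu p.

Definition Lp_bounded (I : Type) (J : set I) (p : \bar R) (F : I -> T -> R) :
    Prop :=
  exists C : R, forall i, J i ->
    F i \in Lfun mu p /\ ('N[mu]_p[EFin \o F i] <= C%:E)%E.

Definition cvg_strong (D : set T) (p : \bar R) (f_ : nat -> T -> R)
    (f : T -> R) : Prop :=
  [/\ forall n, LpOn D p (f_ n), LpOn D p f &
      ('N[mu]_p[EFin \o ((f_ n \- f)%R \_ D)] @[n --> \oo] --> 0)%E].

Definition cvg_weak_star (D : set T) (f_ : nat -> T -> R) (f : T -> R) :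
    Prop :=
  [/\ forall n, LpOn D +oo%E (f_ n), LpOn D +oo%E f &
      forall g, LpOn D 1%E g ->
        \int[mu]_(x in D) (f_ n x * g x) @[n --> \oo]
          --> \int[mu]_(x in D) (f x * g x)].

End LebesgueSpaces.

Section Vectors.
Context {R : realType}.

Definition dot n (a b : 'rV[R]_n) : R := \sum_i a 0 i * b 0 i.

Definition normsq n (a : 'rV[R]_n) : R := dot a a.

Definition frob n (A B : 'M[R]_n) : R := \tr (A *m B^T).

(* The indices i + 1 and i + 2 are taken modulo 3. *)
Definition cross (a b : 'rV[R]_3) : 'rV[R]_3 :=
  \row_(i < 3) (a 0 (i + 1) * b 0 (i + 2%:R) - a 0 (i + 2%:R) * b 0 (i + 1)).

Definition e_3 : 'rV[R]_3 := delta_mx 0 2%:R.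

Definition dir2 (i : 'I_2) : R * R :=
  ((i == 0%N :> nat)%:R, (i == 1%N :> nat)%:R).

Definition dir3 (i : 'I_3) : R * R * R :=
  ((i == 0%N :> nat)%:R, (i == 1%N :> nat)%:R, (i == 2%N :> nat)%:R).

End Vectors.

Section Strip.
Context {R : realType}.

Local Notation R2 := (R * R)%type.
Local Notation R3 := (R * R * R)%type.
Local Notation mu1 := (@lebesgue_measure R).
Local Notation mu2 := (@leb2 R).
Local Notation mu3 := (@leb3 R).
Local Notation mu_tx := (@leb_tx R).
Local Notation mu_th := (@leb_th R).

Definition Omega (l : R) : set R3 := [set x | - l < x.2 < l].

(* The two components of the boundary of Omega l are indexed by a boolean:
   false is the upper one, with exterior normal e_3, and true is the lower
   one, with exterior normal - e_3. *)
Definition bdpt (l : R) (b : bool) (xh : R2) : R3 := (xh, (-1) ^+ b * l).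

Definition normal (b : bool) : 'rV[R]_3 := (-1) ^+ b *: e_3.

Definition vavg (l : R) (f : R3 -> R) (xh : R2) : R :=
  (2 * l)^-1 * \int[mu1]_(s in `]- l, l[) f (xh, s).

Definition vavg_t (l : R) (f : R * R3 -> R) (y : R * R2) : R :=
  vavg l (fun x => f (y.1, x)) y.2.

Definition vavge (l : R) (f : R3 -> \bar R) (xh : R2) : \bar R :=
  (((2 * l)^-1)%:E * \int[mu1]_(s in `](- l)%R, l[) f (xh, s))%E.

(* Sobolev spaces on the plane *)

Definition weak_partial2 (i : 'I_2) (f g : R2 -> R) : Prop :=
  forall phi : R2 -> R, test_fun phi ->
    \int[mu2]_x (f x * 'D_(dir2 i) phi x) = - (\int[mu2]_x (g x * phi x)).

Fixpoint Wkinfty (k : nat) (f : R2 -> R) : Prop :=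
  f \in Lfun mu2 +oo%E /\
  if k is k'.+1 then
    forall i, exists g, weak_partial2 i f g /\ Wkinfty k' g
  else True.

Definition H2norm (phi : R2 -> R) : R :=
  Num.sqrt (\int[mu2]_x (phi x ^+ 2)
    + \sum_(i < 2) \int[mu2]_x ('D_(dir2 i) phi x ^+ 2)
    + \sum_(i < 2) \sum_(j < 2)
        \int[mu2]_x ('D_(dir2 j) (fun y => 'D_(dir2 i) phi y) x ^+ 2)).

(* H^-2 is the dual of H^2, in which test functions are dense. *)
Definition Hm2_bounded (I : Type) (J : set I) (F : I -> R2 -> R) : Prop :=
  exists C : R, forall i, J i -> forall phi : R2 -> R, test_fun phi ->
    `| \int[mu2]_x (F i x * phi x) | <= C * H2norm phi.

(* Weak gradients and traces on the strip *)

Definition weak_gradient (l : R) (f : R3 -> R) (g : R3 -> 'rV[R]_3) : Prop :=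
  forall phi : R3 -> R, test_fun phi -> supp phi `<=` Omega l ->
  forall j, \int[mu3]_(x in Omega l) (f x * 'D_(dir3 j) phi x)
            = - (\int[mu3]_(x in Omega l) (g x 0 j * phi x)).

(* h is the trace on the boundary of a function f in H^1(Omega l) with weak
   gradient g: the Gauss-Green formula holds for test functions which do not
   vanish on the boundary. *)
Definition is_trace (l : R) (f : R3 -> R) (g : R3 -> 'rV[R]_3)
    (h : bool -> R2 -> R) : Prop :=
  forall phi : R3 -> R, test_fun phi -> forall j,
    \int[mu3]_(x in Omega l) (f x * 'D_(dir3 j) phi x)
    + \int[mu3]_(x in Omega l) (g x 0 j * phi x)
    = \sum_(b : bool)
        \int[mu2]_xh (h b xh * phi (bdpt l b xh) * normal b 0 j).

(* Classical derivatives on space-time *)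

Definition dt (phi : R * R3 -> R) (z : R * R3) : R := 'D_(1, 0) phi z.

Definition dx (j : 'I_3) (phi : R * R3 -> R) (z : R * R3) : R :=
  'D_(0, dir3 j) phi z.

Definition dtv (psi : R * R3 -> 'rV[R]_3) (z : R * R3) : 'rV[R]_3 :=
  \row_i dt (fun w => psi w 0 i) z.

Definition jac (psi : R * R3 -> 'rV[R]_3) (z : R * R3) : 'M[R]_3 :=
  \matrix_(i, j) dx j (fun w => psi w 0 i) z.

Definition C1b (beta : R -> R) : Prop :=
  [/\ Ck 1 beta, exists M, forall s, `|beta s| <= M &
      exists M, forall s, `|derive1 beta s| <= M].

(* Finite energy weak solutions; Du is the (weak) Jacobian matrix of u and
   gam b is the trace of u on the component b of the boundary. *)
Record weak_solution_with (eps l alpha : R)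
    (rhoin : R3 -> R) (momin : R3 -> 'rV[R]_3)
    (rho : R * R3 -> R) (u : R * R3 -> 'rV[R]_3)
    (Du : R * R3 -> 'M[R]_3) (gam : bool -> R * R2 -> 'rV[R]_3) : Prop := {
  ws_rho_ge0 :
    {ae mu_tx, forall z, 0 <= z.1 -> Omega l z.2 -> 0 <= rho z} ;
  ws_rho_Linfty : forall T : R, 0 < T ->
    LpOn mu_tx (`[0, T[ `*` Omega l) +oo%E rho ;
  ws_u_LinftyL2 : forall T : R, 0 < T -> exists C : R,
    {ae mu1, forall t, 0 <= t < T ->
      (\int[mu3]_(x in Omega l) (normsq (u (t, x)))%:E <= C%:E)%E} ;
  ws_u_L2 : forall T : R, 0 < T -> forall i,
    LpOn mu_tx (`[0, T[ `*` Omega l) 2%:E (fun z => u z 0 i) ;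
  ws_Du_L2 : forall T : R, 0 < T -> forall i j,
    LpOn mu_tx (`[0, T[ `*` Omega l) 2%:E (fun z => Du z i j) ;
  ws_Du : {ae mu1, forall t, 0 <= t -> forall i,
    weak_gradient l (fun x => u (t, x) 0 i) (fun x => row i (Du (t, x)))} ;
  ws_gam_L2 : forall T : R, 0 < T -> forall b i,
    LpOn mu_th (`[0, T[ `*` setT) 2%:E (fun y => gam b y 0 i) ;
  ws_gam : {ae mu1, forall t, 0 <= t -> forall i,
    is_trace l (fun x => u (t, x) 0 i) (fun x => row i (Du (t, x)))
             (fun b xh => gam b (t, xh) 0 i)} ;
  ws_div : {ae mu_tx, forall z, 0 <= z.1 -> Omega l z.2 -> \tr (Du z) = 0} ;
  ws_normal : forall b,
    {ae mu_th, forall y, 0 <= y.1 -> dot (gam b y) (normal b) = 0} ;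
  ws_mass : forall beta : R -> R, C1b beta \/ beta = id ->
    forall phi : R * R3 -> R, test_fun phi ->
    - (\int[mu_tx]_(z in [set t | 0 <= t] `*` Omega l)
         (beta (rho z) * (dt phi z + \sum_(i < 3) u z 0 i * dx i phi z)))
    = \int[mu3]_(x in Omega l) (beta (rhoin x) * phi (0, x)) ;
  ws_momentum : forall psi : R * R3 -> 'rV[R]_3,
    (forall i, test_fun (fun z => psi z 0 i)) ->
    (forall z, 0 <= z.1 -> Omega l z.2 -> \tr (jac psi z) = 0) ->
    (forall t xh b, 0 <= t -> dot (psi (t, bdpt l b xh)) (normal b) = 0) ->
    \int[mu_tx]_(z in [set t | 0 <= t] `*` Omega l)
      (- (rho z * dot (u z) (dtv psi z))
       - rho z * frob ((u z)^T *m u z) (jac psi z)^T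
       + eps^-1 * dot (cross e_3 (rho z *: u z)) (psi z)
       + frob (Du z)^T (jac psi z)^T)
    + 2 * alpha * \sum_(b : bool)
        \int[mu_th]_(y in [set t | 0 <= t] `*` setT)
          dot (gam b y) (psi (y.1, bdpt l b y.2))
    = \int[mu3]_(x in Omega l) dot (momin x) (psi (0, x)) ;
  ws_energy : {ae mu1, forall t, 0 <= t ->
    ((2^-1)%:E * \int[mu3]_(x in Omega l) (rho (t, x) * normsq (u (t, x)))%:E
     + \int[mu_tx]_(z in `[0%R, t] `*` Omega l) (frob (Du z) (Du z))%:E
     + (2 * alpha)%:E * \sum_(b : bool)
         \int[mu_th]_(y in `[0%R, t] `*` setT) (normsq (gam b y))%:E
     <= \int[mu3]_(x in Omega l) (normsq (momin x) / rhoin x)%:E)%E}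
}.

Definition weak_solution (eps l alpha : R)
    (rhoin : R3 -> R) (momin : R3 -> 'rV[R]_3)
    (rho : R * R3 -> R) (u : R * R3 -> 'rV[R]_3) : Prop :=
  exists Du gam, weak_solution_with eps l alpha rhoin momin rho u Du gam.

Definition constant_fun (f : R2 -> R) : Prop := exists c, forall x, f x = c.

Definition grad_norm (f : R2 -> R) (x : R2) : R :=
  Num.sqrt (\sum_(i < 2) 'D_(dir2 i) f x ^+ 2).

(* 1/f on {f <= delta}, 0 elsewhere; here 1/0 = +oo. *)
Definition inv_small (delta : R) (f : R3 -> R) (x : R3) : \bar R :=
  if f x <= delta then (((f x)%:E)^-1)%E else 0%E.

(* E is the range of the parameter epsilon. Division by rhoin in R is
   harmless, since momin vanishes wherever rhoin does. *)
Record admissible_with (E : set R) (l : R -> R) (rho0 : R2 -> R)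
    (rhoin : R -> R3 -> R) (momin : R -> R3 -> 'rV[R]_3)
    (rin : R -> R3 -> R) (rhostar : R) : Prop := {
  ad_rhostar : 0 < rhostar ;
  ad_decomp : forall e, E e -> {ae mu3, forall x, Omega (l e) x ->
    rhoin e x = rho0 x.1 + e * rin e x} ;
  ad_rho0_C2 : Ck 2 rho0 ;
  ad_rho0_W2 : Wkinfty 2 rho0 ;
  ad_rho0_bd : forall xh, 0 <= rho0 xh <= rhostar ;
  ad_rhoin_Linfty : forall e, E e -> LpOn mu3 (Omega (l e)) +oo%E (rhoin e) ;
  ad_rhoin_bd : forall e, E e -> {ae mu3, forall x, Omega (l e) x ->
    0 <= rhoin e x <= 2 * rhostar} ;
  ad_inv : forall e, E e -> exists2 delta, 0 < delta &
    mu3.-integrable (Omega (l e)) (inv_small delta (rhoin e)) ;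
  ad_inv_unif : exists2 delta, 0 < delta & exists C : R, forall e, E e ->
    (\int[mu2]_xh vavge (l e) (inv_small delta (rhoin e)) xh <= C%:E)%E ;
  ad_rin_Linfty : Lp_bounded mu2 E +oo%E (fun e => vavg (l e) (rin e)) ;
  ad_rin_Hm2 : Hm2_bounded E (fun e => vavg (l e) (rin e)) ;
  ad_min_L2 : forall e, E e -> forall i,
    LpOn mu3 (Omega (l e)) 2%:E (fun x => momin e x 0 i) ;
  ad_min_vac : forall e, E e -> {ae mu3, forall x, Omega (l e) x ->
    rhoin e x = 0 -> momin e x = 0} ;
  ad_min_L1 : forall e, E e -> mu3.-integrable (Omega (l e))
    (fun x => (normsq (momin e x) / rhoin e x)%:E) ;
  ad_min_avg : forall i,
    Lp_bounded mu2 E 2%:E (fun e => vavg (l e) (fun x => momin e x 0 i)) ;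
  ad_energy : exists C : R, forall e, E e ->
    (((2 * l e)^-1)%:E * \int[mu1]_(s in `](- l e)%R, l e[)
       \int[mu2]_xh
         (normsq ((Num.sqrt (rhoin e (xh, s)))^-1 *: momin e (xh, s)))%:E
     <= C%:E)%E ;
  ad_nondeg : ~ constant_fun rho0 -> forall K : set R2, compact K ->
    mu2 (K `&` [set x | grad_norm rho0 x <= delta])
      @[delta --> (0 : R)^'+] --> 0%E
}.

Definition admissible (E : set R) (l : R -> R) (rho0 : R2 -> R)
    (rhoin : R -> R3 -> R) (momin : R -> R3 -> 'rV[R]_3) : Prop :=
  exists rin rhostar, admissible_with E l rho0 rhoin momin rin rhostar.

(* The space C^0([0,T]; L^p_w(K)) and the convergence in it *)

Definition C0Lpw (T : R) (K : set R2) (p : \bar R) (f : R -> R2 -> R) : Prop :=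
  (forall t, 0 <= t <= T -> LpOn mu2 K p (f t)) /\
  forall g, LpOn mu2 K (hoelder_conjugate p) g ->
    {within `[0, T], continuous (fun t => \int[mu2]_(x in K) (f t x * g x))}.

Definition cvg_C0Lpw (T : R) (K : set R2) (p : \bar R)
    (f_ : nat -> R -> R2 -> R) (f : R -> R2 -> R) : Prop :=
  [/\ forall n, C0Lpw T K p (f_ n), C0Lpw T K p f &
      forall g, LpOn mu2 K (hoelder_conjugate p) g ->
        {uniform `[0, T],
          (fun n t => \int[mu2]_(x in K) (f_ n t x * g x)) @ \oo -->
          (fun t => \int[mu2]_(x in K) (f t x * g x))}].

(* A function of (t, x_h) defined almost everywhere is identified with its
   representative which is defined at every time of [0, T]. *)
Definition time_repr (T : R) (f : R * R2 -> R) (ft : R -> R2 -> R) : Prop :=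
  {ae mu1, forall t, 0 <= t <= T -> {ae mu2, forall xh, ft t xh = f (t, xh)}}.

End Strip.

(* Main.v *)
(* Only the energy inequality, the traces and the mass equation are used.

   Since the test functions of the trace formula need not vanish on the lower
   boundary, for almost every time u(x_h, s) = gam(x_h) + int_{-l}^s d_3 u, so
   that the L^2 norm of u on the strip is at most 4 l |gam|^2 + 8 l^2 |Du|^2.
   By the energy inequality |Du|^2 <= 2 l C and |gam|^2 <= l C / alpha, hence
   the vertical mean of |u|^2 is O(l / alpha + l^2), which tends to 0.

   The renormalized mass equation, with a truncation vanishing below 2 rho* and
   cutoffs at scale n whose gradients are bounded in L^2 of the plane, gives
   0 <= rho <= 2 rho*. Tested against functions theta(x_h), the mass equation
   then reads, for the vertical mean of rho,
     int rho(t) theta = int rho^in theta + int_0^t (rho u) . grad theta,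
   where the last term is bounded by the mean of |u|^2, uniformly in t, and
   rho^in differs from rho_0^in by O(eps). So the moments against countably many
   theta converge to those of rho_0^in, uniformly in time; the moments against
   any g in L^1 follow by density. The extraction of a subsequence is not needed.

   The equality holds only at almost every time: at the other times, the
   representative of the density is a weak-* limit along good times. *)
Require Import Defs.
From HB Require Import structures.
From mathcomp Require Import all_boot all_order all_algebra.
From mathcomp Require Import all_classical all_reals all_analysis.
From mathcomp Require Import measurable_realfun ess_sup_inf.
From mathcomp Require Import ring lra.

Set Implicit Arguments.
Unset Strict Implicit.
Unset Printing Implicit Defensive.

Import Order.TTheory GRing.Theory Num.Theory.
Import numFieldNormedType.Exports.

Local Open Scope classical_set_scope.
Local Open Scope ring_scope.

(** * Smooth functions and cutoffs *)

(** The equation for the density holds at almost every time only, with a null set depending on the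
    test function. Hence everything runs over the countable family [theta], for which one null set
    serves. Its members are products of one-variable functions, so that derivatives and norms
    factor, and each is a Gaussian times bumps on a rational box: the Gaussian is the integrable
    weight through which a control on the members spreads to boxes, to measurable sets and to all of
    L^1. That spreading, [weak0_rects], is proved along an arbitrary filter, so that it serves for
    limits of sequences, for uniformity in time and for continuity in time alike.

    The flux is linear in the velocity, while only the square of the velocity is known to be small.
    Young's inequality with a free weight [lam] bridges the two, [lam] being fixed before the index
    grows.

    The trace formula in space and the mass equation in time both reduce to a one-variable weak
    equation whose tests do not vanish at the left end point. [weak_derivative1] treats both; the
    boundary value is the moment of the trace in one case and of the initial density in the
    other. *)

Section CkTheory.
Context {R : realType} {V : normedModType R}.
Implicit Types f g : V -> R.

Lemma Ck_continuous k f : Ck k f -> continuous f.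
Proof. by case: k => [|k] []. Qed.

Lemma Ck_derivable k f : Ck k.+1 f -> forall v x, derivable f x v.
Proof. by move=> [_ H] v x; have [] := H v. Qed.

Lemma Ck_derive k f : Ck k.+1 f -> forall v, Ck k (fun x => 'D_v f x).
Proof. by move=> [_ H] v; have [] := H v. Qed.

Lemma CkW k f : Ck k.+1 f -> Ck k f.
Proof.
elim: k f => [|k IH] f /=; first by case.
move=> [cf df]; split => // v; have [d1 d2] := df v; split => //.
exact: IH.
Qed.

Lemma Ck_cst k (c : R) : Ck k (fun _ : V => c).
Proof.
elim: k c => [|k IH] c; split => //; try exact: cst_continuous.
move=> v; split; first by move=> x; exact: derivable_cst.
have -> : (fun x : V => 'D_v (fun=> c) x) = fun=> 0.
  by apply/funext => x; exact: derive_cst.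
exact: IH.
Qed.

Lemma Ck_add k f g : Ck k f -> Ck k g -> Ck k (fun x => f x + g x).
Proof.
elim: k f g => [|k IH] f g Cf Cg; split => //;
  try (by move=> x; apply: cvgD; [exact: (Ck_continuous Cf)|exact: (Ck_continuous Cg)]).
move=> v; split.
  by move=> x; apply: (@derivableD _ _ _ f g); [exact: (Ck_derivable Cf)|exact: (Ck_derivable Cg)].
have -> : (fun x => 'D_v (fun y => f y + g y) x) = fun x => 'D_v f x + 'D_v g x.
  apply/funext => x; apply: (@deriveD _ _ _ f g);
    [exact: (Ck_derivable Cf)|exact: (Ck_derivable Cg)].
by apply: IH; [exact: (Ck_derive Cf)|exact: (Ck_derive Cg)].
Qed.

Lemma Ck_mul k f g : Ck k f -> Ck k g -> Ck k (fun x => f x * g x).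
Proof.
elim: k f g => [|k IH] f g Cf Cg; split => //;
  try (by move=> x; apply: cvgM; [exact: (Ck_continuous Cf)|exact: (Ck_continuous Cg)]).
move=> v; split.
  by move=> x; apply: (@derivableM _ _ f g); [exact: (Ck_derivable Cf)|exact: (Ck_derivable Cg)].
have -> : (fun x => 'D_v (fun y => f y * g y) x) =
    fun x => f x * 'D_v g x + g x * 'D_v f x.
  apply/funext => x; apply: (@deriveM _ _ f g);
    [exact: (Ck_derivable Cf)|exact: (Ck_derivable Cg)].
by apply: Ck_add; apply: IH; [exact: CkW|exact: (Ck_derive Cg)|
  exact: CkW|exact: (Ck_derive Cf)].
Qed.

Lemma smoothD f g : smooth f -> smooth g -> smooth (fun x => f x + g x).
Proof. by move=> sf sg k; exact: Ck_add. Qed.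

Lemma smoothM f g : smooth f -> smooth g -> smooth (fun x => f x * g x).
Proof. by move=> sf sg k; exact: Ck_mul. Qed.

Lemma smooth_cst (c : R) : smooth (fun _ : V => c).
Proof. by move=> k; exact: Ck_cst. Qed.

Lemma smoothZ (c : R) f : smooth f -> smooth (fun x => c * f x).
Proof. by move=> sf; apply: smoothM => //; exact: smooth_cst. Qed.

Lemma smooth_derivable f v x : smooth f -> derivable f x v.
Proof. by move=> sf; exact: (Ck_derivable (sf 1%N)). Qed.

Lemma smooth_continuous f : smooth f -> continuous f.
Proof. by move=> sf; exact: (Ck_continuous (sf 0%N)). Qed.

Lemma smooth_derive f : smooth f -> forall v, smooth (fun x => 'D_v f x).
Proof. by move=> sf v k; exact: (Ck_derive (sf k.+1)). Qed.

Lemma smooth_primitive f : continuous f -> (forall v x, derivable f x v) ->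
  (forall v, smooth (fun x => 'D_v f x)) -> smooth f.
Proof. by move=> cf df sf [|k]; split => // v; split => //; exact: sf. Qed.

Lemma derive_expR_comp f v x : derivable f x v ->
  derivable (expR \o f) x v /\ 'D_v (expR \o f) x = 'D_v f x * expR (f x).
Proof.
move=> df.
(* Restricting to the line through [x] with direction [v] reduces the claim to the one-variable
   chain rule. *)
pose F := (fun h : R => f (h *: v + x)).
have dF : derivable F 0 1 by rewrite -(derivable1P f x v).
have F0 : F 0 = f x by rewrite /F scale0r add0r.
have idF : is_derive (0 : R) (1 : R) F ('D_1 F 0) by exact: derivableP.
have idE : is_derive (F 0) (1 : R) expR (expR (F 0)) by exact: is_derive_expR.
have idc := is_derive1_comp idE idF.
split; first by rewrite (derivable1P (expR \o f) x v); move: idc => [].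
have E g : 'D_v g x = 'D_1 (fun h : R => g (h *: v + x)) 0.
  rewrite /derive; have -> // : (fun h : R => h^-1 *: ((g \o shift x) (h *: v) - g x)) =
    (fun h : R => h^-1 *: (((fun h : R => g (h *: v + x)) \o shift 0) (h *: (1 : R))
       - (fun h : R => g (h *: v + x)) 0)).
  apply/funext => h /=.
  by rewrite scale0r !addr0 add0r /GRing.scale/= mulr1.
rewrite !E; move: idc => [_ /= ->]; rewrite F0.
by rewrite /GRing.scale /= mulrC.
Qed.

Lemma smooth_expR f : smooth f -> smooth (fun x => expR (f x)).
Proof.
move=> sf k; elim: k => [|k IH]; split => //;
  try (by move=> x; apply: continuous_comp; [exact: smooth_continuous|exact: continuous_expR]).
move=> v; split.
  by move=> x; have [] := derive_expR_comp (smooth_derivable (v := v) (x := x) sf).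
have -> : (fun x => 'D_v (fun y => expR (f y)) x) = fun x => 'D_v f x * expR (f x).
  by apply/funext => x; have [] := derive_expR_comp (smooth_derivable (v := v) (x := x) sf).
by apply: Ck_mul => //; exact: (smooth_derive sf).
Qed.

End CkTheory.

Section CkLinear.
Context {R : realType} {V W : normedModType R}.
Variable L : V -> W.
Hypothesis Llin : forall h v x, L (h *: v + x) = h *: L v + L x.
Hypothesis cL : continuous L.

(** By linearity the difference quotients of [f \o L] at [x] along [v] and of [f] at [L x] along
    [L v] are the same function of [h]. *)
Lemma derive_lin_comp (f : W -> R) v x :
  (derivable f (L x) (L v) -> derivable (f \o L) x v) /\
  'D_v (f \o L) x = 'D_(L v) f (L x).
Proof.
have E : (fun h : R => h^-1 *: (((f \o L) \o shift x) (h *: v) - (f \o L) x)) =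
    (fun h : R => h^-1 *: ((f \o shift (L x)) (h *: L v) - f (L x))).
  by apply/funext => h /=; rewrite Llin.
by split; [rewrite /derivable E|rewrite /derive E].
Qed.

Lemma smooth_lin_comp (f : W -> R) : smooth f -> smooth (f \o L).
Proof.
move=> sf k; elim: k f sf => [|k IH] f sf; split => //;
  try (by move=> x; apply: continuous_comp; [exact: cL|exact: smooth_continuous]).
move=> v; split.
  by move=> x; apply: (derive_lin_comp f v x).1; exact: smooth_derivable.
have -> : (fun x => 'D_v (f \o L) x) = (fun y => 'D_(L v) f y) \o L.
  by apply/funext => x; rewrite (derive_lin_comp f v x).2.
by apply: IH; exact: smooth_derive.
Qed.

End CkLinear.

Section Tensor.
Context {R : realType} {V W : normedModType R}.
Implicit Types (f : V -> R) (g : W -> R).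

Definition tens f g (z : V * W) : R := f z.1 * g z.2.

Let fst_lin (h : R) (v x : V * W) : (h *: v + x).1 = h *: v.1 + x.1.
Proof. by []. Qed.

Let snd_lin (h : R) (v x : V * W) : (h *: v + x).2 = h *: v.2 + x.2.
Proof. by []. Qed.

Let cfst : continuous (fst : V * W -> V).
Proof. by move=> z; exact: cvg_fst. Qed.

Let csnd : continuous (snd : V * W -> W).
Proof. by move=> z; exact: cvg_snd. Qed.

Lemma smooth_tens f g : smooth f -> smooth g -> smooth (tens f g).
Proof.
move=> sf sg; apply: smoothM.
  exact: (smooth_lin_comp fst_lin cfst).
exact: (smooth_lin_comp snd_lin csnd).
Qed.

Lemma derive_tens f g (v z : V * W) : smooth f -> smooth g ->
  'D_v (tens f g) z = 'D_(v.1) f z.1 * g z.2 + f z.1 * 'D_(v.2) g z.2.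
Proof.
move=> sf sg; rewrite (_ : tens f g = (f \o fst) * (g \o snd))//.
rewrite deriveM; last 2 first.
- by apply: (derive_lin_comp fst_lin f v z).1; exact: smooth_derivable.
- by apply: (derive_lin_comp snd_lin g v z).1; exact: smooth_derivable.
rewrite (derive_lin_comp fst_lin f v z).2 (derive_lin_comp snd_lin g v z).2.
by rewrite addrC /GRing.scale /= [g _ * _]mulrC.
Qed.

Lemma test_fun_tens f g : test_fun f -> test_fun g -> test_fun (tens f g).
Proof.
move=> [sf cf] [sg cg]; split; first exact: smooth_tens.
apply: (@subclosed_compact _ _ (supp f `*` supp g)).
- exact: closed_closure.
- exact: compact_setX.
- have cl : closed (supp f `*` supp g).
    apply: compact_closed; last exact: compact_setX.
    exact: norm_hausdorff.
  rewrite ((closure_id _).1 cl) /supp; apply: closureS => z /=.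
  rewrite /tens mulf_eq0 negb_or => /andP[fz gz].
  by split; apply: subset_closure.
Qed.

End Tensor.

(** * A function flat at the origin *)

Section FlatExp.
Context {R : realType}.
Implicit Types (x : R) (n k : nat).

(* The derivatives of [flat 0] are linear combinations of these functions. *)
Definition flat n x : R := if 0 < x then x^-1 ^+ n * expR (- x^-1) else 0.

Lemma flat_ge0 n x : 0 <= flat n x.
Proof.
rewrite /flat; case: ifPn => // x0.
by rewrite mulr_ge0 ?expR_ge0// exprn_ge0// invr_ge0 ltW.
Qed.

Lemma flat0_gt0 n x : 0 < x -> 0 < flat n x.
Proof. by move=> x0; rewrite /flat x0 mulr_gt0 ?expR_gt0// exprn_gt0// invr_gt0. Qed.

Lemma flat_le0 n x : x <= 0 -> flat n x = 0.
Proof. by rewrite /flat ltNge => ->. Qed.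

(** The exponential dominates each single term of its power series. *)
Lemma pow_expRN n (y : R) : 0 <= y -> y ^+ n * expR (- y) <= n`!%:R.
Proof.
move=> y0; rewrite expRN ler_pdivrMr ?expR_gt0//; case: n => [|n].
  by rewrite fact0 mul1r expr0 -expR0 ler_expR.
rewrite -ler_pdivrMl ?ltr0n ?fact_gt0// mulrC.
by apply: le_trans (expR_ge1Dxn n y0); rewrite lerDr.
Qed.

Lemma flat_bounded n x : flat n x <= n`!%:R.
Proof.
rewrite /flat; case: ifPn => x0; last by rewrite ler0n.
by apply: pow_expRN; rewrite invr_ge0 ltW.
Qed.

(** Two powers of [x^-1] are traded for [x ^+ 2] in [pow_expRN]. Quadratic decay at the origin is
    what makes the derivative exist and vanish there. *)
Lemma flat_sqr n x : `|flat n x| <= n.+2`!%:R * x ^+ 2.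
Proof.
rewrite ger0_norm ?flat_ge0//.
rewrite {1}/flat; case: ifPn => x0; last by rewrite mulr_ge0 ?sqr_ge0 ?ler0n.
have := @pow_expRN n.+2 x^-1; rewrite invr_ge0 => /(_ (ltW x0)) H.
rewrite -ler_pdivrMr ?exprn_gt0//; apply: le_trans H.
by rewrite -exprVn mulrAC -exprD addn2.
Qed.

Lemma is_derive_flat n x : is_derive x 1 (flat n) (flat n.+2 x - n%:R * flat n.+1 x).
Proof.
have [x0|x0|->] := ltgtP x 0.
- rewrite /flat !ltNge (ltW x0)/= mulr0 subr0.
  apply: (@near_eq_is_derive _ _ _ (fun=> 0)).
    by near=> y; rewrite /flat ltNge ltW //; near: y; exact: lt_nbhsl.
- have xn0 : x != 0 by rewrite gt_eqF.
  apply: (@near_eq_is_derive _ _ _ (fun y : R => y^-1 ^+ n * expR (- y^-1))).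
  + by near=> y; rewrite /flat ifT //; near: y; exact: lt_nbhsr.
  + have dV : is_derive x (1 : R) (fun y : R => y^-1) (- x ^- 2).
      apply: is_derive_eq; first exact: is_deriveV.
      by rewrite /GRing.scale /= mulr1.
    have dE : is_derive x (1 : R) (expR \o (fun y : R => - y^-1))
        (expR (- x^-1) * (x ^- 2)).
      apply: is_derive1_comp.
      by apply: is_derive_eq; rewrite opprK.
    have dX : is_derive x (1 : R) (fun y : R => y^-1 ^+ n)
        (- n%:R * x^-1 ^+ n.+1).
      case: n => [|n].
        by rewrite oppr0 mul0r; exact: is_derive_cst.
      have -> : (fun y : R => y^-1 ^+ n.+1) = (fun y : R => y^-1) ^+ n.+1.
        by rewrite exprfctE.
      apply: is_derive_eq.
      rewrite /GRing.scale /=; rewrite -exprVn !exprS expr0 -mulr_natl; ring.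
    have := is_deriveM dX dE; rewrite !fctE => dM; apply: (is_derive_eq dM).
    rewrite /GRing.scale /= /flat x0 -exprVn !exprS expr0; ring.
(* At the origin the claimed derivative is 0, and by [flat_sqr] the difference quotient at [h] is at
   most a constant times the modulus of [h]. *)
- rewrite /flat ltxx mulr0 subr0.
  have cv : (h : R)^-1 *: ((flat n \o shift (0 : R)) (h *: (1 : R)) - flat n 0)
      @[h --> 0^'] --> (0 : R).
    apply/cvgrPdist_le => e e0.
    near=> h.
    rewrite /= addr0 (flat_le0 n (lexx 0)) subr0 sub0r normrN /GRing.scale /= mulr1.
    have h0 : h != 0 by near: h; exact: nbhs_dnbhs_neq.
    rewrite normrM normfV ler_pdivrMl ?normr_gt0//.
    apply: (le_trans (flat_sqr n h)).
    rewrite -normr_id -real_normK ?num_real// normr_id expr2 mulrA mulrC ler_wpM2l//.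
    rewrite -ler_pdivlMl ?ltr0n ?fact_gt0//.
    near: h; apply: nbhs_dnbhs.
    exists (n.+2`!%:R^-1 * e) => /=.
      by rewrite mulr_gt0// invr_gt0 ltr0n fact_gt0.
    by move=> z /=; rewrite sub0r normrN => /ltW.
  by split; [apply/cvg_ex; exists 0|exact/cvg_lim].
Unshelve. all: by end_near. Qed.

Lemma derive_flat n x : 'D_1 (flat n) x = flat n.+2 x - n%:R * flat n.+1 x.
Proof. by have [] := is_derive_flat n x. Qed.

Lemma derivable_flat n x : derivable (flat n) x 1.
Proof. by have [] := is_derive_flat n x. Qed.

End FlatExp.

Section Smooth1.
Context {R : realType}.
Implicit Types (f : R -> R).

Lemma derive_dir1 f (v x : R) : derivable f x 1 ->
  derivable f x v /\ 'D_v f x = v * 'D_1 f x.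
Proof.
move=> /derivable1_diffP df; split; first exact: diff_derivable.
rewrite !deriveE// -[v in LHS](mulr1) (_ : v * 1 = v *: 1)//.
by rewrite linearZ.
Qed.

Lemma smooth1_primitive f : (forall x, derivable f x 1) ->
  smooth (fun x => 'D_1 f x) -> smooth f.
Proof.
move=> df sf; apply: smooth_primitive.
- by move=> x; apply/differentiable_continuous/derivable1_diffP.
- by move=> v x; have [] := @derive_dir1 f v x (df x).
- move=> v; have -> : (fun x => 'D_v f x) = fun x => v * 'D_1 f x.
    by apply/funext => x; rewrite (@derive_dir1 f v x (df x)).2.
  exact: smoothZ.
Qed.

(** The induction on the order keeps [n] general, because differentiating [flat n] produces
    [flat n.+1] and [flat n.+2]. *)
Lemma smooth_flat n : smooth (@flat R n).
Proof.
move=> k; elim: k n => [|k IH] n; split => //;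
  try (by move=> x; exact/differentiable_continuous/derivable1_diffP/(@derivable_flat R n x)).
move=> v; split; first by move=> x; have [] := @derive_dir1 (flat n) v x (@derivable_flat R n x).
have -> : (fun x => 'D_v (flat n) x) =
    fun x => v * (flat n.+2 x + (- n%:R) * flat n.+1 x).
  apply/funext => x.
  by rewrite (@derive_dir1 (flat n) v x (@derivable_flat R n x)).2 derive_flat mulNr.
apply: Ck_mul; first exact: Ck_cst.
by apply: Ck_add => //; apply: Ck_mul => //; exact: Ck_cst.
Qed.

Lemma smooth_affine f (a b : R) : smooth f -> smooth (fun x => f (a * x + b)).
Proof.
move=> sf k; elim: k f sf => [|k IH] f sf; split => //;
  try (by move=> x; apply: (@continuous_comp _ _ _ (fun x => a * x + b) f);
    [apply: cvgD; [apply: cvgM; [exact: cvg_cst|exact: cvg_id]|exact: cvg_cst]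
    |exact: smooth_continuous]).
have E v x : (fun h : R => h^-1 *: (((fun x => f (a * x + b)) \o shift x) (h *: v)
      - f (a * x + b))) =
    (fun h : R => h^-1 *: ((f \o shift (a * x + b)) (h *: (a * v)) - f (a * x + b))).
  apply/funext => h /=; congr (_ *: (f _ - _)).
  by rewrite /GRing.scale /=; ring.
move=> v; split.
  by move=> x; rewrite /derivable E; exact: smooth_derivable.
have -> : (fun x => 'D_v (fun x => f (a * x + b)) x) =
    fun x => 'D_(a * v) f (a * x + b).
  by apply/funext => x; rewrite /derive E.
by apply: (IH (fun x => 'D_(a * v) f x)); exact: smooth_derive.
Qed.

End Smooth1.

Section Measure0.
Context d {T : measurableType d} {R : realType}.
Variable mu : {measure set T -> \bar R}.

Lemma integrable_bounded_supp (f : T -> R) (A : set T) (M : R) :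
  measurable_fun setT f -> measurable A -> (mu A < +oo)%E ->
  (forall x, `|f x| <= M) -> (forall x, ~ A x -> f x = 0) ->
  mu.-integrable setT (EFin \o f).
Proof.
move=> mf mA Afin fM f0.
have fE : f = f \_ A.
  apply/funext => x; rewrite patchE; case: ifPn => // xA.
  by apply: f0; move: xA; rewrite notin_setE.
have -> : EFin \o f = (EFin \o f) \_ A by rewrite restrict_EFin -fE.
apply/integrable_restrict => //; rewrite setTI.
apply: (@le_integrable _ _ _ mu _ mA _ (EFin \o cst M)).
- exact/measurable_EFinP/measurable_funTS.
- by move=> x _ /=; rewrite lee_fin (le_trans (fM x))// ler_norm.
- apply/integrableP; split; first exact/measurable_EFinP/measurable_cst.
  by rewrite /= integral_cst// lte_mul_pinfty// lee_fin.
Qed.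

End Measure0.

Section Bump.
Context {R : realType}.
Implicit Types (f g : R -> R) (a b c x L : R) (k : nat).

Lemma test_fun1 f a b : smooth f -> (forall x, ~ (a <= x <= b) -> f x = 0) ->
  test_fun f.
Proof.
move=> sf f0; split => //.
apply: (@subclosed_compact _ _ `[a, b]).
- exact: closed_closure.
- exact: segment_compact.
- have cl : closed `[a, b] by exact: itv_closed.
  rewrite ((closure_id _).1 cl) /supp; apply: closureS => x /= fx.
  rewrite in_itv /=; apply: contrapT => /f0 fx0; by rewrite fx0 eqxx in fx.
Qed.

Lemma test_fun_supp f : test_fun f ->
  exists2 L, 0 < L & forall x, L < `|x| -> \forall y \near x, f y = 0.
Proof.
move=> [_ /compact_bounded [M [_ Mb]]]; exists (`|M| + 1).
  by rewrite ltr_wpDl.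
move=> x xM.
have nx : ~ supp f x.
  move=> sx; have M1 : M < `|M| + 1 by rewrite (le_lt_trans (ler_norm M))// ltrDl.
  by have := Mb _ M1 x sx; rewrite /= leNgt xM.
have : nbhs x (~` supp f).
  by apply: open_nbhs_nbhs; split => //; exact/closed_openC/closed_closure.
apply: filterS => y ny; apply: contrapT => fy; apply: ny.
by apply: subset_closure => /=; exact/eqP.
Qed.

Lemma test_fun_derive f : test_fun f -> test_fun (fun x => 'D_1 f x).
Proof.
move=> tf; have [sf _] := tf.
have [L L0 fL] := test_fun_supp tf.
apply: (@test_fun1 _ (- L) L); first exact: smooth_derive.
move=> x xL; have : L < `|x| by rewrite ltNge ler_norml; apply/negP.
move=> /fL f0; rewrite (@near_eq_derive _ _ _ f (fun=> 0))//.
exact: derive_cst.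
Qed.

Lemma test_fun_bounded f : test_fun f ->
  exists M L, [/\ 0 < L, forall x, `|f x| <= M & forall x, L < `|x| -> f x = 0].
Proof.
move=> tf; have [L L0 fL] := test_fun_supp tf.
have [sf _] := tf.
have cf : {within `[- L, L], continuous f}.
  by apply: continuous_subspaceT; exact: smooth_continuous.
have LL : - L <= L by rewrite ge0_cp// ltW.
have [x1 _ H1] := EVT_max LL cf.
have [x2 _ H2] := EVT_min LL cf.
have fL0 x : L < `|x| -> f x = 0 by move=> /fL /nbhs_singleton.
exists (`|f x1| + `|f x2|), L; split => // x.
have [xL|/fL0 ->] := leP `|x| L; last by rewrite normr0 addr_ge0.
have xi : x \in `[- L, L] by rewrite in_itv /= -ler_norml.
rewrite ler_norml; apply/andP; split.
  rewrite lerNl; apply: (@le_trans _ _ (- f x2)); first by rewrite lerN2 H2.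
  by rewrite (le_trans (ler_norm _))// normrN lerDr.
by apply: le_trans (H1 _ xi) _; rewrite (le_trans (ler_norm _))// lerDl.
Qed.

Lemma smooth1_measurable f : smooth f ->
  measurable_fun (setT : set (measurableTypeR R)) f.
Proof. by move=> sf; apply: continuous_measurable_fun; exact: smooth_continuous. Qed.

Lemma lebesgue_itvcc_fin a b : (@lebesgue_measure R `[a, b]%classic < +oo)%E.
Proof. by rewrite lebesgue_measure_itv /=; case: ifP => //; rewrite ltry. Qed.

Lemma test_fun_integrable f : test_fun f ->
  (@lebesgue_measure R).-integrable setT (EFin \o f).
Proof.
move=> tf; have [M [L [L0 fM fL]]] := test_fun_bounded tf; have [sf _] := tf.
apply: (@integrable_bounded_supp _ _ _ lebesgue_measure f `[- L, L]%classic M) => //.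
- exact: smooth1_measurable.
- exact: lebesgue_itvcc_fin.
- by move=> x /= /negP; rewrite in_itv /= -ler_norml -ltNge => /fL.
Qed.

(** The parameter [k] pushes the values towards 1 inside []a, b[]: the family is smooth, stays
    between 0 and 1, vanishes outside the interval and tends pointwise to its indicator. Dominated
    convergence can then exchange indicators and test functions. *)
Definition bump k a b x : R :=
  1 - expR (- (k%:R * (flat 0 (x - a) * flat 0 (b - x)))).

Lemma smooth_bump k a b : smooth (bump k a b).
Proof.
have E : bump k a b = fun x => 1 + (-1) *
   expR ((- k%:R) * (flat 0 (1 * x + (- a)) * flat 0 ((- 1) * x + b))).
  by apply/funext => x; rewrite /bump mulN1r mul1r mulNr mulN1r [b - x]addrC.
rewrite E; apply: smoothD; first exact: smooth_cst.
apply/smoothZ/smooth_expR/smoothZ/smoothM; apply: smooth_affine; exact: smooth_flat.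
Qed.

Lemma bump_out k a b x : ~~ (a < x < b) -> bump k a b x = 0.
Proof.
rewrite negb_and -!leNgt /bump => /orP[xa|bx].
  by rewrite (@flat_le0 _ _ (x - a)) ?subr_le0// mul0r mulr0 oppr0 expR0 subrr.
by rewrite (@flat_le0 _ _ (b - x)) ?subr_le0// !mulr0 oppr0 expR0 subrr.
Qed.

Lemma bump_ge0 k a b x : 0 <= bump k a b x.
Proof.
by rewrite /bump subr_ge0 expR_le1 oppr_le0 mulr_ge0// mulr_ge0// flat_ge0.
Qed.

Lemma bump_le1 k a b x : bump k a b x <= 1.
Proof. by rewrite /bump lerBlDr lerDl expR_ge0. Qed.

Lemma bump_gt0 a b x : a < x < b -> 0 < bump 1 a b x.
Proof.
move=> /andP[ax xb]; rewrite /bump subr_gt0 expR_lt1 oppr_lt0 mulr_gt0//.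
by rewrite mulr_gt0// flat0_gt0 ?subr_gt0.
Qed.

Lemma bump_cvg a b x : bump k a b x @[k --> \oo] --> (\1_(`]a, b[%classic) x : R).
Proof.
rewrite indicE; have [ab|nab] := boolP (a < x < b); last first.
  rewrite memNset; last by rewrite /= in_itv /=; exact/negP.
  rewrite (_ : (fun k => _) = fun=> 0); first exact: cvg_cst.
  by apply/funext => k; exact: bump_out.
rewrite mem_set; last by rewrite /= in_itv.
rewrite -[X in _ --> X]subr0; apply: cvgB; first exact: cvg_cst.
have g0 : 0 < flat 0 (x - a) * flat 0 (b - x).
  by case/andP: ab => ax xb; rewrite mulr_gt0// flat0_gt0// subr_gt0.
set g := _ * _ in g0 *.
have E : (fun k : nat => expR (- (k%:R * g))) = (fun k => expR (- g) ^+ k).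
  by apply/funext => k; rewrite -expRM_natl mulrN.
rewrite E; apply: cvg_expr; rewrite ger0_norm ?expR_ge0//.
by rewrite expR_lt1 oppr_lt0.
Qed.

Lemma test_fun_bump k a b : test_fun (bump k a b).
Proof.
apply: (@test_fun1 _ a b); first exact: smooth_bump.
move=> x H; apply: bump_out; apply/negP => /andP[ax xb]; apply: H.
by rewrite !ltW.
Qed.

Definition prim f x : R := \int[lebesgue_measure]_(t in `]-oo, x]) f t.

Lemma prim_smooth f : test_fun f -> smooth (prim f) /\ forall x, 'D_1 (prim f) x = f x.
Proof.
move=> tf; have [sf _] := tf.
have H x : derivable (prim f) x 1 /\ derive1 (prim f) x = f x.
  apply: (@continuous_FTC1 R f -oo%O x (x + 1)).
  - by rewrite ltrDl.
  - by apply: (integrableS measurableT) => //; exact: test_fun_integrable.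
  - by rewrite ltNyr.
  - exact: smooth_continuous.
have E x : 'D_1 (prim f) x = f x by rewrite -derive1E; have [] := H x.
split => //; apply: smooth1_primitive; first by move=> x; have [] := H x.
by rewrite (_ : (fun x => 'D_1 (prim f) x) = f)//; apply/funext.
Qed.

Lemma prim_eq0 f a x : (forall y, y <= a -> f y = 0) -> x <= a -> prim f x = 0.
Proof.
move=> f0 xa; rewrite /prim (@eq_Rintegral _ _ _ _ _ (fun=> 0)).
  by rewrite /Rintegral integral0.
by move=> y; rewrite inE /= in_itv /= => yx; apply: f0; exact: le_trans yx xa.
Qed.

Lemma prim_sub f x y : test_fun f -> x <= y ->
  prim f y - prim f x = \int[lebesgue_measure]_(t in `]x, y]) f t.
Proof.
move=> tf xy; rewrite /prim.
apply: (@Rintegral_itvB R f -oo%O (BRight y) x).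
- by apply: (integrableS measurableT) => //; exact: test_fun_integrable.
- by [].
- by rewrite bnd_simp.
Qed.

Lemma prim_ge b f x : test_fun f -> (forall y, b <= y -> f y = 0) -> b <= x ->
  prim f x = prim f b.
Proof.
move=> tf f0 bx; apply/eqP; rewrite -subr_eq0 prim_sub//; apply/eqP.
rewrite (@eq_Rintegral _ _ _ _ _ (fun=> 0)).
  by rewrite /Rintegral integral0.
by move=> y; rewrite inE /= in_itv /= => /andP[/ltW xy _]; apply: f0; exact: le_trans xy.
Qed.

Lemma prim_nd f x y : test_fun f -> (forall x, 0 <= f x) -> x <= y ->
  prim f x <= prim f y.
Proof. by move=> tf f0 xy; rewrite -subr_ge0 prim_sub// Rintegral_ge0. Qed.

(** Otherwise the nondecreasing primitive would vanish on all of []0, 1[], and so would its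
    derivative at the midpoint, where the bump is positive. *)
Lemma prim_bump_gt0 : 0 < prim (bump 1 0 1) 1.
Proof.
have tb := test_fun_bump 1 0 1.
have p0 : prim (bump 1 0 1) 0 = 0.
  by apply: (@prim_eq0 _ 0) => // y y0; apply: bump_out; rewrite ltNge y0.
rewrite lt0r; apply/andP; split; last first.
  by rewrite -[leLHS]p0; apply: prim_nd => // x; exact: bump_ge0.
apply/eqP => H.
have [sp dp] := prim_smooth tb.
have z x : 0 < x < 1 -> prim (bump 1 0 1) x = 0.
  move=> /andP[x0 x1]; apply/eqP; rewrite eq_le; apply/andP; split.
    by rewrite -[leRHS]H; apply: prim_nd => //; [exact: bump_ge0|exact: ltW].
  by rewrite -[leLHS]p0; apply: prim_nd => //; [exact: bump_ge0|exact: ltW].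
have h0 : 0 < (2^-1 : R) by rewrite invr_gt0.
have h1 : (2^-1 : R) < 1 by rewrite invf_lt1 ?ltr1n.
have h01 : 0 < (2^-1 : R) < 1 by rewrite h0 h1.
have : 'D_1 (prim (bump 1 0 1)) (2^-1 : R) = 0.
  rewrite (@near_eq_derive _ _ _ _ (fun=> 0)); first exact: derive_cst.
  have : nbhs (2^-1 : R) `]0, 1[%classic by exact: near_in_itvoo.
  by apply: filterS => y /=; rewrite in_itv /= => /z.
rewrite dp => h; have := bump_gt0 h01; by rewrite h ltxx.
Qed.

Definition step x : R := prim (bump 1 0 1) x / prim (bump 1 0 1) 1.

Lemma smooth_step : smooth step.
Proof.
rewrite (_ : step = fun x => (prim (bump 1 0 1) 1)^-1 * prim (bump 1 0 1) x).
  by apply: smoothZ; have [] := prim_smooth (test_fun_bump 1 0 1).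
by apply/funext => x; rewrite /step mulrC.
Qed.

Lemma step0 x : x <= 0 -> step x = 0.
Proof.
move=> x0; rewrite /step (@prim_eq0 _ 0)// ?mul0r// => y y0.
by apply: bump_out; rewrite ltNge y0.
Qed.

Lemma step1 x : 1 <= x -> step x = 1.
Proof.
move=> x1; rewrite /step (@prim_ge 1)//.
- by rewrite divff// gt_eqF// prim_bump_gt0.
- exact: test_fun_bump.
- by move=> y y1; apply: bump_out; rewrite negb_and -!leNgt y1 orbT.
Qed.

Lemma step_ge0 x : 0 <= step x.
Proof.
rewrite divr_ge0 ?(ltW prim_bump_gt0)//.
by rewrite /prim Rintegral_ge0// => y _; exact: bump_ge0.
Qed.

Definition cut L x : R := step (x + L + 1) * step (L + 1 - x).

Lemma smooth_cut L : smooth (cut L).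
Proof.
rewrite (_ : cut L = fun x => step (1 * x + (L + 1)) * step ((-1) * x + (L + 1))).
  by apply: smoothM; apply: smooth_affine; exact: smooth_step.
by apply/funext => x; rewrite /cut mul1r mulN1r addrA [- x + _]addrC.
Qed.

Lemma cut1 L x : `|x| <= L -> cut L x = 1.
Proof.
rewrite ler_norml => /andP[h1 h2]; rewrite /cut !step1 ?mulr1//; lra.
Qed.

Lemma cut0 L x : L + 1 <= `|x| -> cut L x = 0.
Proof.
rewrite ler_normr => /orP[h|h]; rewrite /cut.
  by rewrite [X in _ * X]step0 ?mulr0//; lra.
by rewrite step0 ?mul0r//; lra.
Qed.

Lemma cut_ge0 L x : 0 <= cut L x.
Proof. by rewrite mulr_ge0// step_ge0. Qed.

Lemma test_fun_cut L : test_fun (cut L).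
Proof.
apply: (@test_fun1 _ (- (L + 1)) (L + 1)); first exact: smooth_cut.
by move=> x /negP; rewrite -ler_norml -ltNge => /ltW/cut0.
Qed.

Lemma derive_cut L x : `|x| < L -> 'D_1 (cut L) x = 0.
Proof.
rewrite ltr_norml => xL.
rewrite (@near_eq_derive _ _ _ _ (cst (1 : R))); first exact: derive_cst.
have : nbhs x `](- L), L[%classic by exact: near_in_itvoo.
by apply: filterS => y /=; rewrite in_itv /= -ltr_norml => /ltW/cut1.
Qed.

(** The primitive of [f] that vanishes from [b] on is in general a nonzero constant far to the left.
    It is cut off below [c], where the equations it will be tested in carry no mass. *)
Lemma test_fun_primitive f b c : test_fun f -> (forall y, b <= y -> f y = 0) ->
  exists psi, [/\ test_fun psi, forall s, b <= s -> psi s = 0,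
    forall s, c <= s -> 'D_1 psi s = f s &
    forall s, c <= s -> psi s = prim f s - prim f b].
Proof.
move=> tf fb; have [sp dp] := prim_smooth tf.
(* The transition takes place between [c - 2] and [c - 1]. The remaining unit of margin makes the
   derivative correct at [s = c] too. *)
pose psi s := step (s - c + 2) * (prim f s - prim f b).
have psiE s : c - 1 <= s -> psi s = prim f s - prim f b.
  by move=> cs; rewrite /psi step1 ?mul1r//; lra.
exists psi; split => //.
- apply: (@test_fun1 _ (c - 2) b).
    rewrite (_ : psi = fun s => step (1 * s + (2 - c)) * (prim f s + (- prim f b))).
      apply: smoothM; first exact/smooth_affine/smooth_step.
      by apply: smoothD => //; exact: smooth_cst.
    by apply/funext => s; rewrite /psi; congr (step _ * _); ring.
  move=> s /negP; rewrite negb_and -!ltNge => /orP[h|/ltW h].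
    by rewrite /psi step0 ?mul0r//; lra.
  by rewrite /psi (prim_ge tf fb h) subrr mulr0.
- by move=> s bs; rewrite /psi (prim_ge tf fb bs) subrr mulr0.
- move=> s cs; rewrite (@near_eq_derive _ _ _ _ (prim f - cst (prim f b))).
    rewrite deriveB ?derive_cst ?dp ?subr0//.
    exact: smooth_derivable.
  have : nbhs s `](c - 1), (s + 1)[%classic.
    by apply: near_in_itvoo; rewrite in_itv /=; apply/andP; split; lra.
  by apply: filterS => y /=; rewrite in_itv /= => /andP[/ltW/psiE].
- by move=> s cs; apply: psiE; lra.
Qed.

End Bump.

(** * Integrals and null sets *)

Section MeasureTheory.
Context d {T : measurableType d} {R : realType}.
Variable mu : {measure set T -> \bar R}.
Implicit Types (f g h : T -> R).

Local Notation intg f := (mu.-integrable setT (EFin \o f)).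

Lemma ae_imp (P Q : T -> Prop) : (forall x, P x -> Q x) ->
  {ae mu, forall x, P x} -> {ae mu, forall x, Q x}.
Proof. by move=> PQ; apply: filterS. Qed.

Lemma ae_imp2 (P1 P2 Q : T -> Prop) : (forall x, P1 x -> P2 x -> Q x) ->
  {ae mu, forall x, P1 x} -> {ae mu, forall x, P2 x} -> {ae mu, forall x, Q x}.
Proof. by move=> PQ; apply: filterS2. Qed.

Lemma ae_imp3 (P1 P2 P3 Q : T -> Prop) : (forall x, P1 x -> P2 x -> P3 x -> Q x) ->
  {ae mu, forall x, P1 x} -> {ae mu, forall x, P2 x} -> {ae mu, forall x, P3 x} ->
  {ae mu, forall x, Q x}.
Proof. by move=> PQ; apply: filterS3. Qed.

Lemma ae_forall_count (I : countType) (P : I -> T -> Prop) :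
  (forall i, {ae mu, forall x, P i x}) -> {ae mu, forall x, forall i, P i x}.
Proof.
move=> H.
have : {ae mu, forall x, forall n : nat,
    if unpickle n is Some i then P i x else True}.
  apply/ae_foralln => n; case: (unpickle n) => [i|]; first exact: H.
  exact: aeW.
by apply: filterS => x Hx i; have := Hx (pickle i); rewrite pickleK.
Qed.

Lemma integrable_EFin_measurable f : intg f -> measurable_fun setT f.
Proof. by move=> /integrableP[/measurable_EFinP]. Qed.

Lemma integrable_dom f g : measurable_fun setT f -> intg g ->
  (forall x, `|f x| <= g x) -> intg f.
Proof.
move=> mf ig fg; apply: (le_integrable measurableT _ _ ig).
- exact/measurable_EFinP.
- by move=> x _ /=; rewrite lee_fin (le_trans (fg x))// ler_norm.
Qed.

Lemma integrable_add f g : intg f -> intg g -> intg (fun x => f x + g x).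
Proof. by move=> i1 i2; exact: (integrableD measurableT i1 i2). Qed.

Lemma integrable_sub f g : intg f -> intg g -> intg (fun x => f x - g x).
Proof. by move=> i1 i2; exact: (integrableB measurableT i1 i2). Qed.

Lemma integrable_scale c f : intg f -> intg (fun x => c * f x).
Proof. by move=> i1; exact: (integrableZl measurableT c i1). Qed.

Lemma integrable_mul_bounded (M : R) f g : intg f -> measurable_fun setT g ->
  (forall x, `|g x| <= M) -> intg (fun x => g x * f x).
Proof.
move=> i1 mg gM.
apply: (@integrable_dom _ (fun x => M * `|f x|)).
- by apply: measurable_funM => //; exact: integrable_EFin_measurable.
- apply: integrable_scale.
  have := integrable_abse i1.
  by rewrite (_ : abse \o (EFin \o f) = EFin \o (fun x => `|f x|)).
- by move=> x; rewrite normrM ler_wpM2r.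
Qed.

Lemma integrable_norm f : intg f -> intg (fun x => `|f x|).
Proof.
move=> /integrable_abse.
by rewrite (_ : abse \o (EFin \o f) = EFin \o (fun x => `|f x|)).
Qed.

Lemma integrable_indic (A : set T) f : measurable A -> intg f ->
  intg (fun x => f x * \1_A x).
Proof.
move=> mA i1; rewrite (_ : (fun x => _) = fun x => \1_A x * f x); last first.
  by apply/funext => x; rewrite mulrC.
apply: (@integrable_mul_bounded 1) => //.
by move=> x; rewrite indicE; case: (_ \in _); rewrite ?normr1// normr0.
Qed.

Lemma EFin_Rintegral f : intg f -> ((\int[mu]_x f x)%:E = \int[mu]_x (f x)%:E)%E.
Proof. by move=> i1; rewrite /Rintegral fineK//; exact: integrable_fin_num. Qed.

Lemma Rintegral_indic (A : set T) f : measurable A ->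
  \int[mu]_x (f x * \1_A x) = \int[mu]_(x in A) f x.
Proof.
move=> mA; rewrite [RHS]Rintegral_mkcond; congr (Rintegral mu setT _); apply/funext => x.
rewrite patchE indicE; case: ifPn => _; by rewrite ?mulr1 ?mulr0.
Qed.

Lemma le_Rintegral_dom f g : intg f -> intg g -> (forall x, `|f x| <= g x) ->
  `|\int[mu]_x f x| <= \int[mu]_x g x.
Proof.
move=> i1 i2 fg; apply: (le_trans (le_normr_Rintegral measurableT i1)).
apply: le_Rintegral => //; first exact: integrable_norm.
Qed.

(** Replacing [g] by its maximum with the modulus of [f] makes the domination pointwise and alters
    [g] on a null set only. *)
Lemma integrable_ae_dom f g : measurable_fun setT f -> intg g ->
  {ae mu, forall x, `|f x| <= g x} -> intg f.
Proof.
move=> mf ig fg.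
pose g' x := Num.max `|f x| (g x).
have mg' : measurable_fun setT g'.
  by apply: measurable_maxr; [exact: measurableT_comp|exact: integrable_EFin_measurable].
apply: (@integrable_dom _ g') => //; last by move=> x; rewrite /g' le_max lexx.
move/integrableP: ig => [mg gfin]; apply/integrableP; split.
  exact/measurable_EFinP.
rewrite (_ : integral _ _ _ = \int[mu]_x `|(EFin \o g) x|)%E//.
apply: ae_eq_integral => //.
- by apply: measurableT_comp => //; exact/measurable_EFinP.
- exact: measurableT_comp.
- by apply: filterS fg => x fgx _ /=; rewrite /g' max_r.
Qed.

Lemma Rintegral_dct (f_ : nat -> T -> R) (f g : T -> R) :
  (forall n, measurable_fun setT (f_ n)) -> measurable_fun setT f ->
  (forall x, f_ n x @[n --> \oo] --> f x) -> intg g ->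
  (forall n x, `|f_ n x| <= g x) ->
  [/\ intg f, \int[mu]_x `|f_ n x - f x| @[n --> \oo] --> (0 : R) &
     \int[mu]_x f_ n x @[n --> \oo] --> \int[mu]_x f x].
Proof.
move=> mf_ mf cf ig fg.
have [|||||i1 i2 i3] := @dominated_convergence _ _ _ mu setT measurableT
  (fun n => EFin \o f_ n) (EFin \o f) (EFin \o g).
- by move=> n; exact/measurable_EFinP.
- exact/measurable_EFinP.
- by apply: aeW => x _; apply: cvg_EFin; [exact: nearW|exact: cf].
- exact: ig.
- by apply: aeW => x n _ /=; rewrite lee_fin.
have if_ n : intg (f_ n) by exact: (integrable_dom (mf_ n) ig).
split => //.
- move: i2.
  have E n : (\int[mu]_x `|(EFin \o f_ n) x - (EFin \o f) x| =
      (\int[mu]_x `|f_ n x - f x|)%:E)%E.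
    rewrite EFin_Rintegral//; apply: integrable_norm; exact: integrable_sub.
  rewrite (_ : [sequence _]_n = (fun n => (\int[mu]_x `|f_ n x - f x|)%:E)).
    exact: fine_cvg.
  by apply/funext => n; exact: E.
- by apply: fine_cvg; rewrite EFin_Rintegral.
Qed.

End MeasureTheory.

(* The Lebesgue integral of the library is a lower integral, so that it does
   not see null sets even when the functions are not measurable. *)
Section NonMeasurable.
Context d {T : measurableType d} {R : realType}.
Variable mu : {measure set T -> \bar R}.
Import HBNNSimple.
Local Open Scope ereal_scope.

Lemma le_integral_ae_nonmeas (f g : T -> \bar R) :
  (forall x, 0 <= f x) -> (forall x, 0 <= g x) ->
  {ae mu, forall x, f x <= g x} -> \int[mu]_x f x <= \int[mu]_x g x.
Proof.
move=> f0 g0 [N [mN N0 fg]].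
rewrite [leLHS]ge0_integralTE//; apply: ge_ereal_sup => _ [h hf <-].
(* Setting the simple function [h] to zero on the null set [N] keeps its integral and puts it below
   [g] everywhere. *)
pose h' := proj_nnsfun h (measurableC mN).
have -> : sintegral mu h = sintegral mu h'.
  rewrite -!integralT_nnsfun; apply: ge0_ae_eq_integral => //.
  - exact/measurable_EFinP.
  - exact/measurable_EFinP.
  - by move=> x _; rewrite lee_fin.
  - by move=> x _; rewrite lee_fin.
  - exists N; split => // x /= nx; apply: contrapT => Nx; apply: nx => _.
    by rewrite mindicE mem_set// mulr1.
rewrite [leRHS]ge0_integralTE//; apply: ereal_sup_ubound => /=.
exists h' => // x; rewrite /= mindicE.
have [Nx|Nx] := pselect (N x).
  by rewrite memNset ?mulr0//= => /(_ Nx).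
rewrite mem_set// mulr1 (le_trans (hf x))//.
by apply: contrapT => fgx; apply: Nx; apply: fg.
Qed.

Lemma integral_ae_nonmeas (f g : T -> \bar R) :
  {ae mu, forall x, f x = g x} -> \int[mu]_x f x = \int[mu]_x g x.
Proof.
move=> fg; rewrite [LHS]integralE [RHS]integralE; congr (_ - _).
- apply/eqP; rewrite eq_le; apply/andP; split; apply: le_integral_ae_nonmeas => //;
    by apply: filterS fg => x; rewrite !funeposE => ->.
- apply/eqP; rewrite eq_le; apply/andP; split; apply: le_integral_ae_nonmeas => //;
    by apply: filterS fg => x; rewrite !funenegE => ->.
Qed.

Lemma Rintegral_ae_eq (f g : T -> R) : {ae mu, forall x, f x = g x} ->
  (\int[mu]_x f x = \int[mu]_x g x)%R.
Proof.
move=> fg; congr fine; apply: integral_ae_nonmeas.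
by apply: filterS fg => x ->.
Qed.

End NonMeasurable.

Lemma le_abse_fine {R : realDomainType} (z : \bar R) : (`|fine z|%:E <= `|z|)%E.
Proof. by case: z => [r| |] //=; rewrite normr0 leey. Qed.

Section ProductMeasure.
Context d1 d2 {T1 : measurableType d1} {T2 : measurableType d2} {R : realType}.
Variables (m1 : {sigma_finite_measure set T1 -> \bar R})
          (m2 : {sigma_finite_measure set T2 -> \bar R}).
Variable m : {measure set (T1 * T2) -> \bar R}.
(** The constants [leb2], [leb3], [leb_tx] and [leb_th] are products as set functions but carry
    measure structures of their own. Fubini's theorems are therefore stated for any [m] with the
    values of a product. *)
Hypothesis mE : (m : set _ -> _) = (m1 \x m2)%E.

Local Lemma integral_prodE D (f : T1 * T2 -> \bar R) :
  (\int[m]_(z in D) f z = \int[m1 \x m2]_(z in D) f z)%E.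
Proof. by apply: eq_measure_integral => A mA _; rewrite mE. Qed.

Lemma integrable_prodE (f : T1 * T2 -> \bar R) :
  m.-integrable setT f <-> (m1 \x m2)%E.-integrable setT f.
Proof. by split => /integrableP[mf fi]; apply/integrableP; rewrite integral_prodE in fi *. Qed.

Lemma tonelli1 (f : T1 * T2 -> \bar R) : measurable_fun setT f ->
  (forall z, 0 <= f z)%E ->
  (\int[m]_z f z = \int[m1]_x \int[m2]_y f (x, y))%E.
Proof. by move=> mf f0; rewrite integral_prodE fubini_tonelli1. Qed.

Lemma tonelli2 (f : T1 * T2 -> \bar R) : measurable_fun setT f ->
  (forall z, 0 <= f z)%E ->
  (\int[m]_z f z = \int[m2]_y \int[m1]_x f (x, y))%E.
Proof. by move=> mf f0; rewrite integral_prodE fubini_tonelli2. Qed.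

(** Tonelli is applied to the indicator of a measurable null set [N] that covers the exceptions, so
    almost every section of [N] is null. *)
Lemma ae_prod1 (P : T1 * T2 -> Prop) : {ae m, forall z, P z} ->
  {ae m1, forall x, {ae m2, forall y, P (x, y)}}.
Proof.
move=> [N [mN N0 PN]].
have : (\int[m1]_x \int[m2]_y (\1_N (x, y))%:E = 0)%E.
  rewrite -(@tonelli1 (EFin \o \1_N)) ?integral_indic ?setIT//.
  - exact/measurable_EFinP.
  - by move=> z /=; rewrite lee_fin.
move=> I0.
have mI : measurable_fun setT (fun x => \int[m2]_y (\1_N (x, y))%:E)%E.
  apply: (measurable_fun_fubini_tonelli_F (EFin \o \1_N)) => //.
  - exact/measurable_EFinP.
  - by move=> z /=; rewrite lee_fin.
have : {ae m1, forall x, (\int[m2]_y (\1_N (x, y))%:E = 0)%E}.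
  have : ae_eq m1 setT (fun x => \int[m2]_y (\1_N (x, y))%:E)%E (cst 0%E).
    apply: (ae_eq_integral_abs m1 measurableT mI).1; rewrite -[RHS]I0.
    apply: eq_integral => x _; rewrite gee0_abs//.
    by apply: integral_ge0 => y _; rewrite lee_fin.
  by apply: filterS => x /(_ I).
apply: filterS => x Hx.
exists (xsection N x); split; first exact: measurable_xsection.
  rewrite -Hx -(setIT (xsection N x)) -integral_indic//; last exact: measurable_xsection.
  apply: eq_integral => y _; congr EFin; rewrite !indicE; congr (_%:R).
  by congr nat_of_bool; apply/idP/idP; rewrite mem_xsection.
by move=> y /= Py; rewrite /xsection /= inE; apply: PN.
Qed.

Lemma integrable_fubini1 (f : T1 * T2 -> R) : m.-integrable setT (EFin \o f) ->
  m1.-integrable setT (EFin \o (fun x => \int[m2]_y f (x, y))).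
Proof.
move=> /integrable_prodE i1.
have iF := integrable_fubini_F i1.
have mF : measurable_fun setT (fun x => \int[m2]_y f (x, y)).
  by apply: measurableT_comp => //; exact: measurable_int iF.
move/integrableP : (iF) => [mF' Ffin].
apply/integrableP; split; first exact/measurable_EFinP.
apply: le_lt_trans Ffin; apply: ge0_le_integral => //.
- by apply: measurableT_comp => //; exact/measurable_EFinP.
- exact: measurableT_comp.
- by move=> x _; exact: le_abse_fine.
Qed.

Lemma Rfubini1 (f : T1 * T2 -> R) : m.-integrable setT (EFin \o f) ->
  \int[m]_z f z = \int[m1]_x \int[m2]_y f (x, y).
Proof.
move=> i0; have /integrable_prodE i1 := i0.
rewrite {1}/Rintegral (@integral_prodE setT (EFin \o f)) -(integral12_prod_meas1 i1).
congr fine; apply: ae_eq_integral => //.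
- exact: (measurable_fubini_F i1).
- by have /integrableP[] := integrable_fubini1 i0.
- have := ae_integrable1 i1; apply: filterS => x Hx _.
  rewrite /fubini_F /= EFin_Rintegral//.
Qed.

Lemma ae_fubini1 (f : T1 * T2 -> R) : m.-integrable setT (EFin \o f) ->
  {ae m1, forall x, m2.-integrable setT (EFin \o (fun y => f (x, y)))}.
Proof. by move=> /integrable_prodE /ae_integrable1. Qed.

Lemma integrable_fubini2 (f : T1 * T2 -> R) : m.-integrable setT (EFin \o f) ->
  m2.-integrable setT (EFin \o (fun y => \int[m1]_x f (x, y))).
Proof.
move=> /integrable_prodE i1.
have mG := measurable_fubini_G i1.
have mF : measurable_fun setT (fun y => \int[m1]_x f (x, y)).
  exact: measurableT_comp.
have [mf _] := integrableP _ _ _ i1.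
apply/integrableP; split; first exact/measurable_EFinP.
apply: le_lt_trans ((integrable21ltyP m1 m2 mf).1 i1).
apply: ge0_le_integral => //.
- by apply: measurableT_comp => //; exact/measurable_EFinP.
- apply: (measurable_fun_fubini_tonelli_G (abse \o (EFin \o f))) => //.
  + exact: measurableT_comp.
  + by move=> z; exact: abse_ge0.
- move=> y _; apply: le_trans (le_abse_fine _) _.
  apply: le_abse_integral => //; exact: (measurableT_comp mf (measurable_pair2 y)).
Qed.

Lemma ae_fubini2 (f : T1 * T2 -> R) : m.-integrable setT (EFin \o f) ->
  {ae m2, forall y, m1.-integrable setT (EFin \o (fun x => f (x, y)))}.
Proof. by move=> /integrable_prodE /ae_integrable2. Qed.

Lemma Rfubini2 (f : T1 * T2 -> R) : m.-integrable setT (EFin \o f) ->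
  \int[m]_z f z = \int[m2]_y \int[m1]_x f (x, y).
Proof.
move=> i0; have /integrable_prodE i1 := i0.
rewrite {1}/Rintegral (@integral_prodE setT (EFin \o f)) -(integral21_prod_meas1 i1).
congr fine; apply: ae_eq_integral => //.
- exact: (measurable_fubini_G i1).
- by have /integrableP[] := integrable_fubini2 i0.
- have := ae_integrable2 i1; apply: filterS => y Hy _.
  rewrite /fubini_G /= EFin_Rintegral//.
Qed.

End ProductMeasure.

(** * Generating families of intervals and rectangles *)

Section Generators.
Context {R : realType}.

(** Rational end points keep the boxes, and the test functions built on them, countable. *)
Definition rat_itv : set (set R) :=
  [set A | exists a b : rat, A = `]ratr a, ratr b[%classic].

Lemma rat_itv_setI : setI_closed rat_itv.
Proof.
move=> _ _ [a [b ->]] [c [d ->]]; exists (Num.max a c), (Num.min b d).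
have rmax (x y : rat) : ratr (Num.max x y) = Num.max (ratr x) (ratr y) :> R.
  by rewrite !maxEle ler_rat; case: ifP.
have rmin (x y : rat) : ratr (Num.min x y) = Num.min (ratr x) (ratr y) :> R.
  by rewrite !minEle ler_rat; case: ifP.
rewrite rmax rmin; apply/seteqP; split => x /=; rewrite !in_itv /= gt_max lt_min.
  by move=> [/andP[-> ->] /andP[-> ->]].
by move=> /andP[/andP[-> ->] /andP[-> ->]].
Qed.

Lemma rat_itv_gen : @measurable _ (measurableTypeR R) = <<s rat_itv >>.
Proof.
rewrite [LHS](RGenOpens.measurableE R) eqEsubset; split.
  apply: smallest_sub; first exact: smallest_sigma_algebra.
  move=> _ [x [y ->]].
  have -> : `]x, y[%classic = \bigcup_(q : rat * rat)
      (if (x <= ratr q.1) && (ratr q.2 <= y) then `]ratr q.1 : R, ratr q.2[%classic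
       else set0).
    apply/seteqP; split => z /=.
      rewrite in_itv /= => /andP[xz zy].
      have [a] := rat_in_itvoo xz; rewrite in_itv /= => /andP[xa az].
      have [b] := rat_in_itvoo zy; rewrite in_itv /= => /andP[zb bY].
      by exists (a, b) => //=; rewrite (ltW xa) (ltW bY) /= in_itv /= az zb.
    move=> [q _ /=]; case: ifP => // /andP[xq qy] /=; rewrite !in_itv /=.
    by move=> /andP[h1 h2]; rewrite (le_lt_trans xq h1) (lt_le_trans h2 qy).
  have -> : \bigcup_(q : rat * rat)
      (if (x <= ratr q.1) && (ratr q.2 <= y) then `]ratr q.1 : R, ratr q.2[%classic
       else set0) = \bigcup_(n : nat) (if unpickle n is Some q then
      (if (x <= ratr q.1) && (ratr q.2 <= y) then `]ratr q.1 : R, ratr q.2[%classic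
       else set0) else set0).
    apply/seteqP; split => z /=.
      by move=> [q _ Hq]; exists (pickle q); [exact: I|rewrite pickleK; exact: Hq].
    move=> [n _]; case: (unpickle n) => [q Hq|[]].
      by exists q; [exact: I|exact: Hq].
  apply: (@bigcupT_measurable _ (g_sigma_algebraType rat_itv)) => n.
  case: (unpickle n) => [q|]; last exact: measurable0.
  case: ifP => _; last exact: measurable0.
  by apply: sub_sigma_algebra; exists q.1, q.2.
apply: smallest_sub; first exact: smallest_sigma_algebra.
by move=> _ [a [b ->]]; apply: sub_sigma_algebra; exists (ratr a), (ratr b).
Qed.

Definition rat_itvn (n : nat) : set R :=
  `]ratr (- n%:R : rat), ratr (n%:R : rat)[%classic.

Lemma rat_itvn_itv n : rat_itv (rat_itvn n).
Proof. by exists (- n%:R), n%:R. Qed.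

Lemma mem_rat_itvn (x : R) : \forall n \near \oo, rat_itvn n x.
Proof.
near=> n; rewrite /rat_itvn /= in_itv /= rmorphN /= ratr_nat -ltr_norml.
have : `|x| + 1 <= n%:R by near: n; exact: nbhs_infty_ger.
by apply: lt_le_trans; rewrite ltrDl.
Unshelve. all: by end_near. Qed.

End Generators.

Section ProductGenerators.
Context d1 d2 {T1 : measurableType d1} {T2 : measurableType d2}.
Variables (G1 : set (set T1)) (G2 : set (set T2)).
Hypotheses (g1 : @measurable _ T1 = <<s G1 >>) (g2 : @measurable _ T2 = <<s G2 >>).
Variables (F1 : nat -> set T1) (F2 : nat -> set T2).
Hypotheses (GF1 : forall n, G1 (F1 n)) (GF2 : forall n, G2 (F2 n)).
Hypotheses (F1T : \bigcup_n F1 n = setT) (F2T : \bigcup_n F2 n = setT).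

Definition rects : set (set (T1 * T2)) := [set A `*` B | A in G1 & B in G2].

Lemma rects_setI : setI_closed G1 -> setI_closed G2 -> setI_closed rects.
Proof.
move=> I1 I2 _ _ [A GA [B GB <-]] [C GC [D GD <-]].
exists (A `&` C); first exact: I1.
exists (B `&` D); first exact: I2.
by rewrite setXI.
Qed.

(** Two passes of the same argument: with one side fixed, the admissible other sides form a
    sigma-algebra. Complements are taken inside a full strip, which the exhaustions [F1] and [F2]
    produce as a countable union. *)
Lemma rects_gen : @measurable _ (T1 * T2)%type = <<s rects >>.
Proof.
pose S := g_sigma_algebraType rects.
have G12 A B : G1 A -> G2 B -> <<s rects >> (A `*` B).
  by move=> GA GB; apply: sub_sigma_algebra; exists A => //; exists B.
have H1 A B : measurable A -> G2 B -> <<s rects >> (A `*` B).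
  rewrite g1 => + GB; move: A; apply: smallest_sub; last by move=> A GA; exact: G12.
  have TB : <<s rects >> (setT `*` B).
    rewrite -F1T setX_bigcupl; apply: (@bigcupT_measurable _ S) => n.
    exact: G12.
  split => /=.
  - by rewrite set0X; exact: (@measurable0 _ S).
  - move=> A mA; rewrite setTD.
    have -> : ~` A `*` B = (setT `*` B) `\` (A `*` B).
      apply/seteqP; split => -[x y] /=; first by move=> [nA By]; split => //; case.
      by move=> [[_ By] nAB]; split => // Ax; apply: nAB.
    exact: (@measurableD _ S).
  - by move=> F mF; rewrite setX_bigcupl; exact: (@bigcupT_measurable _ S).
rewrite measurable_prod_measurableType eqEsubset; split.
  apply: smallest_sub; first exact: smallest_sigma_algebra.
  move=> _ [A mA [B mB <-]]; move: B mB; rewrite g2.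
  apply: smallest_sub; last by move=> B GB; exact: H1.
  have AT : <<s rects >> (A `*` setT).
    rewrite -F2T setX_bigcupr; apply: (@bigcupT_measurable _ S) => n.
    exact: H1.
  split => /=.
  - by rewrite setX0; exact: (@measurable0 _ S).
  - move=> B mB; rewrite setTD.
    have -> : A `*` ~` B = (A `*` setT) `\` (A `*` B).
      apply/seteqP; split => -[x y] /=; first by move=> [Ax nB]; split => //; case.
      by move=> [[Ax _] nAB]; split => // By; apply: nAB.
    exact: (@measurableD _ S).
  - by move=> F mF; rewrite setX_bigcupr; exact: (@bigcupT_measurable _ S).
apply: smallest_sub; first exact: smallest_sigma_algebra.
move=> _ [A GA [B GB <-]]; apply: sub_sigma_algebra; exists A.
  by rewrite g1; exact: sub_sigma_algebra.
by exists B => //; rewrite g2; exact: sub_sigma_algebra.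
Qed.

End ProductGenerators.

Section Fundamental.
Context d {T : measurableType d} {R : realType}.
Variable mu : {measure set T -> \bar R}.
Variables (G : set (set T)) (F : nat -> set T).
Hypotheses (GI : setI_closed G) (gG : @measurable _ T = <<s G >>).
Hypotheses (GF : forall n, G (F n)) (FT : forall x, \forall n \near \oo, F n x).

Local Notation intg f := (mu.-integrable setT (EFin \o f)).

Let GM A : G A -> measurable A.
Proof. by rewrite gG; exact: sub_sigma_algebra. Qed.

Lemma cvg_indic_exhaust (f : T -> R) x : f x * \1_(F n) x @[n --> \oo] --> f x.
Proof.
apply: cvg_near_cst; apply: filterS (FT x) => n Fnx.
by rewrite indicE mem_set// mulr1.
Qed.

(** Dynkin's theorem: the sets over which [V] integrates to 0 are closed under complements and
    disjoint unions. For complements the integral over the whole space must vanish, which follows by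
    dominated convergence along the exhaustion [F]. *)
Lemma ae_eq0_rects (V : T -> R) : intg V ->
  (forall A, G A -> \int[mu]_(x in A) V x = 0) -> {ae mu, forall x, V x = 0}.
Proof.
move=> iV V0.
have mV := integrable_EFin_measurable iV.
pose P := [set A : set T | measurable A /\ \int[mu]_(x in A) V x = 0].
have PT : \int[mu]_x V x = 0.
  have [|||||_ _] := @Rintegral_dct _ _ _ mu (fun n x => V x * \1_(F n) x) V (fun x => `|V x|).
  - by move=> n; apply: measurable_funM => //; apply: measurable_indic; exact/GM/GF.
  - by [].
  - exact: cvg_indic_exhaust.
  - exact: integrable_norm.
  - move=> n x; rewrite normrM indicE; case: (_ \in _); by rewrite ?normr1 ?mulr1// normr0 mulr0.
  have -> : (fun n => \int[mu]_x (V x * \1_(F n) x)) = fun=> 0.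
    by apply/funext => n; rewrite Rintegral_indic ?V0//; exact/GM/GF.
  by move=> H; apply: (cvg_unique (@Rhausdorff R) H); exact: cvg_cst.
have PA A : measurable A -> \int[mu]_(x in A) V x = 0.
  rewrite gG; apply: (@dynkin_induction _ T G (fun A => \int[mu]_(x in A) V x = 0)) => //.
  - move=> S mS S0; have := PT; rewrite -(setUv S) Rintegral_setU ?S0 ?add0r//.
    + exact: measurableC.
    + by rewrite setUv.
    + by apply/disj_setPS; rewrite setICr.
  - move=> F' mF tF F0; rewrite /Rintegral integral_bigcup//; last first.
      by apply: (integrableS measurableT) => //; exact: bigcupT_measurable.
    rewrite eseries0// => n _ _.
    have := F0 n; rewrite /Rintegral => h; rewrite -[LHS]fineK ?h//.
    by apply: integrable_fin_num => //; exact: (integrableS measurableT).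
have : ae_eq mu setT (EFin \o V) (cst 0%E).
  apply: integral_ae_eq => // E _ mE; rewrite integral0.
  rewrite -[LHS]fineK; first by congr EFin; exact: PA.
  by apply: integrable_fin_num => //; exact: (integrableS measurableT).
by apply: filterS => x /(_ I) [].
Qed.

End Fundamental.

(** * Weak convergence in L^1 duality *)

Section WeakL1.
Context d {T : measurableType d} {R : realType}.
Variable mu : {measure set T -> \bar R}.
Context {J : Type} (F : set_system J) {FF : Filter F}.
Variables (phi : J -> T -> R) (C : R).
Hypotheses (C0 : 0 < C) (mphi : forall j, measurable_fun setT (phi j)).
Hypothesis phiC : forall j x, `|phi j x| <= C.

Local Notation intg f := (mu.-integrable setT (EFin \o f)).

(* [phi] tends to 0 against [g]; below, [F] encodes convergence, uniform
   convergence in time and uniform continuity in time alike. *)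
Definition weak0 (g : T -> R) : Prop :=
  \int[mu]_x (phi j x * g x) @[j --> F] --> (0 : R).

Lemma integrable_phiM j g : intg g -> intg (fun x => phi j x * g x).
Proof. by move=> ig; apply: (integrable_mul_bounded ig (mphi j) (phiC j)). Qed.

Lemma weak0D g h : intg g -> intg h -> weak0 g -> weak0 h ->
  weak0 (fun x => g x + h x).
Proof.
move=> ig ih pg ph; rewrite /weak0.
have E j : \int[mu]_x (phi j x * (g x + h x)) =
    \int[mu]_x (phi j x * g x) + \int[mu]_x (phi j x * h x).
  rewrite -RintegralD//; [|exact: integrable_phiM..].
  by congr (Rintegral mu setT _); apply/funext => x; rewrite mulrDr.
have -> : (fun j => \int[mu]_x (phi j x * (g x + h x))) =
  (fun j => \int[mu]_x (phi j x * g x) + \int[mu]_x (phi j x * h x)) by exact/funext.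
have H : (fun j => \int[mu]_x (phi j x * g x) + \int[mu]_x (phi j x * h x)) @ F -->
  (0 + 0 : R) by apply: cvgD; [exact: pg|exact: ph].
by rewrite addr0 in H; exact: H.
Qed.

Lemma weak0Z c g : intg g -> weak0 g -> weak0 (fun x => c * g x).
Proof.
move=> ig pg; rewrite /weak0.
have E j : \int[mu]_x (phi j x * (c * g x)) = c * \int[mu]_x (phi j x * g x).
  rewrite -RintegralZl//; last exact: integrable_phiM.
  by congr (Rintegral mu setT _); apply/funext => x; rewrite mulrCA.
have -> : (fun j => \int[mu]_x (phi j x * (c * g x))) =
  (fun j => c * \int[mu]_x (phi j x * g x)) by exact/funext.
have H : (fun j => c * \int[mu]_x (phi j x * g x)) @ F --> (c * 0 : R).
  by apply: cvgM; [exact: cvg_cst|exact: pg].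
by rewrite mulr0 in H; exact: H.
Qed.

(** The uniform bound [C] makes the pairing with [phi j] Lipschitz in the L^1 norm, with a constant
    independent of [j]. *)
Lemma weak0_lim (g_ : nat -> T -> R) g : (forall n, intg (g_ n)) -> intg g ->
  \int[mu]_x `|g_ n x - g x| @[n --> \oo] --> (0 : R) ->
  (forall n, weak0 (g_ n)) -> weak0 g.
Proof.
move=> ig_ ig cg pg; apply/cvgrPdist_le => e e0.
have e2 : 0 < e / 2 by rewrite divr_gt0.
have [n _ Hn] : \forall n \near \oo, \int[mu]_x `|g_ n x - g x| <= e / 2 / C.
  move/cvgrPdist_le : cg => /(_ (e / 2 / C)); rewrite divr_gt0// => /(_ isT).
  by apply: filterS => n; rewrite sub0r normrN; apply: le_trans; rewrite ler_norm.
have {}Hn := Hn n (leqnn n).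
move/cvgrPdist_le : (pg n) => /(_ (e / 2) e2); apply: filterS => j.
rewrite !sub0r !normrN => H1.
have -> : \int[mu]_x (phi j x * g x) = \int[mu]_x (phi j x * g_ n x)
    - \int[mu]_x (phi j x * (g_ n x - g x)).
  rewrite -RintegralB//; first last.
  - by apply: integrable_phiM; exact: integrable_sub.
  - exact: integrable_phiM.
  by congr (Rintegral mu setT _); apply/funext => x; ring.
apply: (le_trans (ler_normB _ _)); rewrite [leRHS](splitr e) lerD//.
have i1 : intg (fun x => `|g_ n x - g x|).
  by apply: integrable_norm; exact: integrable_sub.
apply: (@le_trans _ _ (\int[mu]_x (C * `|g_ n x - g x|))).
  apply: le_Rintegral_dom.
  - by apply: integrable_phiM; exact: integrable_sub.
  - exact: integrable_scale.
  - by move=> x; rewrite normrM ler_wpM2r.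
by rewrite RintegralZl// mulrC -ler_pdivlMr.
Qed.

Lemma weak0_dct (g_ : nat -> T -> R) (g h : T -> R) : (forall n, measurable_fun setT (g_ n)) ->
  measurable_fun setT g -> (forall x, g_ n x @[n --> \oo] --> g x) -> intg h ->
  (forall n x, `|g_ n x| <= h x) -> (forall n, weak0 (g_ n)) -> weak0 g.
Proof.
move=> mg_ mg cg ih gh pg.
have [ig c1 _] := Rintegral_dct mg_ mg cg ih gh.
by apply: (weak0_lim _ ig c1) => // n; exact: (integrable_dom (mg_ n) ih).
Qed.

(** A positive integrable weight gives sense to the pairing with indicators of sets of infinite
    measure, so that complements can be used in the Dynkin argument. *)
Variable w : T -> R.
Hypotheses (w0 : forall x, 0 < w x) (iw : intg w).

Let mw : measurable_fun setT w := integrable_EFin_measurable iw.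

Let mwA A : measurable A -> measurable_fun setT (fun x => w x * \1_A x).
Proof. by move=> mA; apply: measurable_funM. Qed.

Let wA_le A x : `|w x * \1_A x| <= w x.
Proof.
rewrite normrM gtr0_norm// ler_piMr//; first exact: ltW.
by rewrite indicE; case: (_ \in _); rewrite ?normr1// normr0.
Qed.

Import HBNNSimple.

(** A nonnegative [g] is the increasing limit of [w] times the simple approximations of [g / w],
    with [g] itself as majorant; a general [g] is split into its positive and negative parts. *)
Lemma weak0_all : (forall A, measurable A -> weak0 (fun x => w x * \1_A x)) ->
  forall g, intg g -> weak0 g.
Proof.
move=> HA.
have Hs (h : {nnsfun T >-> R}) : weak0 (fun x => w x * h x).
  have Hl (l : seq R) : weak0 (fun x => \sum_(r <- l) r * (w x * \1_(h @^-1` [set r]) x)) /\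
      intg (fun x => \sum_(r <- l) r * (w x * \1_(h @^-1` [set r]) x)).
    elim: l => [|r l [IH1 IH2]].
      have -> : (fun x => \sum_(r <- [::]) r * (w x * \1_(h @^-1` [set r]) x)) = fun=> 0.
        by apply/funext => x; rewrite big_nil.
      split; last by apply: (integrable_dom _ iw) => // x; rewrite normr0 ltW.
      rewrite (_ : (fun=> 0) = fun x => 0 * (w x * \1_setT x)).
        by apply: weak0Z; [exact: integrable_indic|exact: HA].
      by apply/funext => x; rewrite mul0r.
    have -> : (fun x => \sum_(r <- r :: l) r * (w x * \1_(h @^-1` [set r]) x)) =
        fun x => r * (w x * \1_(h @^-1` [set r]) x) +
          \sum_(r <- l) r * (w x * \1_(h @^-1` [set r]) x).
      by apply/funext => x; rewrite big_cons.
    have ir : intg (fun x => w x * \1_(h @^-1` [set r]) x) by exact: integrable_indic.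
    split; last by apply: integrable_add => //; exact: integrable_scale.
    apply: weak0D => //; first exact: integrable_scale.
    by apply: weak0Z => //; exact: HA.
  have [+ _] := Hl (finmap.enum_fset (fset_set (range h))).
  rewrite (_ : (fun x => _) = fun x => w x * h x)//; apply/funext => x.
  rewrite [in RHS](fimfunE h x) fsbig_finite//= mulr_sumr.
  by apply: eq_bigr => r _; rewrite mulrCA.
have Hpos (g : T -> R) : (forall x, 0 <= g x) -> intg g -> weak0 g.
  move=> g0 ig; have mg := integrable_EFin_measurable ig.
  have mgw : measurable_fun setT (EFin \o (fun x => g x / w x)).
    apply/measurable_EFinP; apply: measurable_funM => //.
    rewrite (_ : (fun x => (w x)^-1) = (@powR R ^~ (-1)) \o w).
      by apply: measurableT_comp => //; exact: measurable_powR.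
    by apply/funext => x /=; rewrite powR_inv1 ?ltW.
  pose h n := nnsfun_approx measurableT mgw n.
  have hle n x : h n x <= g x / w x.
    rewrite -lee_fin; rewrite /h nnsfun_approxE; apply: (@le_approx _ _ _ setT (fun x => (g x / w x)%:E)) => //.
    by move=> y _ /=; rewrite lee_fin divr_ge0// ltW.
  apply: (@weak0_dct (fun n x => w x * h n x) g g) => //.
  - by move=> n; apply: measurable_funM.
  - move=> x; have -> : g x = w x * (g x / w x) by rewrite mulrCA divff ?mulr1// gt_eqF.
    apply: cvgMr.
    have : (EFin \o (fun n => h n x)) @ \oo --> (g x / w x)%:E.
      apply: (@cvg_nnsfun_approx _ _ _ setT measurableT _ mgw _ x I).
      by move=> y _ /=; rewrite lee_fin divr_ge0// ltW.
    by move/fine_cvg.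
  - move=> n x; rewrite ger0_norm; last by apply: mulr_ge0 => //; exact: ltW.
    by have := hle n x; rewrite ler_pdivlMr// mulrC.
move=> g ig.
have E : g = fun x => Num.max (g x) 0 + (-1) * Num.max (- g x) 0.
  apply/funext => x; rewrite mulN1r /Num.max.
  by do 2 case: ifPn; rewrite -?leNgt; lra.
have mg := integrable_EFin_measurable ig.
have i1 : intg (fun x => Num.max (g x) 0).
  apply: (integrable_dom _ (integrable_norm ig)); first exact: measurable_maxr.
  by move=> x; rewrite ger0_norm ?le_max ?lexx ?orbT// ge_max ler_norm normr_ge0.
have i2 : intg (fun x => Num.max (- g x) 0).
  apply: (integrable_dom _ (integrable_norm ig)).
    by apply: measurable_maxr => //; exact: measurable_funN.
  by move=> x; rewrite ger0_norm ?le_max ?lexx ?orbT// ge_max -normrN ler_norm normr_ge0.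
rewrite E; apply: weak0D => //; first exact: integrable_scale.
  by apply: Hpos => // x; rewrite le_max lexx orbT.
by apply: weak0Z => //; apply: Hpos => // x; rewrite le_max lexx orbT.
Qed.

Variables (G : set (set T)) (E : nat -> set T).
Hypotheses (GI : setI_closed G) (gG : @measurable _ T = <<s G >>).
Hypotheses (GE : forall n, G (E n)) (ET : forall x, \forall n \near \oo, E n x).

(** The sets that are good for [weak0] form a Dynkin system: linearity gives complements and finite
    unions, dominated convergence with majorant [w] gives the whole space and countable unions. *)
Lemma weak0_rects : (forall A, G A -> weak0 (fun x => w x * \1_A x)) ->
  forall g, intg g -> weak0 g.
Proof.
move=> HG; apply: weak0_all.
have GM A : G A -> measurable A by rewrite gG; exact: sub_sigma_algebra.
have HT : weak0 w.
  apply: (@weak0_dct (fun n x => w x * \1_(E n) x) w w) => //.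
  - by move=> n; apply: mwA; exact: GM.
  - exact: cvg_indic_exhaust.
  - by move=> n; exact: HG.
move=> A; rewrite {1}gG; move: A.
apply: (@dynkin_induction _ T G (fun A => weak0 (fun x => w x * \1_A x))) => //.
- rewrite (_ : (fun x => _) = w)//; apply/funext => x.
  by rewrite indicT mulr1.
- move=> S mS HS.
  have -> : (fun x => w x * \1_(~` S) x) = fun x => w x + (-1) * (w x * \1_S x).
    by apply/funext => x; rewrite !indicE in_setC; case: (_ \in _) => /=; ring.
  apply: weak0D => //; first by apply: integrable_scale; exact: integrable_indic.
  by apply: weak0Z => //; exact: integrable_indic.
- move=> D mD tD HD.
  have HU n : weak0 (fun x => w x * \1_(\big[setU/set0]_(i < n) D i) x).
    elim: n => [|n IH].
      rewrite (_ : (fun x => _) = fun x => 0 * w x); first exact: weak0Z.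
      by apply/funext => x; rewrite big_ord0 indic0 mulr0 mul0r.
    have -> : (fun x => w x * \1_(\big[setU/set0]_(i < n.+1) D i) x) =
        fun x => w x * \1_(\big[setU/set0]_(i < n) D i) x + w x * \1_(D n) x.
      apply/funext => x; rewrite big_ord_recr /= -mulrDr; congr (_ * _).
      rewrite !indicE in_setU; have [xn|xn] := boolP (x \in D n); last by rewrite orbF addr0.
      rewrite orbT memNset ?add0r// -bigcup_mkord => -[i /= ni Di].
      move/trivIsetP : tD => /(_ i n I I); rewrite neq_ltn ni => /(_ isT) Din.
      have : (D i `&` D n) x by split => //; exact/set_mem.
      by rewrite Din.
    apply: weak0D => //; apply: integrable_indic => //.
    by apply: bigsetU_measurable.
  apply: (@weak0_dct (fun n x => w x * \1_(\big[setU/set0]_(i < n) D i) x) _ w) => //.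
  + by move=> n; apply: mwA; exact: bigsetU_measurable.
  + by apply: mwA; exact: bigcupT_measurable.
  + move=> x; apply: cvgMr.
    have [[k _ Dk]|nD] := pselect ((\bigcup_k D k) x).
      apply: cvg_near_cst; near=> n; rewrite !indicE -bigcup_mkord.
      rewrite (mem_set (A := \bigcup_k D k)); last by exists k.
      rewrite mem_set//; exists k => //=; near: n; exact: nbhs_infty_gt.
    apply: cvg_near_cst; near=> n; rewrite !indicE !memNset//.
    by rewrite -bigcup_mkord => -[i _ Di]; apply: nD; exists i.
Unshelve. all: by end_near. Qed.

End WeakL1.

(** * Sequential completeness for the weak-* topology *)

Section WeakStarCompleteness.
Context d {T : measurableType d} {R : realType}.
Variable mu : {sigma_finite_measure set T -> \bar R}.
Local Notation intg f := (mu.-integrable setT (EFin \o f)).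
Variables (w : T -> R) (C : R) (f_ : nat -> T -> R).
Hypotheses (w0 : forall x, 0 < w x) (iw : intg w) (C0 : 0 < C).
Hypotheses (mf_ : forall n, measurable_fun setT (f_ n)).
Hypotheses (f0 : forall n x, 0 <= f_ n x <= C).
Hypothesis cf : forall g, intg g -> cvgn (fun n => \int[mu]_x (f_ n x * g x)).

Let fC n x : `|f_ n x| <= C.
Proof. by have /andP[h1 h2] := f0 n x; rewrite ger0_norm. Qed.

Let mw : measurable_fun setT w := integrable_EFin_measurable iw.

Let Lam (g : T -> R) : R := limn (fun n => \int[mu]_x (f_ n x * g x)).

Let ifg n g : intg g -> intg (fun x => f_ n x * g x).
Proof. by move=> ig; apply: (integrable_mul_bounded ig (mf_ n) (fC n)). Qed.

Let LamD g h : intg g -> intg h -> Lam (fun x => g x + h x) = Lam g + Lam h.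
Proof.
move=> ig ih; rewrite /Lam -limD; [|exact: cf..].
have -> // : (fun n : nat => \int[mu]_x (f_ n x * (g x + h x))) =
  ((fun n : nat => \int[mu]_x (f_ n x * g x)) +
     (fun n : nat => \int[mu]_x (f_ n x * h x))).
apply/funext => n; rewrite fctE -RintegralD//; [|exact: ifg..].
by congr (Rintegral mu setT _); apply/funext => x; rewrite mulrDr.
Qed.

Let Lam_ge0 g : intg g -> (forall x, 0 <= g x) -> 0 <= Lam g.
Proof.
move=> ig g0; apply: limr_ge; first exact: cf.
apply: nearW => n; apply: Rintegral_ge0 => x _; rewrite mulr_ge0//.
by have /andP[] := f0 n x.
Qed.

Let Lam_le g : intg g -> (forall x, 0 <= g x) -> Lam g <= C * \int[mu]_x g x.
Proof.
move=> ig g0; apply: limr_le; first exact: cf.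
apply: nearW => n; rewrite -RintegralZl//; apply: le_Rintegral => //.
- exact: ifg.
- exact: integrable_scale.
- by move=> x _; rewrite ler_wpM2r//; have /andP[] := f0 n x.
Qed.

Let iwA A : measurable A -> intg (fun x => w x * \1_A x).
Proof. by move=> mA; exact: integrable_indic. Qed.

Let wA_ge0 A x : 0 <= w x * \1_A x.
Proof. by rewrite mulr_ge0// ltW. Qed.

(** The limit functional [Lam] is represented through a measure: its values on [w * \1_A] are those
    of a finite measure dominated by [mu], and the Radon-Nikodym density divided by [w] is the limit
    sought. The value 0 on other sets only makes the function total. *)
Definition wlim_measure (A : set T) : \bar R :=
  if pselect (measurable A) then (Lam (fun x => w x * \1_A x))%:E else 0%E.

Let numE A : measurable A -> wlim_measure A = (Lam (fun x => w x * \1_A x))%:E.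
Proof. by move=> mA; rewrite /wlim_measure; case: pselect. Qed.

Let nu0 : wlim_measure set0 = 0%E.
Proof.
rewrite numE// (_ : (fun x => _) = fun=> 0); last first.
  by apply/funext => x; rewrite indic0 mulr0.
congr EFin; have i0 : intg (fun=> 0 : R).
  by apply: (integrable_dom _ iw) => // x; rewrite normr0 ltW.
apply/eqP; rewrite eq_le Lam_ge0// andbT.
apply: (le_trans (Lam_le i0 _)) => //.
by rewrite /Rintegral integral0 mulr0.
Qed.

Let nu_ge0 A : (0 <= wlim_measure A)%E.
Proof.
rewrite /wlim_measure; case: pselect => // mA.
by rewrite lee_fin Lam_ge0//; exact: iwA.
Qed.

Let nu_sigma_additive : semi_sigma_additive wlim_measure.
Proof.
move=> D mD tD mU.
pose U n := \big[setU/set0]_(i < n) D i.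
have mUn n : measurable (U n) by exact: bigsetU_measurable.
have UE n : U n `<=` \bigcup_k D k by rewrite /U -bigcup_mkord => x [i _ Di]; exists i.
have sumE n : (\sum_(0 <= i < n) wlim_measure (D i) = (Lam (fun x => w x * \1_(U n) x))%:E)%E.
  elim: n => [|n IH].
    by rewrite big_geq// /U big_ord0 -numE// nu0.
  rewrite big_nat_recr//= IH numE// -EFinD -LamD; [|exact: iwA..].
  congr (EFin (Lam _)); apply/funext => x; rewrite /U big_ord_recr /= -mulrDr.
  congr (_ * _); rewrite !indicE in_setU.
  have [xn|xn] := boolP (x \in D n); last by rewrite orbF addr0.
  rewrite orbT memNset ?add0r// -bigcup_mkord => -[i /= ni Di].
  move/trivIsetP : tD => /(_ i n I I); rewrite neq_ltn ni => /(_ isT) Din.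
  have : (D i `&` D n) x by split => //; exact/set_mem.
  by rewrite Din.
under eq_fun do rewrite sumE.
rewrite numE//; apply: cvg_EFin; first exact: nearW.
(* Countable additivity of the limit rests on [Lam_le]: the remainder of the series is at most [C]
   times the weight of the remaining set, which tends to 0. *)
have H0 : \int[mu]_x (w x * \1_(\bigcup_k D k `\` U n) x) @[n --> \oo] --> (0 : R).
  have [|||||_ _] := @Rintegral_dct _ _ _ mu
      (fun n x => w x * \1_(\bigcup_k D k `\` U n) x) (fun=> 0) w.
  - by move=> n; apply: measurable_funM => //; apply: measurable_indic; exact: measurableD.
  - by [].
  - move=> x; apply: cvg_near_cst.
    have [[k _ Dk]|nD] := pselect ((\bigcup_k D k) x).
      near=> n; rewrite indicE memNset ?mulr0// => -[_]; apply.
      rewrite /U -bigcup_mkord; exists k => //=; near: n; exact: nbhs_infty_gt.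
    by apply: nearW => n; rewrite indicE memNset ?mulr0// => -[].
  - exact: iw.
  - move=> n x; rewrite ger0_norm// ler_piMr//; first exact: ltW.
  - by rewrite /Rintegral integral0.
apply/cvgrPdist_le => e e0.
move/cvgrPdist_le : H0 => /(_ (e / C)); rewrite divr_gt0// => /(_ isT).
apply: filterS => n; rewrite sub0r normrN => H.
have mUD : measurable (\bigcup_k D k `\` U n) by exact: measurableD.
have -> : Lam (fun x => w x * \1_(\bigcup_k D k) x) =
    Lam (fun x => w x * \1_(U n) x) + Lam (fun x => w x * \1_(\bigcup_k D k `\` U n) x).
  rewrite -LamD; [|exact: iwA..]; congr Lam; apply/funext => x.
  rewrite -mulrDr; congr (_ * _); rewrite !indicE in_setD.
  have [xU|xU] := boolP (x \in U n); last by rewrite andbT add0r.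
  by rewrite andbF addr0 (mem_set (UE n x (set_mem xU))).
rewrite addrAC subrr add0r ger0_norm; last by apply: Lam_ge0 => //; exact: iwA.
apply: (le_trans (Lam_le _ _)) => //; first exact: iwA.
rewrite mulrC -ler_pdivlMr//; apply: le_trans H; exact: ler_norm.
Unshelve. all: by end_near. Qed.

HB.instance Definition _ := isMeasure.Build _ _ _ wlim_measure
  nu0 nu_ge0 nu_sigma_additive.

Let nu_fin : fin_num_fun wlim_measure.
Proof. by move=> A mA; rewrite numE. Qed.

HB.instance Definition _ := Measure_isFinite.Build _ _ _ wlim_measure nu_fin.

Lemma weak_star_complete : exists r : T -> R, [/\ measurable_fun setT r,
  forall x, 0 <= r x <= C &
  forall g, intg g ->
    \int[mu]_x (f_ n x * g x) @[n --> \oo] --> \int[mu]_x (r x * g x)].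
Proof.
pose nu : {finite_measure set T -> \bar R} := wlim_measure.
have dom : nu `<< mu.
  apply/null_content_dominatesP => A mA A0; rewrite /nu /= numE//; congr EFin.
  apply/eqP; rewrite eq_le Lam_ge0 ?andbT//; last exact: iwA.
  apply: (le_trans (Lam_le _ _)) => //; first exact: iwA.
  rewrite Rintegral_indic// /Rintegral null_set_integral ?mulr0//.
  by apply: measurable_funTS; exact/measurable_EFinP.
have [k [k0 kfin ik kE]] := radon_nikodym_sigma_finite dom.
(* The minimum enforces the upper bound at every point; [kr] shows that it changes the density on a
   null set only. *)
pose r x := Num.min (fine (k x) / w x) C.
have mk : measurable_fun setT k := measurable_int _ ik.
have mwV : measurable_fun setT (fun x => (w x)^-1).
  rewrite (_ : (fun x => (w x)^-1) = (@powR R ^~ (-1)) \o w).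
    by apply: measurableT_comp => //; exact: measurable_powR.
  by apply/funext => x /=; rewrite powR_inv1 ?ltW.
have mfk : measurable_fun setT (fun x => fine (k x)) by exact: measurableT_comp.
have mr : measurable_fun setT r.
  by apply: measurable_minr => //; exact: measurable_funM.
have rC x : 0 <= r x <= C.
  rewrite /r le_min ge_min lexx orbT andbT (ltW C0) andbT.
  by rewrite divr_ge0 ?fine_ge0// ltW.
exists r; split => // g ig.
have ifk : intg (fun x => fine (k x)).
  by rewrite (_ : EFin \o _ = k)//; apply/funext => x /=; rewrite fineK.
have kA A : measurable A -> \int[mu]_(x in A) fine (k x) = Lam (fun x => w x * \1_A x).
  move=> mA; rewrite /Rintegral; under eq_integral do rewrite fineK//.
  by rewrite -kE//; exact: (congr1 fine (numE mA)).
have kr : {ae mu, forall x, fine (k x) = r x * w x}.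
  (* On [A] the nonnegative excess [k - C * w] has integral at most 0, by [Lam_le] applied to
     [w * \1_A], so it vanishes almost everywhere. *)
  pose A := [set x | C * w x < fine (k x)].
  have mA : measurable A.
    rewrite /A -[X in measurable X]setTI; apply: measurable_fun_ltr => //.
    exact: measurable_funM.
  have A0 : {ae mu, forall x, (fine (k x) - C * w x) * \1_A x = 0}.
    have idd : intg (fun x => (fine (k x) - C * w x) * \1_A x).
      by apply: integrable_indic => //; apply: integrable_sub => //; exact: integrable_scale.
    have dge0 x : 0 <= (fine (k x) - C * w x) * \1_A x.
      rewrite indicE; have [xA|xA] := boolP (x \in A); last by rewrite mulr0.
      by rewrite mulr1 subr_ge0 ltW//; exact: (set_mem xA).
    have : ae_eq mu setT (EFin \o (fun x => (fine (k x) - C * w x) * \1_A x)) (cst 0%E).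
      apply/ae_eq_integral_abs => //; first exact: measurable_int idd.
      under eq_integral do rewrite gee0_abs ?lee_fin//.
      rewrite -EFin_Rintegral//; congr EFin; apply/eqP; rewrite eq_le Rintegral_ge0 ?andbT//.
      rewrite Rintegral_indic// RintegralB//; last 2 first.
      - by apply: (integrableS measurableT) => //.
      - by apply: (integrableS measurableT) => //; exact: integrable_scale.
      rewrite subr_le0 kA// RintegralZl//; last exact: (integrableS measurableT).
      by rewrite -Rintegral_indic//; apply: Lam_le => //; exact: iwA.
    by apply: filterS => x /(_ I) [].
  apply: filterS A0 => x; rewrite indicE /r.
  have [xA|xA] := boolP (x \in A).
    have := set_mem xA; rewrite /A /= mulr1 => xA' /eqP.
    by rewrite subr_eq0 => /eqP h; rewrite h ltxx in xA'.
  move: xA; rewrite notin_setE /A /= => /negP; rewrite -leNgt => h _.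
  rewrite min_l ?mulfVK ?gt_eqF//.
  by rewrite ler_pdivrMr.
pose phi n x := f_ n x - r x.
have mphi n : measurable_fun setT (phi n) by exact: measurable_funB.
have phiC n x : `|phi n x| <= C.
  have /andP[h1 h2] := f0 n x; have /andP[h3 h4] := rC x.
  rewrite /phi ler_norml; apply/andP; split; lra.
have irg h : intg h -> intg (fun x => r x * h x).
  by move=> ih; apply: (@integrable_mul_bounded _ _ _ mu C) => // x;
     have /andP[h1 h2] := rC x; rewrite ger0_norm.
have phiE n h : intg h -> \int[mu]_x (phi n x * h x) =
    \int[mu]_x (f_ n x * h x) - \int[mu]_x (r x * h x).
  move=> ih; rewrite -RintegralB//; [|exact: ifg|exact: irg].
  by congr (Rintegral mu setT _); apply/funext => x; rewrite mulrBl.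
have H0 : weak0 mu (nbhs \oo) phi g.
  apply: (weak0_all C0 mphi phiC w0 iw) => // A mA.
  have iA := iwA mA.
  have rE : \int[mu]_x (r x * (w x * \1_A x)) = Lam (fun x => w x * \1_A x).
    rewrite -kA// -[RHS]Rintegral_indic//; apply: Rintegral_ae_eq.
    by apply: filterS kr => x ->; rewrite mulrA.
  have : (fun n => \int[mu]_x (f_ n x * (w x * \1_A x)) - Lam (fun x => w x * \1_A x))
      @ \oo --> (Lam (fun x => w x * \1_A x) - Lam (fun x => w x * \1_A x) : R).
    by apply: cvgB; [exact: cf|exact: cvg_cst].
  rewrite subrr /weak0 (_ : (fun n => _ - _) = fun n => \int[mu]_x (phi n x * (w x * \1_A x)))//.
  by apply/funext => n; rewrite phiE// rE.
have : (fun n => \int[mu]_x (phi n x * g x) + \int[mu]_x (r x * g x)) @ \oo -->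
    (0 + \int[mu]_x (r x * g x) : R).
  by apply: cvgD; [exact: H0|exact: cvg_cst].
rewrite add0r (_ : (fun n => _ + _) = fun n => \int[mu]_x (f_ n x * g x))//.
by apply/funext => n; rewrite phiE// subrK.
Qed.

End WeakStarCompleteness.

(** * Weak derivatives in one variable *)

Section TensorIntegrable.
Context d1 d2 {T1 : measurableType d1} {T2 : measurableType d2} {R : realType}.
Variables (m1 : {sigma_finite_measure set T1 -> \bar R})
          (m2 : {sigma_finite_measure set T2 -> \bar R}).
Variable m : {measure set (T1 * T2) -> \bar R}.
Hypothesis mE : (m : set _ -> _) = (m1 \x m2)%E.

Lemma measurable_tens (f : T1 -> R) (g : T2 -> R) :
  measurable_fun setT f -> measurable_fun setT g ->
  measurable_fun setT (fun z : T1 * T2 => f z.1 * g z.2).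
Proof.
move=> mf mg; apply: measurable_funM.
- exact: (measurableT_comp mf measurable_fst).
- exact: (measurableT_comp mg measurable_snd).
Qed.

Lemma integrable_tens (f : T1 -> R) (g : T2 -> R) :
  m1.-integrable setT (EFin \o f) -> m2.-integrable setT (EFin \o g) ->
  m.-integrable setT (EFin \o (fun z : T1 * T2 => f z.1 * g z.2)).
Proof.
move=> i1 i2.
have mf := integrable_EFin_measurable i1.
have mg := integrable_EFin_measurable i2.
apply/(integrable_prodE mE); apply/integrable12ltyP.
  by apply/measurable_EFinP; exact: measurable_tens.
move/integrableP : i1 => [_ f1]; move/integrableP : i2 => [_ g1].
have g1' : (\int[m2]_y `|(EFin \o g) y| \is a fin_num)%E.
  by rewrite ge0_fin_numE//; exact: integral_ge0.
have E x : (\int[m2]_y `|(EFin \o (fun z : T1 * T2 => (f z.1 * g z.2)%R)) (x, y)| =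
    `|(EFin \o f) x| * \int[m2]_y `|(EFin \o g) y|)%E.
  rewrite -ge0_integralZl//.
  - by apply: eq_integral => y _ /=; rewrite normrM EFinM.
  - by apply: measurableT_comp => //; exact/measurable_EFinP.
under eq_integral do rewrite E.
rewrite -(fineK g1') ge0_integralZr//.
- rewrite muleC lte_mul_pinfty// lee_fin fine_ge0//; exact: integral_ge0.
- by apply: measurableT_comp => //; exact/measurable_EFinP.
- by rewrite lee_fin fine_ge0// integral_ge0.
Qed.

End TensorIntegrable.

Section WeakDerivative1.
Context {R : realType}.
Local Notation mu := (@lebesgue_measure R).
Local Notation intg f := (mu.-integrable setT (EFin \o f)).

Lemma prim_indic (g : R -> R) (s : R) :
  prim g s = \int[mu]_t (g t * (t <= s)%R%:R).
Proof.
rewrite /prim -Rintegral_indic//; congr (Rintegral mu setT _); apply/funext => t.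
by rewrite indicE; congr (_ * _%:R); rewrite mem_setE /= in_itv.
Qed.

Lemma prim_indic_lt (g : R -> R) (s : R) : intg g ->
  prim g s = \int[mu]_t (g t * (t < s)%R%:R).
Proof.
move=> ig; rewrite /prim -Rintegral_itv_bndo_bndc; last exact: (integrableS measurableT).
rewrite -Rintegral_indic//; congr (Rintegral mu setT _); apply/funext => t.
by rewrite indicE; congr (_ * _%:R); rewrite mem_setE /= in_itv.
Qed.

Let measurable_lt_pair : measurable_fun setT (fun z : R * R => (z.1 < z.2)%R%:R : R).
Proof.
have -> : (fun z : R * R => (z.1 < z.2)%R%:R : R) = \1_[set z : R * R | z.1 < z.2].
  by apply/funext => z; rewrite indicE mem_setE.
apply: measurable_indic; rewrite -[X in measurable X]setTI.
exact: measurable_fun_ltr.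
Qed.

Let mm : (@leb2 R : set _ -> _) = (mu \x mu)%E. Proof. by []. Qed.

Let integrable_tri (f g : R -> R) : intg f -> intg g ->
  (@leb2 R).-integrable setT (EFin \o (fun z : R * R => (z.1 < z.2)%R%:R * (f z.1 * g z.2))).
Proof.
move=> i1 i2; apply: (@integrable_mul_bounded _ _ _ _ 1).
- exact: (integrable_tens mm).
- exact: measurable_lt_pair.
- by move=> z; case: (_ < _); rewrite ?normr1// normr0.
Qed.

Lemma integrable_prim (f g : R -> R) : intg f -> intg g ->
  intg (fun t => f t * prim g t).
Proof.
move=> i1 i2; have := integrable_fubini2 mm (integrable_tri i2 i1).
rewrite (_ : (fun y => _) = fun t => f t * prim g t)//.
apply/funext => t; rewrite prim_indic_lt//= -RintegralZl//.
  by congr (Rintegral mu setT _); apply/funext => s; ring.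
rewrite (_ : (fun s => _) = fun s => g s * \1_(`]-oo, t[%classic) s).
  exact: integrable_indic.
by apply/funext => s; rewrite indicE mem_setE /= in_itv.
Qed.

(** Fubini's theorem on the triangle [s < t]. *)
Lemma Rintegral_prim_swap (f g : R -> R) : intg f -> intg g ->
  \int[mu]_s (g s * \int[mu]_t (f t * (s < t)%R%:R)) = \int[mu]_t (f t * prim g t).
Proof.
move=> i1 i2; have i3 := integrable_tri i2 i1.
transitivity (\int[@leb2 R]_z ((z.1 < z.2)%R%:R * (g z.1 * f z.2))).
  rewrite (Rfubini1 mm i3); congr (Rintegral mu setT _); apply/funext => s /=.
  rewrite -RintegralZl//.
    by congr (Rintegral mu setT _); apply/funext => t; ring.
  rewrite (_ : (fun t => _) = fun t => f t * \1_(`]s, +oo[%classic) t).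
    exact: integrable_indic.
  by apply/funext => t; rewrite indicE mem_setE /= in_itv /= andbT.
rewrite (Rfubini2 mm i3); congr (Rintegral mu setT _); apply/funext => t /=.
rewrite prim_indic_lt// -RintegralZl//.
  by congr (Rintegral mu setT _); apply/funext => s; ring.
rewrite (_ : (fun s => _) = fun s => g s * \1_(`]-oo, t[%classic) s).
  exact: integrable_indic.
by apply/funext => s; rewrite indicE mem_setE /= in_itv.
Qed.

Variables (c d h : R) (f g : R -> R).
Hypotheses (i1 : intg f) (i2 : intg g).
Hypotheses (f0 : forall s, ~~ (c <= s < d) -> f s = 0).
Hypotheses (g0 : forall s, ~~ (c <= s < d) -> g s = 0).
(** The tests vanish from [d] on but are free at [c], so the right-hand side records [h] as the
    value of [f] at [c]. In [strip_trace] this point is the lower boundary, in [mass_ae] it is the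
    initial time. *)
Hypothesis weak : forall psi, test_fun psi -> (forall s, d <= s -> psi s = 0) ->
  \int[mu]_s (f s * 'D_1 psi s) + \int[mu]_s (g s * psi s) = - (h * psi c).

Let V s := \1_(`]c, d[%classic) s * (f s - h - prim g s).

Let iV : intg V.
Proof.
have iI : intg (\1_(`]c, d[%classic) : R -> R).
  apply: (@integrable_bounded_supp _ _ _ mu _ _ 1 _ _ (lebesgue_itvcc_fin c d)) => //.
  - by move=> x; rewrite indicE; case: (_ \in _); rewrite ?normr1// normr0.
  - move=> x /= /negP xcd; rewrite indicE memNset//= in_itv /=.
    by move=> /andP[/ltW h1 /ltW h2]; move: xcd; rewrite in_itv /= h1 h2.
have i3 : intg (fun s => f s * \1_(`]c, d[%classic) s) by exact: integrable_indic.
have := integrable_sub (integrable_sub i3 (integrable_scale h iI)) (integrable_prim iI i2).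
by rewrite (_ : (fun x => _) = V)//; apply/funext => s; rewrite /V; ring.
Qed.

(** The test is the primitive of the bump [eta] vanishing from [b] on. Its value at [c] is minus the
    integral of [eta], which yields the term in [h], and the triangle swap turns the pairing of [g]
    with it into minus that of [eta] with [prim g]. *)
Let V0_bump k a b : c <= a -> a < b -> b <= d -> \int[mu]_s (bump k a b s * V s) = 0.
Proof.
move=> ca ab bd.
set eta := bump k a b.
have te : test_fun eta by exact: test_fun_bump.
have etab y : b <= y -> eta y = 0.
  by move=> yb; apply: bump_out; rewrite negb_and -!leNgt yb orbT.
have etac y : y <= c -> eta y = 0.
  by move=> yc; apply: bump_out; rewrite negb_and -!leNgt (le_trans yc ca).
have [psi [tpsi psib psic psiE]] := test_fun_primitive c te etab.
have ie : intg eta by exact: test_fun_integrable.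
have me : measurable_fun setT eta := integrable_EFin_measurable ie.
have e1 x : `|eta x| <= 1 by rewrite ger0_norm ?bump_ge0// bump_le1.
have := weak tpsi (fun s ds => psib s (le_trans bd ds)).
have -> : \int[mu]_s (f s * 'D_1 psi s) = \int[mu]_s (eta s * f s).
  congr (Rintegral mu setT _); apply/funext => s.
  have [cs|sc] := leP c s; first by rewrite psic// mulrC.
  by rewrite f0 ?mulr0 ?mul0r// leNgt sc.
have pc : prim eta c = 0 by apply: (@prim_eq0 _ _ c).
have pb : prim eta b = \int[mu]_s eta s.
  rewrite prim_indic; congr (Rintegral mu setT _); apply/funext => s.
  by have [sb|/ltW sb] := leP s b; rewrite ?mulr1// etab// mul0r.
have -> : \int[mu]_s (g s * psi s) = - \int[mu]_t (eta t * prim g t).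
  rewrite -Rintegral_prim_swap// -mulN1r -RintegralZl//.
    congr (Rintegral mu setT _); apply/funext => s.
    have [cs|sc] := leP c s; last by rewrite g0 ?mul0r ?mulr0// leNgt sc.
    rewrite psiE// pb prim_indic -RintegralB//.
    - rewrite mulrCA; congr (_ * _); rewrite -RintegralZl//.
        congr (Rintegral mu setT _); apply/funext => t.
        by case: (leP t s) => _; rewrite ?mulr0 ?mulr1 ?subrr ?sub0r ?mulN1r.
      rewrite (_ : (fun t => _) = fun t => eta t * \1_(`]s, +oo[%classic) t).
        exact: integrable_indic.
      by apply/funext => t; rewrite indicE mem_setE /= in_itv /= andbT.
    - rewrite (_ : (fun t => _) = fun t => eta t * \1_(`]-oo, s]%classic) t).
        exact: integrable_indic.
      by apply/funext => t; rewrite indicE mem_setE /= in_itv.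
  have := integrable_fubini1 mm (integrable_tri i2 ie).
  rewrite (_ : (fun x => _) = fun s => g s * \int[mu]_t (eta t * (s < t)%R%:R))//.
  apply/funext => s /=; rewrite -RintegralZl//.
    by congr (Rintegral mu setT _); apply/funext => t; ring.
  rewrite (_ : (fun t => _) = fun t => eta t * \1_(`]s, +oo[%classic) t).
    exact: integrable_indic.
  by apply/funext => t; rewrite indicE mem_setE /= in_itv /= andbT.
rewrite psiE// pc pb sub0r mulrN opprK => H.
have -> : \int[mu]_s (eta s * V s) =
    \int[mu]_s (eta s * f s) - \int[mu]_s (h * eta s) - \int[mu]_t (eta t * prim g t).
  rewrite -RintegralB//; last 2 first.
  - exact: (integrable_mul_bounded i1 me e1).
  - exact: integrable_scale.
  rewrite -RintegralB//; last 2 first.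
  - apply: integrable_sub; last exact: integrable_scale.
    exact: (integrable_mul_bounded i1 me e1).
  - exact: integrable_prim.
  congr (Rintegral mu setT _); apply/funext => s; rewrite /V.
  rewrite indicE mem_setE /= in_itv /=; have [scd|scd] := boolP (c < s < d).
    by rewrite mul1r; ring.
  rewrite /eta bump_out; first by ring.
  apply: contra scd => /andP[as_ sb].
  by rewrite (le_lt_trans ca as_) (lt_le_trans sb bd).
by rewrite RintegralZl// addrAC H subrr.
Qed.

Lemma weak_derivative1 :
  {ae mu, forall s, c < s < d -> f s = h + prim g s}.
Proof.
have : {ae mu, forall s, V s = 0}.
  apply: (@ae_eq0_rects _ _ _ mu (@rat_itv R) rat_itvn) => //.
  - exact: rat_itv_setI.
  - exact: rat_itv_gen.
  - exact: rat_itvn_itv.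
  - exact: mem_rat_itvn.
  move=> _ [qa [qb ->]]; set a : R := ratr qa; set b : R := ratr qb.
  (* [V] vanishes outside []c, d[], so the rational interval may be clipped to it, as [V0_bump]
     requires. *)
  pose a' := Num.max a c; pose b' := Num.min b d.
  rewrite -Rintegral_indic//.
  have -> : (fun s => V s * \1_(`]a, b[%classic) s) = fun s => V s * \1_(`]a', b'[%classic) s.
    apply/funext => s; rewrite /V !indicE !mem_setE /= !in_itv /= gt_max lt_min.
    by case: (c < s); case: (s < d) => /=; rewrite ?andbT ?andbF ?mul0r// ?mulr0.
  have [ab|ba] := ltP a' b'; last first.
    rewrite /Rintegral integral0_eq// => s _.
    rewrite indicE memNset ?mulr0//= in_itv /= => /andP[h1 h2].
    by have := lt_trans h1 h2; rewrite ltNge ba.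
  have [|||||_ _ cv] := @Rintegral_dct _ _ _ mu (fun k s => bump k a' b' s * V s)
      (fun s => V s * \1_(`]a', b'[%classic) s) (fun s => `|V s|).
  - move=> k; apply: measurable_funM; last exact: (integrable_EFin_measurable iV).
    by apply: smooth1_measurable; exact: smooth_bump.
  - by apply: measurable_funM => //; exact: (integrable_EFin_measurable iV).
  - move=> s; rewrite mulrC; apply: cvgM; [exact: bump_cvg|exact: cvg_cst].
  - exact: (integrable_norm iV).
  - by move=> k s; rewrite normrM ger0_norm ?bump_ge0// ler_piMl// bump_le1.
  apply: (cvg_unique (@Rhausdorff R) cv).
  rewrite (_ : (fun k => _) = fun=> 0); first exact: cvg_cst.
  apply/funext => k; apply: V0_bump => //.
  - by rewrite le_max lexx orbT.
  - by rewrite ge_min lexx orbT.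
apply: ae_imp => s; rewrite /V => + scd.
rewrite indicE mem_setE /= in_itv /= scd mul1r => /eqP.
by rewrite -addrA -opprD subr_eq0 => /eqP.
Qed.

End WeakDerivative1.

(** * A countable determining family of tests on the plane *)

Section PlaneTests.
Context {R : realType}.
Local Notation R2 := (R * R)%type.
Local Notation mu := (@lebesgue_measure R).
Local Notation mu2 := (@leb2 R).
Local Notation intg2 f := (mu2.-integrable setT (EFin \o f)).

Lemma leb2E : (mu2 : set _ -> _) = (mu \x mu)%E. Proof. by []. Qed.

(** The weight [w] of the abstract lemmas. Being smooth as well as positive and integrable, it
    yields test functions when multiplied by bumps. *)
Definition gauss (x : R) : R := normal_pdf 0 1 x.

Lemma gaussE x : gauss x = normal_peak 1 * expR (- (x ^+ 2 / 2)).
Proof.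
rewrite /gauss normal_pdfE ?oner_neq0// /normal_fun subr0.
by rewrite expr1n mulNr.
Qed.

Lemma gauss_gt0 x : 0 < gauss x.
Proof. by rewrite gaussE mulr_gt0 ?expR_gt0// normal_peak_gt0// oner_neq0. Qed.

Lemma gauss_le x : gauss x <= normal_peak 1.
Proof.
rewrite gaussE ler_piMr ?normal_peak_ge0//.
by rewrite expR_le1 oppr_le0 divr_ge0// sqr_ge0.
Qed.

Lemma smooth_id : smooth (fun x : R => x).
Proof.
apply: smooth1_primitive => [x|]; first exact: derivable_id.
have -> : (fun x : R => 'D_1 (fun x : R => x) x) = fun=> 1.
  by apply/funext => x; exact: derive_id.
exact: smooth_cst.
Qed.

Lemma smooth_gauss : smooth gauss.
Proof.
rewrite (_ : gauss = fun x => normal_peak 1 * expR ((- 2^-1) * (x * x))).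
  by apply/smoothZ/smooth_expR/smoothZ/smoothM; exact: smooth_id.
by apply/funext => x; rewrite gaussE expr2 mulNr mulrC [2^-1 * _]mulrC mulrC.
Qed.

Lemma integrable_gauss : mu.-integrable setT (EFin \o gauss).
Proof. exact: integrable_normal_pdf. Qed.

Definition gauss2 (x : R2) : R := gauss x.1 * gauss x.2.

Lemma gauss2_gt0 x : 0 < gauss2 x.
Proof. by rewrite mulr_gt0// gauss_gt0. Qed.

Lemma integrable_gauss2 : intg2 gauss2.
Proof. apply: (integrable_tens leb2E); exact: integrable_gauss. Qed.

Lemma gauss2_le x : gauss2 x <= normal_peak 1 ^+ 2.
Proof.
rewrite expr2 ler_pM ?gauss_le//; [exact/ltW/gauss_gt0|exact/ltW/gauss_gt0].
Qed.

Definition gbump (k : nat) (a b x : R) : R := gauss x * bump k a b x.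

Lemma test_fun_gbump k a b : test_fun (gbump k a b).
Proof.
apply: (@test_fun1 _ _ a b).
  by apply: smoothM; [exact: smooth_gauss|exact: smooth_bump].
move=> x H; rewrite /gbump bump_out ?mulr0//; apply/negP => /andP[ax xb]; apply: H.
by rewrite !ltW.
Qed.

Definition box_idx := ((rat * rat) * (rat * rat) * nat)%type.

(* A countable family of test functions on the plane which determines a
   function up to null sets. *)
Definition theta1 (i : box_idx) : R -> R :=
  gbump i.2 (ratr i.1.1.1) (ratr i.1.1.2).
Definition theta2 (i : box_idx) : R -> R :=
  gbump i.2 (ratr i.1.2.1) (ratr i.1.2.2).
Definition theta (i : box_idx) : R2 -> R := tens (theta1 i) (theta2 i).

Definition rat_box := rects (@rat_itv R) (@rat_itv R).
Definition rat_boxn (n : nat) : set R2 := rat_itvn n `*` rat_itvn n.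

Lemma rat_box_setI : setI_closed rat_box.
Proof. apply: rects_setI; exact: rat_itv_setI. Qed.

Lemma bigcup_rat_itvn : \bigcup_n rat_itvn n = [set: R].
Proof.
rewrite -subTset => x _; have [n _ Hn] := mem_rat_itvn x.
by exists n => //; exact: (Hn n (leqnn n)).
Qed.

Lemma rat_box_gen :
  @measurable _ (measurableTypeR R * measurableTypeR R)%type = <<s rat_box >>.
Proof.
apply: (rects_gen rat_itv_gen rat_itv_gen (F1 := rat_itvn) (F2 := rat_itvn)).
- exact: rat_itvn_itv.
- exact: rat_itvn_itv.
- exact: bigcup_rat_itvn.
- exact: bigcup_rat_itvn.
Qed.

Lemma rat_boxn_box n : rat_box (rat_boxn n).
Proof. by exists (rat_itvn n); [exact: rat_itvn_itv|exists (rat_itvn n) => //; exact: rat_itvn_itv]. Qed.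

Lemma mem_rat_boxn (x : R2) : \forall n \near \oo, rat_boxn n x.
Proof. by apply: filterS2 (mem_rat_itvn x.1) (mem_rat_itvn x.2) => n ? ?; split. Qed.

Lemma theta_cvg (a b c d : rat) (x : R2) :
  theta (((a, b), (c, d)), k) x @[k --> \oo] -->
  gauss2 x * \1_(`]ratr a, ratr b[%classic `*` `]ratr c, ratr d[%classic) x.
Proof.
have -> : gauss2 x * \1_(`]ratr a, ratr b[%classic `*` `]ratr c, ratr d[%classic) x =
  (gauss x.1 * \1_(`]ratr a, ratr b[%classic) x.1) *
  (gauss x.2 * \1_(`]ratr c, ratr d[%classic) x.2).
  rewrite mulrACA; congr (_ * _); rewrite !indicE -natrM mulnb; congr (nat_of_bool _)%:R.
  by apply/idP/idP; rewrite -?in_setX => /[!inE].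
have H (q r : rat) (y : R) : gbump k (ratr q) (ratr r) y @[k --> \oo] -->
    gauss y * \1_(`]ratr q, ratr r[%classic) y.
  by apply: cvgM; [exact: cvg_cst|exact: bump_cvg].
exact: (cvgM (H a b x.1) (H c d x.2)).
Qed.

Lemma theta_bound i x : `|theta i x| <= gauss2 x.
Proof.
rewrite /theta /tens /gauss2 normrM; apply: ler_pM => //.
  rewrite /theta1 /gbump normrM ger0_norm ?(ltW (gauss_gt0 _))//.
  by rewrite ler_piMr ?(ltW (gauss_gt0 _))// ger0_norm ?bump_ge0// bump_le1.
rewrite /theta2 /gbump normrM ger0_norm ?(ltW (gauss_gt0 _))//.
by rewrite ler_piMr ?(ltW (gauss_gt0 _))// ger0_norm ?bump_ge0// bump_le1.
Qed.

(** The part of [theta i] left after factoring out the weight. As it is bounded by 1, integrability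
    against [gauss2] passes to [theta i]. *)
Definition boxbump (i : box_idx) (x : R2) : R :=
  bump i.2 (ratr i.1.1.1) (ratr i.1.1.2) x.1 *
  bump i.2 (ratr i.1.2.1) (ratr i.1.2.2) x.2.

Lemma theta_gauss2 i x : theta i x = gauss2 x * boxbump i x.
Proof. by rewrite /theta /tens /theta1 /theta2 /gbump /boxbump /gauss2 mulrACA. Qed.

Lemma measurable_boxbump i :
  measurable_fun (setT : set (measurableTypeR R * measurableTypeR R)) (boxbump i).
Proof. by apply: measurable_tens; apply: smooth1_measurable; exact: smooth_bump. Qed.

Lemma boxbump_bound i x : `|boxbump i x| <= 1.
Proof.
rewrite /boxbump normrM -[leRHS]mulr1; apply: ler_pM => //;
  by rewrite ger0_norm ?bump_ge0// bump_le1.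
Qed.

Lemma test_fun_theta1 i : test_fun (theta1 i). Proof. exact: test_fun_gbump. Qed.
Lemma test_fun_theta2 i : test_fun (theta2 i). Proof. exact: test_fun_gbump. Qed.

Lemma test_fun_theta i : test_fun (theta i).
Proof. by apply: test_fun_tens; [exact: test_fun_theta1|exact: test_fun_theta2]. Qed.

Lemma measurable_theta i : measurable_fun (setT : set (measurableTypeR R * measurableTypeR R)) (theta i).
Proof.
by apply: measurable_tens; apply: smooth1_measurable;
  [have [] := test_fun_theta1 i|have [] := test_fun_theta2 i].
Qed.

Lemma integrable_theta i : intg2 (theta i).
Proof.
apply: integrable_dom integrable_gauss2 _; first exact: measurable_theta.
exact: theta_bound.
Qed.

Lemma measurable_gauss2 :
  measurable_fun (setT : set (measurableTypeR R * measurableTypeR R)) gauss2.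
Proof. exact: integrable_EFin_measurable integrable_gauss2. Qed.

(** For a fixed rational box the functions [theta] tend to [gauss2] times its indicator, with
    majorant [gauss2]; [weak0_dct] then supplies the hypothesis of [weak0_rects]. *)
Lemma weak0_theta (J : Type) (F : set_system J) {FF : Filter F}
    (phi : J -> R2 -> R) (C : R) : 0 < C ->
  (forall j, measurable_fun (setT : set (measurableTypeR R * measurableTypeR R)) (phi j)) ->
  (forall j x, `|phi j x| <= C) ->
  (forall i, weak0 mu2 F phi (theta i)) -> forall g, intg2 g -> weak0 mu2 F phi g.
Proof.
move=> C0 mphi phiC Hth.
apply: (weak0_rects C0 mphi phiC gauss2_gt0 integrable_gauss2 rat_box_setI
  rat_box_gen rat_boxn_box mem_rat_boxn).
move=> _ [_ [a [b ->]] [_ [c [d ->]] <-]].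
apply: (@weak0_dct _ _ _ mu2 J F FF phi C C0 mphi phiC
  (fun k => theta (((a, b), (c, d)), k)) _ gauss2).
- by move=> k; exact: measurable_theta.
- apply: measurable_funM; first exact: measurable_gauss2.
  by apply: measurable_indic; apply: measurableX.
- by move=> x; exact: theta_cvg.
- exact: integrable_gauss2.
- by move=> k x; exact: theta_bound.
- by move=> k; exact: Hth.
Qed.

(** Integrability is asked after multiplication by the weight, because [W] will be built from traces
    and slices that are square integrable on the plane but possibly not integrable. *)
Lemma ae_eq0_theta (W : R2 -> R) :
  intg2 (fun x => W x * gauss2 x) ->
  (forall i, \int[mu2]_x (W x * theta i x) = 0) -> {ae mu2, forall x, W x = 0}.
Proof.
move=> iW W0.
have thE i x : W x * theta i x = W x * gauss2 x * boxbump i x.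
  by rewrite theta_gauss2 mulrA.
have : {ae mu2, forall x, W x * gauss2 x = 0}.
  apply: (@ae_eq0_rects _ _ _ mu2 rat_box rat_boxn rat_box_setI rat_box_gen
    rat_boxn_box mem_rat_boxn _ iW).
  move=> _ [_ [a [b ->]] [_ [c [d ->]] <-]].
  set A := _ `*` _; have mA : measurable A by apply: measurableX.
  rewrite -Rintegral_indic//.
  have [|||||_ _ cv] := @Rintegral_dct _ _ _ mu2
      (fun k x => W x * theta (((a, b), (c, d)), k) x)
      (fun x => W x * gauss2 x * \1_A x) (fun x => `|W x * gauss2 x|).
  - move=> k; rewrite (_ : (fun x => _) = fun x => W x * gauss2 x *
        boxbump (((a, b), (c, d)), k) x); last by apply/funext => x; exact: thE.
    apply: measurable_funM; first exact: integrable_EFin_measurable iW.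
    exact: measurable_boxbump.
  - by apply: measurable_funM => //; exact: integrable_EFin_measurable iW.
  - by move=> x; rewrite -mulrA; apply: cvgM; [exact: cvg_cst|exact: theta_cvg].
  - exact: integrable_norm.
  - by move=> k x; rewrite normrM [leRHS]normrM; apply: ler_wpM2l => //;
      apply: (le_trans (theta_bound _ _)); exact: ler_norm.
  apply: (cvg_unique (@Rhausdorff R) cv).
  rewrite (_ : (fun k => _) = fun=> 0); first exact: cvg_cst.
  by apply/funext => k; exact: W0.
apply: ae_imp => x /eqP; rewrite mulf_eq0 => /orP[/eqP//|].
by rewrite gt_eqF// gauss2_gt0.
Qed.

End PlaneTests.

(** * The trace on the lower boundary *)

Section CauchySchwarz.
Context d {T : measurableType d} {R : realType}.
Variable mu : {measure set T -> \bar R}.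

Lemma integrable_sqr_bounded (D : set T) (f : T -> R) :
  measurable D -> (mu D < +oo)%E -> measurable_fun setT f ->
  (forall x, ~ D x -> f x = 0) ->
  mu.-integrable setT (EFin \o (fun x => f x ^+ 2)) ->
  mu.-integrable setT (EFin \o f).
Proof.
move=> mD Dfin mf f0 i2.
have iD : mu.-integrable setT (EFin \o (\1_D : T -> R)).
  apply: (@integrable_bounded_supp _ _ _ mu _ D 1) => //.
  - by move=> x; rewrite indicE; case: (_ \in _); rewrite ?normr1// normr0.
  - by move=> x nD; rewrite indicE memNset.
apply: (integrable_dom mf (integrable_add i2 iD)) => x.
have [Dx|nDx] := pselect (D x); last first.
  by rewrite f0// normr0 expr0n /= add0r indicE ler0n.
rewrite indicE mem_set// -[X in _ <= X + _]real_normK ?num_real//.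
have h := sqr_ge0 (`|f x| - 1); rewrite sqrrB mulr1 expr1n mulr2n in h.
by have h2 := sqr_ge0 `|f x|; rewrite /= mulr1n; lra.
Qed.

Lemma cauchy_schwarz1 (D : set T) (f : T -> R) :
  measurable D -> (mu D < +oo)%E -> measurable_fun setT f ->
  (forall x, ~ D x -> f x = 0) ->
  (((\int[mu]_x f x) ^+ 2)%:E <= mu D * \int[mu]_x (f x ^+ 2)%:E)%E.
Proof.
move=> mD Dfin mf f0.
have Df : mu D \is a fin_num by rewrite ge0_fin_numE.
have iD : mu.-integrable setT (EFin \o (\1_D : T -> R)).
  apply: (@integrable_bounded_supp _ _ _ mu _ D 1) => //.
  - by move=> x; rewrite indicE; case: (_ \in _); rewrite ?normr1// normr0.
  - by move=> x nD; rewrite indicE memNset.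
have iD1 : \int[mu]_x (\1_D x : R) = fine (mu D).
  by rewrite /Rintegral integral_indic// setIT.
have mf2 : measurable_fun setT (fun x => f x ^+ 2) by exact: measurable_funX.
have [D0|D0] := eqVneq (mu D) 0%E.
  have -> : \int[mu]_x f x = 0.
    rewrite (@Rintegral_ae_eq _ _ _ mu f (fun=> 0)).
      by rewrite /Rintegral integral0.
    by exists D; split => // x /= nf; apply: contrapT => nD; apply: nf; exact: f0.
  by rewrite expr0n /= mule_ge0// integral_ge0// => x _; rewrite lee_fin sqr_ge0.
have Dpos : 0 < fine (mu D) by rewrite fine_gt0// lt0e D0 measure_ge0.
have [/eqP foo|fin] := boolP (\int[mu]_x (f x ^+ 2)%:E == +oo)%E.
  by rewrite foo gt0_muley ?leey// lt0e D0 measure_ge0.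
have i2 : mu.-integrable setT (EFin \o (fun x => f x ^+ 2)).
  apply/integrableP; split; first exact/measurable_EFinP.
  rewrite (eq_integral (fun x => (f x ^+ 2)%:E)) ?ltey//.
  by move=> x _ /=; rewrite ger0_norm// sqr_ge0.
have i1 : mu.-integrable setT (EFin \o f) by exact: (integrable_sqr_bounded mD Dfin mf f0 i2).
rewrite -EFin_Rintegral// -(fineK Df) -EFinM lee_fin.
set I := \int[mu]_x f x; set L := fine (mu D); set A := Rintegral _ _ _.
(* The square of [f - K] is integrated over [D]; the best [K] is the mean value [I / L]. *)
have H K : 2 * K * I <= A + K ^+ 2 * L.
  rewrite -RintegralZl// /L -iD1 -RintegralZl// -RintegralD//; last exact: integrable_scale.
  apply: le_Rintegral => //; first exact: integrable_scale.
    by apply: integrable_add => //; exact: integrable_scale.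
  move=> x _; have [Dx|nDx] := pselect (D x); last first.
    by rewrite f0// expr0n /= mulr0 add0r indicE memNset// mulr0.
  rewrite indicE mem_set// mulr1.
  by have := sqr_ge0 (f x - K); nra.
have := H (I / L).
rewrite -(ler_pM2l Dpos) -/L => {}H.
have L0 : L != 0 by rewrite gt_eqF.
have e1 : L * (2 * (I / L) * I) = 2 * I ^+ 2 by field.
have e2 : L * (A + (I / L) ^+ 2 * L) = L * A + I ^+ 2 by field.
by rewrite e1 e2 in H; lra.
Qed.

End CauchySchwarz.

Section StripTrace.
Context {R : realType}.
Local Notation R2 := (R * R)%type.
Local Notation R3 := (R * R * R)%type.
Local Notation mR := (measurableTypeR R).
Local Notation mu1 := (@lebesgue_measure R).
Local Notation mu2 := (@leb2 R).
Local Notation mu3 := (@leb3 R).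

Lemma leb3E : (mu3 : set _ -> _) = (mu2 \x mu1)%E. Proof. by []. Qed.

Lemma integrable_mul_sqr d (T : measurableType d) (mu : {measure set T -> \bar R})
    (f g : T -> R) : measurable_fun setT f -> measurable_fun setT g ->
  mu.-integrable setT (EFin \o (fun x => f x ^+ 2)) ->
  mu.-integrable setT (EFin \o (fun x => g x ^+ 2)) ->
  mu.-integrable setT (EFin \o (fun x => f x * g x)).
Proof.
move=> mf mg i1 i2.
apply: (integrable_dom _ (integrable_add i1 i2)); first exact: measurable_funM.
move=> x; rewrite normrM -[X in _ <= X + _]real_normK ?num_real//.
rewrite -[X in _ <= _ + X]real_normK ?num_real//.
have h := sqr_ge0 (`|f x| - `|g x|).
have h1 := normr_ge0 (f x); have h2 := normr_ge0 (g x); nra.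
Qed.

Lemma integrable_itv (a b : R) :
  mu1.-integrable setT (EFin \o (\1_(`]a, b[%classic) : R -> R)).
Proof.
apply: (@integrable_bounded_supp _ _ _ mu1 _ _ 1 _ _ (lebesgue_itvcc_fin a b)) => //.
- by move=> x; rewrite indicE; case: (_ \in _); rewrite ?normr1// normr0.
- move=> x /= /negP xcd; rewrite indicE memNset//= in_itv /=.
  by move=> /andP[/ltW h1 /ltW h2]; move: xcd; rewrite in_itv /= h1 h2.
Qed.

Lemma lebesgue_itvoo (a b : R) : a <= b -> mu1 `]a, b[%classic = (b - a)%:E.
Proof.
move=> ab; rewrite lebesgue_measure_itv /= lte_fin.
case: ltP => // ba; have -> : b = a by apply/eqP; rewrite eq_le ba ab.
by rewrite subrr.
Qed.

Lemma measurable_le_ind (s : R) : measurable_fun (setT : set mR) (fun t : R => (t <= s)%R%:R : R).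
Proof.
rewrite (_ : (fun t : R => (t <= s)%R%:R) = \1_(`]-oo, s]%classic))//.
by apply/funext => t; rewrite indicE mem_setE /= in_itv.
Qed.

Variables (l : R) (f g : R3 -> R) (hm : R2 -> R).
Hypothesis l0 : 0 < l.
Hypotheses (mf : measurable_fun (setT : set (mR * mR * mR)) f)
           (mg : measurable_fun (setT : set (mR * mR * mR)) g)
           (mh : measurable_fun (setT : set (mR * mR)) hm).
Hypotheses (f2 : mu3.-integrable setT (EFin \o (fun x => f x ^+ 2)))
           (g2 : mu3.-integrable setT (EFin \o (fun x => g x ^+ 2)))
           (h2 : mu2.-integrable setT (EFin \o (fun x => hm x ^+ 2))).
Hypotheses (fO : forall x, ~ Omega l x -> f x = 0)
           (gO : forall x, ~ Omega l x -> g x = 0).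
(** The minus sign is the vertical component of the exterior normal on the lower boundary, the only
    one seen by such a [psi]. *)
Hypothesis tr : forall (i : box_idx) (psi : R -> R), test_fun psi ->
  (forall s, l <= s -> psi s = 0) ->
  \int[mu3]_x (f x * (theta i x.1 * 'D_1 psi x.2))
  + \int[mu3]_x (g x * (theta i x.1 * psi x.2))
  = - ((\int[mu2]_y (hm y * theta i y)) * psi (- l)).

Let P (y : R2) (s : R) := prim (fun t => g (y, t)) s.

Let itv (s : R) : R := \1_(`](- l), l[%classic) s.

Let outO (F : R3 -> R) : (forall x, ~ Omega l x -> F x = 0) ->
  forall x, F x = F x * itv x.2.
Proof.
move=> FO x; rewrite /itv indicE mem_setE /= in_itv /=.
have [h|h] := boolP (- l < x.2 < l); first by rewrite mulr1.
by rewrite mulr0 FO//; exact/negP.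
Qed.

Let sqr_gauss2 : mu3.-integrable setT
  (EFin \o (fun x : R3 => (gauss2 x.1 * itv x.2) ^+ 2)).
Proof.
have iG := integrable_tens leb3E (@integrable_gauss2 R) (integrable_itv (- l) l).
apply: (integrable_dom _ (integrable_scale (normal_peak 1 ^+ 2) iG)).
  by apply: measurable_funX; exact: integrable_EFin_measurable iG.
move=> x; rewrite ger0_norm ?sqr_ge0// -/(itv x.2).
have -> : (gauss2 x.1 * itv x.2) ^+ 2 = gauss2 x.1 * (gauss2 x.1 * itv x.2).
  rewrite exprMn /itv indicE; case: (_ \in _); rewrite ?expr1n ?expr0n /=; ring.
apply: ler_wpM2r; last exact: gauss2_le.
by rewrite mulr_ge0// ltW// gauss2_gt0.
Qed.

(** The Gaussian restricted to the strip is square integrable, so its product with a square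
    integrable function supported in the strip is integrable. *)
Let iFG (F : R3 -> R) : measurable_fun (setT : set (mR * mR * mR)) F ->
  mu3.-integrable setT (EFin \o (fun x => F x ^+ 2)) ->
  (forall x, ~ Omega l x -> F x = 0) ->
  mu3.-integrable setT (EFin \o (fun x => F x * gauss2 x.1)).
Proof.
move=> mF F2 FO.
have iG := integrable_tens leb3E (@integrable_gauss2 R) (integrable_itv (- l) l).
have := integrable_mul_sqr mF (integrable_EFin_measurable iG) F2 sqr_gauss2.
rewrite (_ : (fun x => F x * _) = fun x => F x * gauss2 x.1)//.
by apply/funext => x; rewrite [in RHS](outO FO) /itv; ring.
Qed.

Let iFb (F : R3 -> R) (B : R3 -> R) (M : R) :
  measurable_fun (setT : set (mR * mR * mR)) F ->
  mu3.-integrable setT (EFin \o (fun x => F x ^+ 2)) ->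
  (forall x, ~ Omega l x -> F x = 0) ->
  measurable_fun (setT : set (mR * mR * mR)) B ->
  (forall x, `|B x| <= M * gauss2 x.1) ->
  mu3.-integrable setT (EFin \o (fun x => F x * B x)).
Proof.
move=> mF F2 FO mB BM; have i1 := iFG mF F2 FO.
apply: (integrable_dom _ (integrable_scale M (integrable_norm i1))).
  exact: measurable_funM.
move=> x; rewrite normrM [`|F x * gauss2 _|]normrM mulrCA.
by apply: ler_wpM2l => //; rewrite [`|gauss2 _|]ger0_norm// ltW// gauss2_gt0.
Qed.

Let mtp (i : box_idx) (psi : R -> R) : measurable_fun (setT : set mR) psi ->
  measurable_fun (setT : set (mR * mR * mR)) (fun x : R3 => theta i x.1 * psi x.2).
Proof. by move=> mp; exact: (measurable_tens (@measurable_theta R i) mp). Qed.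

Let iFt (F : R3 -> R) (i : box_idx) (psi : R -> R) (M : R) :
  measurable_fun (setT : set (mR * mR * mR)) F ->
  mu3.-integrable setT (EFin \o (fun x => F x ^+ 2)) ->
  (forall x, ~ Omega l x -> F x = 0) ->
  measurable_fun (setT : set mR) psi -> (forall s, `|psi s| <= M) ->
  mu3.-integrable setT (EFin \o (fun x => F x * (theta i x.1 * psi x.2))).
Proof.
move=> mF F2 FO mp pM; apply: (iFb (M := M) mF F2 FO (mtp i mp)) => x.
rewrite normrM mulrC; apply: ler_pM => //; exact: theta_bound.
Qed.

Let iFt1 (F : R3 -> R) (i : box_idx) :
  measurable_fun (setT : set (mR * mR * mR)) F ->
  mu3.-integrable setT (EFin \o (fun x => F x ^+ 2)) ->
  (forall x, ~ Omega l x -> F x = 0) ->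
  mu3.-integrable setT (EFin \o (fun x => F x * theta i x.1)).
Proof.
move=> mF F2 FO.
have := iFt i mF F2 FO (@measurable_cst _ _ _ _ setT (1 : R)) (M := 1).
rewrite (_ : (fun x => _) = fun x => F x * theta i x.1).
  by apply => s; rewrite normr1.
by apply/funext => x /=; rewrite mulr1.
Qed.

Let Pmu (y : R2) (s : R) : P y s = \int[mu1]_t (g (y, t) * (t <= s)%R%:R).
Proof. exact: prim_indic. Qed.

(** For each [i] the moment of the slice at height [s] solves a one-variable weak equation with
    initial value the moment of [hm]. Countability gives one null set of heights for all [i], and at
    the other heights [ae_eq0_theta] removes the test. *)
Lemma strip_trace : {ae mu1, forall s, - l < s < l ->
  {ae mu2, forall y, f (y, s) = hm y + P y s}}.
Proof.
have H1 : {ae mu1, forall s, forall i, - l < s < l ->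
    \int[mu2]_y (f (y, s) * theta i y) =
    \int[mu2]_y (hm y * theta i y) + prim (fun t => \int[mu2]_y (g (y, t) * theta i y)) s}.
  apply: ae_forall_count => i.
  have itf := iFt1 i mf f2 fO; have itg := iFt1 i mg g2 gO.
  apply: (@weak_derivative1 R (- l) l).
  - exact: (integrable_fubini2 leb3E itf).
  - exact: (integrable_fubini2 leb3E itg).
  - move=> s sl; rewrite /Rintegral integral0_eq// => y _; rewrite fO ?mul0r//.
    by move=> /andP[h1 h3]; move: sl; rewrite (ltW h1) h3.
  - move=> s sl; rewrite /Rintegral integral0_eq// => y _; rewrite gO ?mul0r//.
    by move=> /andP[h1 h3]; move: sl; rewrite (ltW h1) h3.
  move=> psi tpsi psil; rewrite -(tr i tpsi psil).
  have [M [L [_ pM _]]] := test_fun_bounded tpsi.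
  have [M' [L' [_ pM' _]]] := test_fun_bounded (test_fun_derive tpsi).
  have mp : measurable_fun (setT : set mR) psi.
    by apply: smooth1_measurable; have [] := tpsi.
  have mp' : measurable_fun (setT : set mR) (fun s => 'D_1 psi s).
    by apply: smooth1_measurable; have [] := test_fun_derive tpsi.
  congr (_ + _).
  - rewrite (Rfubini2 leb3E (iFt i mf f2 fO mp' pM')).
    apply: Rintegral_ae_eq; move: (ae_fubini2 leb3E itf); apply: ae_imp => s is_.
    rewrite -RintegralZr//.
    by congr (Rintegral mu2 setT _); apply/funext => y /=; ring.
  - rewrite (Rfubini2 leb3E (iFt i mg g2 gO mp pM)).
    apply: Rintegral_ae_eq; move: (ae_fubini2 leb3E itg); apply: ae_imp => s is_.
    rewrite -RintegralZr//.
    by congr (Rintegral mu2 setT _); apply/funext => y /=; ring.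
have H2 := ae_fubini2 leb3E (iFG mf f2 fO).
move: H1 H2; apply: ae_imp2 => s Hs if_ sl.
have hG : mu2.-integrable setT (EFin \o (fun y => hm y * gauss2 y)).
  apply: integrable_mul_sqr => //; first exact: measurable_gauss2.
  apply: (integrable_dom _ (integrable_scale (normal_peak 1 ^+ 2) (@integrable_gauss2 R))).
    by apply: measurable_funX; exact: measurable_gauss2.
  move=> y; rewrite ger0_norm ?sqr_ge0// [leLHS]expr2.
  by apply: ler_wpM2r; [exact/ltW/gauss2_gt0|exact: gauss2_le].
have ggs : mu3.-integrable setT
    (EFin \o (fun x : R3 => g x * (gauss2 x.1 * (x.2 <= s)%R%:R))).
  apply: (iFb (M := 1) mg g2 gO (measurable_tens (@measurable_gauss2 R) (measurable_le_ind s))) => x.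
  rewrite mul1r normrM ger0_norm ?(ltW (gauss2_gt0 _))//.
  rewrite ler_piMr ?(ltW (gauss2_gt0 _))//.
  by case: (x.2 <= s); rewrite ?normr1// normr0.
have gts i : mu3.-integrable setT
    (EFin \o (fun x : R3 => g x * (theta i x.1 * (x.2 <= s)%R%:R))).
  apply: (iFt (M := 1) i mg g2 gO (measurable_le_ind s)) => t.
  by case: (t <= s); rewrite ?normr1// normr0.
have aeg : {ae mu2, forall y, mu1.-integrable setT (EFin \o (fun t => g (y, t) * (t <= s)%R%:R))}.
  move: (ae_fubini1 leb3E ggs); apply: ae_imp => y /= iy.
  have <- : (fun t => (gauss2 y)^-1 * (g (y, t) * (gauss2 y * (t <= s)%R%:R))) =
      (fun t => g (y, t) * (t <= s)%R%:R).
    by apply/funext => t; rewrite mulrCA mulKf// gt_eqF// gauss2_gt0.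
  exact: integrable_scale.
(* Fubini applies to the weighted integral [Q], not directly to [P], since [g] is integrable only
   after weighting; the two agree up to the weight for almost every [y]. *)
pose Q y := \int[mu1]_t (g (y, t) * (gauss2 y * (t <= s)%R%:R)).
have iQ : mu2.-integrable setT (EFin \o Q) := integrable_fubini1 leb3E ggs.
have QP : {ae mu2, forall y, (gauss2 y)^-1 * Q y = P y s}.
  move: aeg; apply: ae_imp => y iy; rewrite Pmu /Q.
  rewrite (_ : (fun t => g (y, t) * (gauss2 y * (t <= s)%R%:R)) =
            (fun t => gauss2 y * (g (y, t) * (t <= s)%R%:R))); last first.
    by apply/funext => t; ring.
  by rewrite RintegralZl// mulKf// gt_eqF// gauss2_gt0.
have W0 : {ae mu2, forall y, f (y, s) - hm y - (gauss2 y)^-1 * Q y = 0}.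
  apply: ae_eq0_theta.
    have := integrable_sub (integrable_sub if_ hG) iQ.
    rewrite (_ : (fun x => _) = fun y => (f (y, s) - hm y - (gauss2 y)^-1 * Q y) * gauss2 y)//.
    apply/funext => y /=; have /eqP gn0 : gauss2 y != 0 by rewrite gt_eqF// gauss2_gt0.
    by field; exact/eqP.
  move=> i.
  have ib F : mu2.-integrable setT (EFin \o (fun y => F y * gauss2 y)) ->
      mu2.-integrable setT (EFin \o (fun y => F y * theta i y)).
    move=> iF; have := integrable_mul_bounded iF (@measurable_boxbump R i) (@boxbump_bound R i).
    rewrite (_ : (fun x => _) = fun y => F y * theta i y)//.
    by apply/funext => y; rewrite theta_gauss2; ring.
  have iQg : mu2.-integrable setT (EFin \o (fun y => (gauss2 y)^-1 * Q y * gauss2 y)).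
    have -> : (fun y => (gauss2 y)^-1 * Q y * gauss2 y) = Q by
      apply/funext => y; rewrite mulrC mulVKf// gt_eqF// gauss2_gt0.
    exact: iQ.
  have -> : (fun y => (f (y, s) - hm y - (gauss2 y)^-1 * Q y) * theta i y) =
      (fun y => f (y, s) * theta i y - hm y * theta i y
      - (gauss2 y)^-1 * Q y * theta i y) by apply/funext => y; ring.
  have i1 := ib _ if_; have i2 := ib _ hG; have i3 := ib _ iQg.
  rewrite RintegralB//; last exact: integrable_sub.
  rewrite (RintegralB _ i1 i2)// Hs// [X in X - _]addrAC subrr add0r.
  apply/eqP; rewrite subr_eq0; apply/eqP.
  rewrite prim_indic.
  have -> : \int[mu2]_y ((gauss2 y)^-1 * Q y * theta i y) =
      \int[mu2]_y \int[mu1]_t (g (y, t) * (theta i y * (t <= s)%R%:R)).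
    apply: Rintegral_ae_eq; move: QP aeg; apply: ae_imp2 => y -> iy; rewrite Pmu.
    rewrite mulrC -RintegralZl//.
    by congr (Rintegral mu1 setT _); apply/funext => t; ring.
  rewrite -(Rfubini1 leb3E (gts i)) (Rfubini2 leb3E (gts i)).
  apply: Rintegral_ae_eq; move: (ae_fubini2 leb3E (iFt1 i mg g2 gO)); apply: ae_imp => t it.
  rewrite -RintegralZr//.
  by congr (Rintegral mu2 setT _); apply/funext => y /=; ring.
by move: W0 QP; apply: ae_imp2 => y + Qy; rewrite Qy; lra.
Qed.

End StripTrace.

Section LebesgueTools.
Context d {T : measurableType d} {R : realType}.
Variable mu : {measure set T -> \bar R}.
Implicit Types (f : T -> R).

Lemma le_Rintegral_ae f g : mu.-integrable setT (EFin \o f) ->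
  mu.-integrable setT (EFin \o g) -> {ae mu, forall x, f x <= g x} ->
  \int[mu]_x f x <= \int[mu]_x g x.
Proof.
move=> i_f ig fg.
have -> : \int[mu]_x f x = \int[mu]_x (Num.min (f x) (g x)).
  by apply: Rintegral_ae_eq; move: fg; apply: ae_imp => x ?; rewrite min_l.
apply: le_Rintegral => //; last by move=> x _; rewrite ge_min lexx orbT.
apply: (integrable_dom _ (integrable_add (integrable_norm i_f) (integrable_norm ig))).
  apply: measurable_minr.
    exact: integrable_EFin_measurable i_f.
  exact: integrable_EFin_measurable ig.
move=> x; have := normr_ge0 (f x); have := normr_ge0 (g x).
by case: (leP (f x) (g x)) => _; lra.
Qed.

Lemma ae_eq0_Rintegral f : mu.-integrable setT (EFin \o f) ->
  (forall x, 0 <= f x) -> \int[mu]_x f x = 0 -> {ae mu, forall x, f x = 0}.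
Proof.
move=> i_f f0 I0; have /integrableP[mf _] := i_f.
have [H _] := ae_eq_integral_abs mu measurableT mf.
have : ae_eq mu setT (EFin \o f) (cst 0%E).
  apply: H; rewrite (eq_integral (fun x => (f x)%:E)); last first.
    by move=> x _; rewrite gee0_abs// lee_fin.
  by rewrite -EFin_Rintegral// I0.
by apply: ae_imp => x /(_ I) [].
Qed.

Lemma Lfun_measurable p f : f \in Lfun mu p -> measurable_fun setT f.
Proof. by rewrite inE => /andP[]; rewrite inE. Qed.

Lemma Lfun_oo_bound f : f \in Lfun mu +oo%E ->
  exists2 M, 0 <= M & {ae mu, forall x, `|f x| <= M}.
Proof.
move=> /[dup] /Lfun_measurable mf.
rewrite inE => /andP[_]; rewrite inE /= /finite_norm unlock.
case: ifPn => [m0 foo|]; last first.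
  rewrite -leNgt => m0 _; exists 0 => //; exists setT; split => //.
  by apply/eqP; rewrite eq_le m0 measure_ge0.
have fz : (0 <= ess_sup mu (abse \o (EFin \o f)))%E.
  by apply: ess_sup_gee => //; apply: aeW => x /=; rewrite lee_fin.
exists (fine (ess_sup mu (abse \o (EFin \o f)))); first exact: fine_ge0.
have := ess_sup_ge mu (abse \o (EFin \o f)); apply: ae_imp => x /=.
by rewrite -lee_fin fineK// ge0_fin_numE.
Qed.

Lemma Lnorm_oo_bound f M : 0 <= M -> ('N[mu]_+oo[EFin \o f] <= M%:E)%E ->
  {ae mu, forall x, `|f x| <= M}.
Proof.
move=> M0; rewrite unlock; case: ifPn => [m0 /ess_supP|]; first exact: ae_imp.
rewrite -leNgt => m0 _; exists setT; split => //.
by apply/eqP; rewrite eq_le m0 measure_ge0.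
Qed.

Lemma bounded_Lfun_oo f M : measurable_fun setT f ->
  {ae mu, forall x, `|f x| <= M} -> f \in Lfun mu +oo%E.
Proof.
move=> mf fM; rewrite inE; apply/andP; split; rewrite inE//= /finite_norm unlock.
case: ifPn => // m0; apply: (@le_lt_trans _ _ M%:E); last by rewrite ltey.
by apply/ess_supP; move: fM; apply: ae_imp => x; rewrite lee_fin.
Qed.

Lemma LnormE2 f : measurable_fun setT f ->
  mu.-integrable setT (EFin \o (fun x => f x ^+ 2)) ->
  ('N[mu]_2%:E[EFin \o f] = (Num.sqrt (\int[mu]_x (f x ^+ 2))%R)%:E)%E.
Proof.
move=> mf i2; rewrite unlock.
have -> : (fun x => `|(EFin \o f) x| `^ 2)%E = EFin \o (fun x => f x ^+ 2).
  by apply/funext => x /=; rewrite powR_mulrn// real_normK// num_real.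
have := EFin_Rintegral i2; rewrite /comp => <-.
by rewrite poweR_EFin -powR12_sqrt// Rintegral_ge0// => x _; exact: sqr_ge0.
Qed.

Lemma Lfun2I f : measurable_fun setT f ->
  mu.-integrable setT (EFin \o (fun x => f x ^+ 2)) -> f \in Lfun mu 2%:E.
Proof.
move=> mf i2; rewrite inE; apply/andP; split; rewrite inE//= /finite_norm.
by rewrite LnormE2// ltry.
Qed.

End LebesgueTools.

Section StripEstimate.
Context {R : realType}.
Local Notation R2 := (R * R)%type.
Local Notation R3 := (R * R * R)%type.
Local Notation mR := (measurableTypeR R).
Local Notation mu1 := (@lebesgue_measure R).
Local Notation mu2 := (@leb2 R).
Local Notation mu3 := (@leb3 R).
Variables (l : R) (f g : R3 -> R) (hm : R2 -> R).
Hypothesis l0 : 0 < l.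
Hypotheses (mf : measurable_fun (setT : set (mR * mR * mR)) f)
           (mg : measurable_fun (setT : set (mR * mR * mR)) g)
           (mh : measurable_fun (setT : set (mR * mR)) hm).
Hypotheses (f2 : mu3.-integrable setT (EFin \o (fun x => f x ^+ 2)))
           (g2 : mu3.-integrable setT (EFin \o (fun x => g x ^+ 2)))
           (h2 : mu2.-integrable setT (EFin \o (fun x => hm x ^+ 2))).
Hypotheses (fO : forall x, ~ Omega l x -> f x = 0)
           (gO : forall x, ~ Omega l x -> g x = 0).
Hypothesis tr : forall (i : box_idx) (psi : R -> R), test_fun psi ->
  (forall s, l <= s -> psi s = 0) ->
  \int[mu3]_x (f x * (theta i x.1 * 'D_1 psi x.2))
  + \int[mu3]_x (g x * (theta i x.1 * psi x.2))
  = - ((\int[mu2]_y (hm y * theta i y)) * psi (- l)).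

Let gs (y : R2) : R := \int[mu1]_t (g (y, t) ^+ 2).

(** Cauchy-Schwarz on []- l, l[], whose length is the factor [2 * l]. *)
Lemma prim_sqr_le (y : R2) s : mu1.-integrable setT (EFin \o (fun t => g (y, t) ^+ 2)) ->
  prim (fun t => g (y, t)) s ^+ 2 <= 2 * l * gs y.
Proof.
move=> iy; rewrite prim_indic.
have mgy : measurable_fun (setT : set mR) (fun t => g (y, t)).
  by apply: measurableT_comp; [exact: mg|exact: measurable_pair1].
have mgi := measurable_funM mgy (measurable_le_ind s).
have fin : (mu1 `](- l)%R, l[%classic < +oo)%E by rewrite lebesgue_itvoo ?ltry//; move: l0; lra.
have out t : ~ `](- l)%R, l[%classic t -> g (y, t) * (t <= s)%R%:R = 0.
  move=> tl; rewrite gO ?mul0r// /Omega /=; move=> h; apply: tl.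
have := cauchy_schwarz1 (mu := mu1) (measurable_itv `](- l), l[) fin mgi out.
have ll : - l <= l by move: l0; lra.
rewrite (lebesgue_itvoo ll : (mu1 : measure _ _) _ = _) /=.
have le (t : R) : (g (y, t) * (t <= s)%R%:R) ^+ 2 <= g (y, t) ^+ 2.
  by case: (t <= s); rewrite ?mulr1// mulr0 expr0n /= sqr_ge0.
have i2 : mu1.-integrable setT (EFin \o (fun t => (g (y, t) * (t <= s)%R%:R) ^+ 2)).
  apply: (integrable_dom _ iy) => [|t]; first exact: measurable_funX.
  by rewrite ger0_norm ?sqr_ge0.
have -> : (\int[mu1]_x ((g (y, x) * (x <= s)%R%:R) ^+ 2)%:E =
  (\int[mu1]_x ((g (y, x) * (x <= s)%R%:R) ^+ 2))%:E)%E by rewrite EFin_Rintegral.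
rewrite -EFinM lee_fin => /le_trans; apply.
rewrite (_ : l - - l = 2 * l); last ring.
apply: ler_wpM2l; first by move: l0; lra.
exact: le_Rintegral.
Qed.

Lemma strip_sqr : \int[mu3]_x (f x ^+ 2) <=
  4 * l * \int[mu2]_y (hm y ^+ 2) + 8 * l ^+ 2 * \int[mu3]_x (g x ^+ 2).
Proof.
have igs : mu2.-integrable setT (EFin \o gs) := integrable_fubini1 leb3E g2.
have gsE : \int[mu2]_y gs y = \int[mu3]_x (g x ^+ 2) by rewrite (Rfubini1 leb3E g2).
set A := \int[mu2]_y (hm y ^+ 2); set B := \int[mu3]_x (g x ^+ 2).
have A0 : 0 <= A by apply: Rintegral_ge0 => x _; exact: sqr_ge0.
have B0 : 0 <= B by apply: Rintegral_ge0 => x _; exact: sqr_ge0.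
(* The square of a sum is at most twice the sum of the squares, and [prim_sqr_le] bounds the second
   one: [K] controls every slice. Integration over a height [2 * l] then produces the coefficients
   [4 * l] and [8 * l ^+ 2]. *)
pose K : R := 2 * A + 4 * l * B.
have aeg := ae_fubini1 leb3E g2.
have slice : {ae mu1, forall s, \int[mu2]_y (f (y, s) ^+ 2) <= K * \1_(`](- l), l[%classic) s}.
  move: (strip_trace mf mg mh f2 g2 h2 fO gO tr) (ae_fubini2 leb3E f2).
  apply: ae_imp2 => s Hs is_.
  have [sl|sl] := boolP (- l < s < l); last first.
    rewrite indicE memNset ?mulr0; last by rewrite /= in_itv; exact/negP.
    rewrite (@Rintegral_ae_eq _ _ _ mu2 _ (fun=> 0)).
      by rewrite /Rintegral integral0.
    by apply: aeW => y; rewrite fO ?expr0n//; exact/negP.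
  rewrite indicE mem_set ?mulr1; last by rewrite /= in_itv.
  have {}Hs := Hs sl.
  have iK : mu2.-integrable setT (EFin \o (fun y => 2 * hm y ^+ 2 + 4 * l * gs y)).
    by apply: integrable_add; exact: integrable_scale.
  have -> : K = \int[mu2]_y (2 * hm y ^+ 2 + 4 * l * gs y).
    rewrite RintegralD//; [|exact: integrable_scale|exact: integrable_scale].
    by rewrite !RintegralZl// gsE.
  apply: le_Rintegral_ae => //.
  move: Hs aeg; apply: ae_imp2 => y -> iy.
  have := prim_sqr_le s iy; set p := prim _ _; set q := gs y => hp.
  have := sqr_ge0 (hm y - p); rewrite sqrrB sqrrD mulr2n; lra.
have iL : mu1.-integrable setT
    (EFin \o (fun s => K * \1_(`](- l), l[%classic) s : R)).
  by apply: integrable_scale; exact: integrable_itv.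
rewrite (Rfubini2 leb3E f2).
have -> : 4 * l * A + 8 * l ^+ 2 * B = \int[mu1]_s (K * \1_(`](- l), l[%classic) s).
  rewrite RintegralZl//; last exact: integrable_itv.
  have -> : \int[mu1]_s (\1_(`](- l), l[%classic) s : R) = 2 * l.
    rewrite /Rintegral integral_indic// setIT.
    have ll : - l <= l by move: l0; lra.
    by have /(congr1 fine) /= := lebesgue_itvoo ll => ->; ring.
  rewrite /K; ring.
have if2 := integrable_fubini2 leb3E f2.
exact: le_Rintegral_ae.
Qed.

End StripEstimate.

Lemma ae_exists_itv {R : realType} (P : R -> Prop) (a b : R) : a < b ->
  {ae (@lebesgue_measure R), forall t, P t} -> exists t, a < t < b /\ P t.
Proof.
move=> ab [N [mN N0 PN]]; apply: contrapT => nP.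
have abN : `]a, b[%classic `<=` N.
  move=> t; rewrite /= in_itv /= => tab; apply: PN => Pt; apply: nP.
  by exists t.
have abE : (@lebesgue_measure R) `]a, b[%classic = (b - a)%:E := lebesgue_itvoo (ltW ab).
have N0' : (@lebesgue_measure R N <= 0)%E by rewrite N0.
have : ((b - a)%:E <= 0)%E.
  rewrite -abE; apply: le_trans N0'.
  exact: (le_measure (@lebesgue_measure R) (mem_set (measurable_itv `]a, b[)) (mem_set mN) abN).
by rewrite lee_fin; lra.
Qed.

Lemma derive_along0 {R : realType} {V : normedModType R} (f : V -> R) (x : V) :
  'D_0 f x = 0.
Proof.
rewrite /derive; apply: (@lim_near_cst _ (@Rhausdorff R)).
by apply: nearW => h /=; rewrite scaler0 add0r subrr scaler0.
Qed.

Lemma frob_sqr {R : realType} n (A : 'M[R]_n) : frob A A = \sum_i \sum_j A i j ^+ 2.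
Proof.
rewrite /frob /mxtrace; apply: eq_bigr => i _; rewrite mxE.
by apply: eq_bigr => j _; rewrite mxE expr2.
Qed.

Lemma sqr_le_frob {R : realType} n (A : 'M[R]_n) i j : A i j ^+ 2 <= frob A A.
Proof.
rewrite frob_sqr (bigD1 i)//= (bigD1 j)//= -addrA lerDl addr_ge0//.
  by apply: sumr_ge0 => k _; exact: sqr_ge0.
by apply: sumr_ge0 => k _; apply: sumr_ge0 => m _; exact: sqr_ge0.
Qed.

Lemma sqr_le_normsq {R : realType} n (a : 'rV[R]_n) i : a 0 i ^+ 2 <= normsq a.
Proof.
rewrite /normsq /dot (bigD1 i)//= expr2 lerDl; apply: sumr_ge0 => k _.
by rewrite -expr2 sqr_ge0.
Qed.

Lemma frob_ge0 {R : realType} n (A : 'M[R]_n) : 0 <= frob A A.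
Proof. by rewrite frob_sqr; apply: sumr_ge0 => i _; apply: sumr_ge0 => j _; exact: sqr_ge0. Qed.

Lemma normsq_ge0 {R : realType} n (a : 'rV[R]_n) : 0 <= normsq a.
Proof. by apply: sumr_ge0 => i _; rewrite -expr2 sqr_ge0. Qed.

Lemma integral_ae_ge0 d (T : measurableType d) (R : realType)
    (mu : {measure set T -> \bar R}) (D : set T) (f : T -> \bar R) :
  {ae mu, forall x, D x -> (0 <= f x)%E} -> (0 <= \int[mu]_(x in D) f x)%E.
Proof.
move=> f0; rewrite integral_mkcond.
rewrite (@integral_ae_nonmeas _ _ _ mu _ (fun x => `|(f \_ D) x|%E)).
  exact: integral_ge0.
move: f0; apply: ae_imp => x h; rewrite /patch; case: ifPn => [Dx|]; last by rewrite abse0.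
by rewrite gee0_abs//; apply: h; rewrite inE in Dx.
Qed.

(** * Consequences of the energy inequality *)

Section EnergyEstimate.
Context {R : realType}.
Local Notation R2 := (R * R)%type.
Local Notation R3 := (R * R * R)%type.
Local Notation mR := (measurableTypeR R).
Local Notation mu1 := (@lebesgue_measure R).
Local Notation mu2 := (@leb2 R).
Local Notation mu3 := (@leb3 R).
Local Notation mu_tx := (@leb_tx R).
Local Notation mu_th := (@leb_th R).

Lemma leb_txE : (mu_tx : set _ -> _) = (mu1 \x mu3)%E. Proof. by []. Qed.
Lemma leb_thE : (mu_th : set _ -> _) = (mu1 \x mu2)%E. Proof. by []. Qed.

Variables (eps l alpha : R) (rhoin : R3 -> R) (momin : R3 -> 'rV[R]_3)
    (rho : R * R3 -> R) (u : R * R3 -> 'rV[R]_3)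
    (Du : R * R3 -> 'M[R]_3) (gam : bool -> R * R2 -> 'rV[R]_3).
Hypothesis W : weak_solution_with eps l alpha rhoin momin rho u Du gam.
Hypotheses (l0 : 0 < l) (alpha0 : 0 < alpha).
Variables (T1 E : R).
Hypothesis T0 : 0 < T1.
Hypothesis hE : (\int[mu3]_(x in Omega l) (normsq (momin x) / rhoin x)%:E <= E%:E)%E.

Let D : set (R * R3) := `[0, T1[ `*` Omega l.
Let Dh : set (R * R2) := `[0, T1[ `*` setT.

(** The energy inequality is available at almost every time only, so a valid time is picked just
    after [T1]; the dissipation up to it dominates the one up to [T1]. The kinetic energy is
    nonnegative at almost every time and is dropped. *)
Lemma good_time : exists t, [/\ T1 < t,
  (\int[mu_tx]_(z in `[0%R, t] `*` Omega l) (frob (Du z) (Du z))%:E <= E%:E)%E &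
  ((2 * alpha)%:E * \sum_(b : bool)
     \int[mu_th]_(y in `[0%R, t] `*` setT) (normsq (gam b y))%:E <= E%:E)%E].
Proof.
have A : {ae mu1, forall t, 0 <= t ->
    (0 <= \int[mu3]_(x in Omega l) (rho (t, x) * normsq (u (t, x)))%:E)%E}.
  move: (ae_prod1 leb_txE (ws_rho_ge0 W)); apply: ae_imp => t h t0.
  apply: integral_ae_ge0; move: h; apply: ae_imp => x h Ox.
  by rewrite lee_fin mulr_ge0 ?normsq_ge0// h.
have [t [/andP[tT _] ht]] : exists t, T1 < t < T1 + 1 /\ (0 <= t -> 
   (0 <= \int[mu3]_(x in Omega l) (rho (t, x) * normsq (u (t, x)))%:E)%E /\
    ((2^-1)%:E * \int[mu3]_(x in Omega l) (rho (t, x) * normsq (u (t, x)))%:E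
     + \int[mu_tx]_(z in `[0%R, t] `*` Omega l) (frob (Du z) (Du z))%:E
     + (2 * alpha)%:E * \sum_(b : bool)
         \int[mu_th]_(y in `[0%R, t] `*` setT) (normsq (gam b y))%:E
     <= \int[mu3]_(x in Omega l) (normsq (momin x) / rhoin x)%:E)%E).
  apply: ae_exists_itv; first lra.
  by move: A (ws_energy W); apply: ae_imp2 => t h1 h2 t0; split; [exact: h1|exact: h2].
have t0 : 0 <= t by move: T0 tT; lra.
have [h1 h2] := ht t0; exists t.
have h3 : (0 <= \int[mu_tx]_(z in `[0%R, t] `*` Omega l) (frob (Du z) (Du z))%:E)%E.
  by apply: integral_ge0 => z _; rewrite lee_fin frob_ge0.
have h4 : (0 <= (2 * alpha)%:E * \sum_(b : bool)
     \int[mu_th]_(y in `[0%R, t] `*` setT) (normsq (gam b y))%:E)%E.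
  apply: mule_ge0; first by rewrite lee_fin mulr_ge0// ltW.
  by apply: sume_ge0 => b _; apply: integral_ge0 => z _; rewrite lee_fin normsq_ge0.
split => //; apply: le_trans (le_trans h2 hE).
  apply: (@le_trans _ _ (\int[mu_tx]_(z in `[0%R, t] `*` Omega l) (frob (Du z) (Du z))%:E
    + (2 * alpha)%:E * \sum_(b : bool)
     \int[mu_th]_(y in `[0%R, t] `*` setT) (normsq (gam b y))%:E)%E); first by rewrite leeDl.
  by rewrite leeD2r// leeDr// mule_ge0// lee_fin.
by rewrite leeDr// adde_ge0// mule_ge0// lee_fin.
Qed.

Let Up i := (fun z => u z 0 i) \_ D.
Let Gp i j := (fun z => Du z i j) \_ D.
Let Hp b i := (fun y => gam b y 0 i) \_ Dh.

Lemma energy_Du i j : \int[mu_tx]_z (Gp i j z ^+ 2) <= E.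
Proof.
have [t [tT h _]] := good_time.
have G2 := Lfun2_integrable_sqr (ws_Du_L2 W T0 i j).
rewrite -lee_fin (EFin_Rintegral G2); apply: le_trans h.
rewrite [leRHS]integral_mkcond; apply: le_integral_ae_nonmeas.
- by move=> z; rewrite lee_fin sqr_ge0.
- by apply: erestrict_ge0 => z _; rewrite lee_fin frob_ge0.
apply: aeW => z; rewrite /Gp /patch /D; case: ifPn => [|_]; last first.
  by rewrite expr0n /=; case: ifPn => // _; rewrite lee_fin frob_ge0.
rewrite inE /= in_itv /= => -[/andP[t0 t1] Oz].
rewrite mem_set ?lee_fin ?sqr_le_frob//; split => //=.
by rewrite in_itv /= t0 ltW// (lt_trans t1).
Qed.

Lemma energy_trace b i : \int[mu_th]_y (Hp b i y ^+ 2) <= E / (2 * alpha).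
Proof.
have [t [tT _ h]] := good_time.
have H2 := Lfun2_integrable_sqr (ws_gam_L2 W T0 b i).
have a0 : 0 < 2 * alpha by rewrite mulr_gt0.
rewrite ler_pdivlMr// mulrC -lee_fin EFinM (EFin_Rintegral H2); apply: le_trans h.
apply: lee_wpmul2l; first by rewrite lee_fin ltW.
rewrite (bigD1 b)//=.
apply: (@le_trans _ _ (\int[mu_th]_(y in `[0%R, t] `*` setT) (normsq (gam b y))%:E)%E); last first.
  rewrite leeDl//; apply: sume_ge0 => c _; apply: integral_ge0 => y _.
  by rewrite lee_fin normsq_ge0.
rewrite [leRHS]integral_mkcond; apply: le_integral_ae_nonmeas.
- by move=> z; rewrite lee_fin sqr_ge0.
- by apply: erestrict_ge0 => z _; rewrite lee_fin normsq_ge0.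
apply: aeW => z; rewrite /Hp /patch /Dh; case: ifPn => [|_]; last first.
  by rewrite expr0n /=; case: ifPn => // _; rewrite lee_fin normsq_ge0.
rewrite inE /= in_itv /= => -[/andP[t0 t1] _].
rewrite mem_set ?lee_fin ?sqr_le_normsq//; split => //=.
by rewrite in_itv /= t0 ltW// (lt_trans t1).
Qed.

(* The trace is taken on the lower boundary: a test function which vanishes
   for s >= l only sees this component. *)
Lemma slice_estimate i : {ae mu1, forall t,
  \int[mu3]_x (Up i (t, x) ^+ 2) <=
  4 * l * \int[mu2]_y (Hp true i (t, y) ^+ 2)
  + 8 * l ^+ 2 * \int[mu3]_x (Gp i 2%:R (t, x) ^+ 2)}.
Proof.
have U2 := Lfun2_integrable_sqr (ws_u_L2 W T0 i).
have G2 := Lfun2_integrable_sqr (ws_Du_L2 W T0 i 2%:R).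
have H2 := Lfun2_integrable_sqr (ws_gam_L2 W T0 true i).
have mU := Lfun_measurable (ws_u_L2 W T0 i).
have mG := Lfun_measurable (ws_Du_L2 W T0 i 2%:R).
have mH := Lfun_measurable (ws_gam_L2 W T0 true i).
have sec d (T : measurableType d) (f : R * T -> R) t :
    measurable_fun (setT : set (mR * T)) f -> measurable_fun setT (fun x => f (t, x)).
  by move=> mf; apply: measurableT_comp; [exact: mf|exact: measurable_pair1].
move: (ae_fubini1 leb_txE U2) (ae_fubini1 leb_txE G2) (ae_fubini1 leb_thE H2).
move=> aU aG aH; have := @ae_imp3 _ _ _ mu1 _ _ _ _ (fun t a b c => conj a (conj b c)) aU aG aH.
move: (ws_gam W); apply: ae_imp2 => t + [iU [iG iH]].
have [tT|tT] := boolP (0 <= t < T1); last first.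
  move=> _; have -> : \int[mu3]_x (Up i (t, x) ^+ 2) = 0.
    rewrite /Rintegral integral0_eq// => x _; rewrite /Up /patch memNset ?expr0n//.
    by move=> -[/=]; rewrite in_itv /= (negbTE tT).
  have l1 : 0 <= 4 * l by move: l0; lra.
  have l2 : 0 <= 8 * l ^+ 2 by rewrite mulr_ge0 ?sqr_ge0.
  by apply: addr_ge0; apply: mulr_ge0 => //; apply: Rintegral_ge0 => x _; exact: sqr_ge0.
have memD x : ((t, x) \in D) = (x \in Omega l).
  apply/idP/idP; rewrite !inE; first by case.
  by move=> Ox; split => //=; rewrite in_itv.
have tD y : (t, y) \in Dh by rewrite inE; split => //=; rewrite in_itv.
move=> /(_ _ i); case/andP: (tT) => t0 _ /(_ t0) tr.
apply: strip_sqr => //; [exact: sec|exact: sec|exact: sec| | |].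
- by move=> x nO; rewrite /Up /patch memD memNset.
- by move=> x nO; rewrite /Gp /patch memD memNset.
move=> k psi tpsi psil.
have := tr (tens (theta k) psi) (test_fun_tens (test_fun_theta k) tpsi) 2%:R.
rewrite [X in X + _ = _]Rintegral_mkcond [X in _ + X = _]Rintegral_mkcond big_bool => trk.
have D3 x : 'D_(dir3 2%:R) (tens (theta k) psi) x = theta k x.1 * 'D_1 psi x.2.
  have [s3 _] := tpsi; have [s4 _] := @test_fun_theta R k.
  have -> : dir3 2%:R = ((0, 0), 1) :> R * R * R by [].
  rewrite (derive_tens _ _ s4 s3)/=.
  have -> : 'D_(0, 0) (theta k) x.1 = 0 :> R by exact: (@derive_along0 R (R * R)%type).
  by rewrite mul0r add0r.
transitivity (\int[mu3]_x ((fun x : R3 => u (t, x) 0 i * 'D_(dir3 2%:R) (tens (theta k) psi) x) \_ (Omega l)) x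
  + \int[mu3]_x ((fun x : R3 => row i (Du (t, x)) 0 2%:R * tens (theta k) psi x) \_ (Omega l)) x).
  congr (_ + _); congr (Rintegral mu3 setT _); apply/funext => x.
  - by rewrite /Up /patch memD; case: ifPn => // _; rewrite ?mul0r// D3.
  - by rewrite /Gp /patch memD; case: ifPn => // _; rewrite ?mul0r// mxE.
rewrite trk /= /bdpt expr0 mul1r expr1 mulN1r.
have -> : \int[mu2]_xh (gam false (t, xh) 0 i *
    tens (theta k) psi (xh, l) * normal false 0 2%:R) = 0.
  by rewrite /Rintegral integral0_eq// => y _; rewrite /tens /= psil// mulr0 mulr0 mul0r.
rewrite addr0.
have iT : mu2.-integrable setT (EFin \o (fun y => Hp true i (t, y) * theta k y)).
  apply: integrable_mul_sqr => //; [exact: sec|exact: measurable_theta|].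
  have tb (y : R2) : `|theta k y| <= normal_peak 1 ^+ 2.
    exact: le_trans (theta_bound k y) (gauss2_le y).
  exact: (integrable_mul_bounded (@integrable_theta R k) (@measurable_theta R k) tb).
rewrite mulrC -mulNr -RintegralZl//.
congr (Rintegral mu2 setT _); apply/funext => y.
rewrite /Hp /patch tD /tens /normal /e_3 !mxE /= expr1; ring.
Qed.

Lemma velocity_estimate i : \int[mu_tx]_z (Up i z ^+ 2) <=
  (2 * l / alpha + 8 * l ^+ 2) * E.
Proof.
have U2 := Lfun2_integrable_sqr (ws_u_L2 W T0 i).
have G2 := Lfun2_integrable_sqr (ws_Du_L2 W T0 i 2%:R).
have H2 := Lfun2_integrable_sqr (ws_gam_L2 W T0 true i).
have l2 : 0 <= 8 * l ^+ 2 by rewrite mulr_ge0 ?sqr_ge0.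
apply: (@le_trans _ _ (4 * l * (E / (2 * alpha)) + 8 * l ^+ 2 * E)); last first.
  have an0 : alpha != 0 by rewrite gt_eqF.
  by rewrite le_eqVlt; apply/orP; left; apply/eqP; field.
apply: (@le_trans _ _ (4 * l * \int[mu_th]_y (Hp true i y ^+ 2)
    + 8 * l ^+ 2 * \int[mu_tx]_z (Gp i 2%:R z ^+ 2))); last first.
  have l1 : 0 <= 4 * l by move: l0; lra.
  by apply: lerD; apply: ler_wpM2l => //; [exact: energy_trace|exact: energy_Du].
rewrite (Rfubini1 leb_txE U2) (Rfubini1 leb_txE G2) (Rfubini1 leb_thE H2).
have iU := integrable_fubini1 leb_txE U2.
have iG := integrable_fubini1 leb_txE G2.
have iH := integrable_fubini1 leb_thE H2.
rewrite -RintegralZl// -RintegralZl// -RintegralD//; [|exact: integrable_scale..].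
apply: le_Rintegral_ae => //; last exact: slice_estimate.
by apply: integrable_add; exact: integrable_scale.
Qed.

End EnergyEstimate.

(** * The mass equation *)

(** At [s = d] only the difference quotients from the right are known; they determine the
    derivative, which exists by hypothesis. *)
Lemma derive_right0 {R : realType} (psi : R -> R) (d : R) :
  (forall x, derivable psi x 1) -> (forall s, d <= s -> psi s = 0) ->
  forall s, d <= s -> 'D_1 psi s = 0.
Proof.
move=> dpsi psi0 s ds.
rewrite /derive cvg_at_rightE; last exact: dpsi.
apply: (@lim_near_cst _ (@Rhausdorff R)).
near=> h; have h0 : 0 < h by near: h; exact: nbhs_right_gt.
rewrite /= [X in X - _]psi0; last by rewrite [_ *: _]mulr1; lra.
by rewrite psi0// subrr scaler0.
Unshelve. all: by end_near. Qed.

Section MassEquation.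
Context {R : realType}.
Local Notation R2 := (R * R)%type.
Local Notation R3 := (R * R * R)%type.
Local Notation mR := (measurableTypeR R).
Local Notation mu1 := (@lebesgue_measure R).
Local Notation mu2 := (@leb2 R).
Local Notation mu3 := (@leb3 R).
Local Notation mu_tx := (@leb_tx R).

Lemma measurable_Omega (l : R) : measurable (Omega l : set (mR * mR * mR)).
Proof.
rewrite (_ : Omega l = setT `*` `]- l, l[%classic).
  exact: measurableX.
by apply/seteqP; split => x; rewrite /Omega /= in_itv /= => -[].
Qed.

Lemma integrable_test_sqr (a : R -> R) : test_fun a ->
  mu1.-integrable setT (EFin \o (fun x => a x ^+ 2)).
Proof.
move=> ta; have [M [L [_ aM _]]] := test_fun_bounded ta.
have ma := smooth1_measurable (proj1 ta).
exact: (integrable_mul_bounded (test_fun_integrable ta) ma aM).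
Qed.

(** Horizontal tests depend neither on time nor on height. On the slab that carries the density they
    may be multiplied by its indicator, which makes them integrable and square integrable on
    space-time. *)
Definition slab_weight (l T1 : R) (a b : R -> R) (z : R * R3) : R :=
  \1_(`[0, T1[%classic) z.1 * (a z.2.1.1 * b z.2.1.2 * \1_(`](- l), l[%classic) z.2.2).

Let integrable_indic_itv (i : interval R) (M : R) : [set` i] `<=` `[- M, M]%classic ->
  mu1.-integrable setT (EFin \o (\1_[set` i] : R -> R)).
Proof.
move=> iM; apply: (@integrable_bounded_supp _ _ _ mu1 _ _ 1 _ _ (lebesgue_itvcc_fin (- M) M)) => //.
- by move=> x; rewrite indicE; case: (_ \in _); rewrite ?normr1// normr0.
- by move=> x xcd; rewrite indicE memNset// => /iM.
Qed.

Lemma slab_weight_sqr l T1 a b : (fun z => slab_weight l T1 a b z ^+ 2) =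
  slab_weight l T1 (fun x => a x ^+ 2) (fun x => b x ^+ 2).
Proof.
apply/funext => z; rewrite /slab_weight !exprMn !indicE.
by case: (_ \in _); case: (_ \in _); rewrite ?expr1n ?expr0n.
Qed.

Lemma integrable_slab_weight l T1 a b :
  mu1.-integrable setT (EFin \o a) -> mu1.-integrable setT (EFin \o b) ->
  mu_tx.-integrable setT (EFin \o slab_weight l T1 a b).
Proof.
move=> ia ib.
have i0 : mu1.-integrable setT (EFin \o (\1_(`[0, T1[%classic) : R -> R)).
  apply: (@integrable_indic_itv _ `|T1|) => t /=; rewrite !in_itv /= => /andP[t0 t1].
  by have := ler_norm T1; have := normr_ge0 T1; lra.
have i1 := integrable_tens leb3E (integrable_tens leb2E ia ib) (integrable_itv (- l) l).
exact: (integrable_tens leb_txE i0 i1).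
Qed.

Lemma integrable_slab_weight_sqr l T1 a b : test_fun a -> test_fun b ->
  mu_tx.-integrable setT (EFin \o (fun z => slab_weight l T1 a b z ^+ 2)).
Proof.
move=> ta tb.
by rewrite slab_weight_sqr; apply: integrable_slab_weight; exact: integrable_test_sqr.
Qed.

Variables (eps l alpha : R) (rhoin : R3 -> R) (momin : R3 -> 'rV[R]_3)
    (rho : R * R3 -> R) (u : R * R3 -> 'rV[R]_3)
    (Du : R * R3 -> 'M[R]_3) (gam : bool -> R * R2 -> 'rV[R]_3).
Hypothesis W : weak_solution_with eps l alpha rhoin momin rho u Du gam.
Hypotheses (l0 : 0 < l).
Variables (T1 : R).
Hypothesis T0 : 0 < T1.
Hypothesis rhoin_oo : LpOn mu3 (Omega l) +oo%E rhoin.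
Variable beta : R -> R.
Hypothesis hbeta : C1b beta \/ beta = id.

Let D : set (R * R3) := `[0, T1[ `*` Omega l.
Let Up i := (fun z => u z 0 i) \_ D.

(** Extension by zero beyond the slab, where nothing is known of [rho], allows Fubini's theorem on
    the whole space-time. *)
Definition bdens := (fun z => beta (rho z)) \_ D.
Definition bdens_in := (fun x => beta (rhoin x)) \_ (Omega l).
Definition bflux (i : 'I_3) (z : R * R3) := bdens z * Up i z.

Let mD : measurable (D : set (mR * (mR * mR * mR))).
Proof. by apply: measurableX => //; exact: measurable_Omega. Qed.

Let mbeta : measurable_fun (setT : set mR) beta.
Proof.
apply: continuous_measurable_fun.
by case: hbeta => [[/Ck_continuous]|->]// x; exact: cvg_id.
Qed.

(** The indicator is there because [beta 0] may differ from 0. *)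
Let patchE (T : Type) (A : set T) (f g : T -> R) :
  (fun z => beta (f z)) \_ A = fun z => beta ((f \_ A) z) * \1_A z.
Proof.
apply/funext => z; rewrite /patch indicE; case: ifPn => _; last by rewrite mulr0.
by rewrite mulr1.
Qed.

Lemma measurable_bdens :
  measurable_fun (setT : set (mR * (mR * mR * mR))) bdens.
Proof.
rewrite /bdens patchE//; apply: measurable_funM; last exact: measurable_indic.
by apply: measurableT_comp; [exact: mbeta|exact: (Lfun_measurable (ws_rho_Linfty W T0))].
Qed.

Lemma measurable_bdens_in :
  measurable_fun (setT : set (mR * mR * mR)) bdens_in.
Proof.
rewrite /bdens_in patchE//; apply: measurable_funM; last first.
  by apply: measurable_indic; exact: measurable_Omega.
by apply: measurableT_comp; [exact: mbeta|exact: (Lfun_measurable rhoin_oo)].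
Qed.

Let bound d (T : measurableType d) (mu : {measure set T -> \bar R}) (A : set T) (f : T -> R) :
  (f \_ A) \in Lfun mu +oo%E ->
  exists2 M, 0 <= M & {ae mu, forall z, `|((fun z => beta (f z)) \_ A) z| <= M}.
Proof.
move=> /Lfun_oo_bound[M M0 fM]; case: hbeta => [[_ [M' bM] _]|be].
  have M'0 : 0 <= M' by exact: le_trans (bM 0).
  exists M' => //; apply: aeW => z; rewrite /patch; case: ifPn => // _.
  by rewrite normr0.
by exists M => //; rewrite be.
Qed.

Lemma bdens_bound : exists2 M, 0 <= M & {ae mu_tx, forall z, `|bdens z| <= M}.
Proof. exact: bound (ws_rho_Linfty W T0). Qed.

Lemma bdens_in_bound : exists2 M, 0 <= M & {ae mu3, forall z, `|bdens_in z| <= M}.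
Proof. exact: bound rhoin_oo. Qed.

Let bdensD z : bdens z = bdens z * \1_D z.
Proof.
rewrite /bdens /patch indicE; case: (z \in D); first by rewrite mulr1.
by rewrite mul0r.
Qed.

Let weightD (a b : R -> R) (z : R * R3) :
  \1_D z * slab_weight l T1 a b z = \1_D z * (a z.2.1.1 * b z.2.1.2).
Proof.
rewrite indicE; have [|] := boolP (z \in D); last by rewrite !mul0r.
rewrite inE => -[/= z1 z2]; rewrite /slab_weight !indicE !mem_set ?mul1r ?mulr1//.
Qed.

Lemma integrable_bdens a b : test_fun a -> test_fun b ->
  mu_tx.-integrable setT (EFin \o (fun z : R * R3 => bdens z * (a z.2.1.1 * b z.2.1.2))).
Proof.
move=> ta tb; have [M M0 BM] := bdens_bound.
have iG := integrable_slab_weight l T1 (test_fun_integrable ta) (test_fun_integrable tb).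
have -> : (fun z : R * R3 => bdens z * (a z.2.1.1 * b z.2.1.2)) =
    (fun z => bdens z * slab_weight l T1 a b z).
  by apply/funext => z; rewrite bdensD -!mulrA weightD.
apply: (integrable_ae_dom _ (integrable_scale M (integrable_norm iG))).
  apply: measurable_funM; first exact: measurable_bdens.
  exact: integrable_EFin_measurable iG.
by move: BM; apply: ae_imp => z h; rewrite normrM; exact: ler_wpM2r.
Qed.

Lemma integrable_bflux i a b : test_fun a -> test_fun b ->
  mu_tx.-integrable setT (EFin \o (fun z : R * R3 => bflux i z * (a z.2.1.1 * b z.2.1.2))).
Proof.
move=> ta tb; have [M M0 BM] := bdens_bound.
have iG := integrable_slab_weight_sqr l T1 ta tb.
have mG := integrable_EFin_measurable (integrable_slab_weight l T1 (test_fun_integrable ta) (test_fun_integrable tb)).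
have mU := Lfun_measurable (ws_u_L2 W T0 i).
have iU := Lfun2_integrable_sqr (ws_u_L2 W T0 i).
have iUG := integrable_mul_sqr mU mG iU iG.
have -> : (fun z : R * R3 => bflux i z * (a z.2.1.1 * b z.2.1.2)) =
    (fun z => bdens z * (Up i z * slab_weight l T1 a b z)).
  apply/funext => z; rewrite /bflux bdensD.
  transitivity (bdens z * Up i z * (\1_D z * (a z.2.1.1 * b z.2.1.2))); first by ring.
  by rewrite -weightD; ring.
apply: (integrable_ae_dom _ (integrable_scale M (integrable_norm iUG))).
  apply: measurable_funM; first exact: measurable_bdens.
  exact: integrable_EFin_measurable iUG.
by move: BM; apply: ae_imp => z h; rewrite normrM; exact: ler_wpM2r.
Qed.

Lemma integrable_bdens_in a b : test_fun a -> test_fun b ->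
  mu3.-integrable setT (EFin \o (fun x : R3 => bdens_in x * (a x.1.1 * b x.1.2))).
Proof.
move=> ta tb; have [M M0 BM] := bdens_in_bound.
have iG := integrable_tens leb3E (integrable_tens leb2E (test_fun_integrable ta)
   (test_fun_integrable tb)) (integrable_itv (- l) l).
have -> : (fun x : R3 => bdens_in x * (a x.1.1 * b x.1.2)) =
    (fun x => bdens_in x * (a x.1.1 * b x.1.2 * \1_(`](- l), l[%classic) x.2)).
  apply/funext => x; rewrite /bdens_in /patch; case: ifPn => [|_]; last by rewrite !mul0r.
  by rewrite inE => Ox; rewrite indicE mem_set ?mulr1//= in_itv.
apply: (integrable_ae_dom _ (integrable_scale M (integrable_norm iG))).
  apply: measurable_funM; first exact: measurable_bdens_in.
  exact: integrable_EFin_measurable iG.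
by move: BM; apply: ae_imp => z h; rewrite normrM; exact: ler_wpM2r.
Qed.

Definition mass_flux (a b : R -> R) (t : R) : R :=
  \int[mu3]_x (bflux 0 (t, x) * ('D_1 a x.1.1 * b x.1.2)
              + bflux 1 (t, x) * (a x.1.1 * 'D_1 b x.1.2)).

Let integrable_flux a b : test_fun a -> test_fun b ->
  mu_tx.-integrable setT (EFin \o (fun z : R * R3 =>
    bflux 0 z * ('D_1 a z.2.1.1 * b z.2.1.2)
    + bflux 1 z * (a z.2.1.1 * 'D_1 b z.2.1.2))).
Proof.
move=> ta tb; apply: integrable_add.
  exact: (integrable_bflux 0 (test_fun_derive ta) tb).
exact: (integrable_bflux 1 ta (test_fun_derive tb)).
Qed.

Lemma integrable_mass_flux a b : test_fun a -> test_fun b ->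
  mu1.-integrable setT (EFin \o mass_flux a b).
Proof. by move=> ta tb; exact: (integrable_fubini1 leb_txE (integrable_flux ta tb)). Qed.

(** The factor [cut l] provides compact support in the vertical direction; on the strip it equals 1
    and its derivative vanishes, so it leaves no trace in the equation. *)
Let phi_dt (psi a b : R -> R) (z : R * R3) : test_fun psi -> test_fun a -> test_fun b ->
  - l < z.2.2 < l ->
  dt (tens psi (tens (tens a b) (cut l))) z = 'D_1 psi z.1 * (a z.2.1.1 * b z.2.1.2).
Proof.
move=> [sp _] [sa _] [sb _] zl; rewrite /dt.
have sab := smooth_tens sa sb; have sc := smooth_tens sab (smooth_cut l).
rewrite (derive_tens _ z sp sc) /=.
rewrite (@derive_along0 R (R * R * R)%type) mulr0 addr0 /tens cut1 ?mulr1//.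
by rewrite ler_norml; lra.
Qed.

Let phi_dx (psi a b : R -> R) (z : R * R3) : test_fun psi -> test_fun a -> test_fun b ->
  - l < z.2.2 < l ->
  [/\ dx 0 (tens psi (tens (tens a b) (cut l))) z = psi z.1 * ('D_1 a z.2.1.1 * b z.2.1.2),
     dx 1 (tens psi (tens (tens a b) (cut l))) z = psi z.1 * (a z.2.1.1 * 'D_1 b z.2.1.2) &
     dx 2%:R (tens psi (tens (tens a b) (cut l))) z = 0].
Proof.
move=> [sp _] [sa _] [sb _] zl; rewrite /dx.
have sab := smooth_tens sa sb; have sc := smooth_tens sab (smooth_cut l).
have e0 : dir3 0 = ((1, 0), 0) :> R * R * R by [].
have e1 : dir3 1 = ((0, 1), 0) :> R * R * R by [].
have e2 : dir3 2%:R = ((0, 0), 1) :> R * R * R by [].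
have zl' : `|z.2.2| < l by rewrite ltr_norml.
have cut1' : cut l z.2.2 = 1 by rewrite cut1// ltW.
have key v : 'D_(0, v) (tens psi (tens (tens a b) (cut l))) z =
    psi z.1 * (('D_(v.1.1) a z.2.1.1 * b z.2.1.2 + a z.2.1.1 * 'D_(v.1.2) b z.2.1.2)
               + (a z.2.1.1 * b z.2.1.2) * 'D_(v.2) (cut l) z.2.2).
  rewrite (derive_tens _ z sp sc) /= derive_along0 mul0r add0r.
  rewrite (derive_tens _ z.2 sab (smooth_cut l)) cut1' mulr1.
  by rewrite (derive_tens _ z.2.1 sa sb).
rewrite !key e0 e1 e2 /= !derive_along0 derive_cut//.
by split; rewrite ?mulr0 ?mul0r ?addr0 ?add0r ?mulr0.
Qed.

(** Tested against [psi] in time and [a], [b] in the horizontal variables, the mass equation says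
    that the moment has weak derivative [mass_flux] and starts from the moment of the initial
    density, so [weak_derivative1] applies. *)
Lemma mass_ae a b : test_fun a -> test_fun b ->
  {ae mu1, forall t, 0 < t < T1 ->
    \int[mu3]_x (bdens (t, x) * (a x.1.1 * b x.1.2)) =
    \int[mu3]_x (bdens_in x * (a x.1.1 * b x.1.2)) + prim (mass_flux a b) t}.
Proof.
move=> ta tb.
have iB := integrable_bdens ta tb; have iJ := integrable_flux ta tb.
have out t x : ~~ (0 <= t < T1) -> (t, x) \notin D.
  by move=> tT; rewrite notin_setE => -[/=]; rewrite in_itv /= (negbTE tT).
apply: weak_derivative1.
- exact: (integrable_fubini1 leb_txE iB).
- exact: integrable_mass_flux.
- move=> t tT; rewrite /Rintegral integral0_eq// => x _.
  by rewrite /bdens /patch (negbTE (out _ _ tT)) mul0r.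
- move=> t tT; rewrite /mass_flux /Rintegral integral0_eq// => x _.
  by rewrite /bflux /bdens /patch (negbTE (out _ _ tT)) !mul0r addr0.
move=> psi tpsi psiT.
have dpsi : forall x, derivable psi x 1.
  by move=> x; apply: smooth_derivable; exact: (proj1 tpsi).
have dpsiT := derive_right0 dpsi psiT.
have [M [L [_ pM _]]] := test_fun_bounded tpsi.
have [M' [L' [_ pM' _]]] := test_fun_bounded (test_fun_derive tpsi).
have mp := smooth1_measurable (proj1 tpsi).
have mp' := smooth1_measurable (proj1 (test_fun_derive tpsi)).
have mfst (f : R -> R) : measurable_fun (setT : set mR) f ->
    measurable_fun (setT : set (mR * (mR * mR * mR))) (fun z : R * R3 => f z.1).
  by move=> mf; exact: measurableT_comp mf measurable_fst.
have iB' := integrable_mul_bounded iB (mfst _ mp') (fun z => pM' z.1).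
have iJ' := integrable_mul_bounded iJ (mfst _ mp) (fun z => pM z.1).
have -> : \int[mu1]_s (\int[mu3]_x (bdens (s, x) * (a x.1.1 * b x.1.2)) * 'D_1 psi s)
  = \int[mu_tx]_z ('D_1 psi z.1 * (bdens z * (a z.2.1.1 * b z.2.1.2))).
  rewrite (Rfubini1 leb_txE iB').
  apply: Rintegral_ae_eq; move: (ae_fubini1 leb_txE iB); apply: ae_imp => s is_.
  by rewrite /= RintegralZl// mulrC.
have -> : \int[mu1]_s (mass_flux a b s * psi s)
  = \int[mu_tx]_z (psi z.1 * (bflux 0 z * ('D_1 a z.2.1.1 * b z.2.1.2)
    + bflux 1 z * (a z.2.1.1 * 'D_1 b z.2.1.2))).
  rewrite (Rfubini1 leb_txE iJ').
  apply: Rintegral_ae_eq; move: (ae_fubini1 leb_txE iJ); apply: ae_imp => s is_.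
  by rewrite /= RintegralZl// mulrC.
rewrite -RintegralD//.
have tphi := test_fun_tens tpsi (test_fun_tens (test_fun_tens ta tb) (@test_fun_cut R l)).
have := ws_mass W hbeta tphi.
rewrite [X in - X = _]Rintegral_mkcond [X in _ = X]Rintegral_mkcond.
have -> : ((fun x => beta (rhoin x) * tens psi (tens (tens a b) (cut l)) (0, x)) \_ (Omega l))
  = (fun x => psi 0 * (bdens_in x * (a x.1.1 * b x.1.2))).
  apply/funext => x; rewrite /bdens_in /patch; case: ifPn => [|_]; last by rewrite mul0r mulr0.
  rewrite inE /Omega /= => xl; rewrite /tens /= cut1; first by ring.
  by rewrite ler_norml; lra.
rewrite RintegralZl//; last exact: integrable_bdens_in.
move=> E; rewrite mulrC -E opprK; congr (Rintegral mu_tx setT _); apply/funext => z.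
rewrite /patch; case: ifPn => [|/negP zD]; last first.
  rewrite /bflux /bdens /patch memNset ?mul0r ?addr0 ?mulr0 ?addr0//.
  by move=> -[/=]; rewrite in_itv /= => /andP[z0 _ Oz]; apply: zD; rewrite inE.
rewrite inE => -[/= z0 zl].
rewrite phi_dt// !big_ord_recl big_ord0.
have -> : lift ord0 (lift ord0 ord0) = 2%:R :> 'I_3 by exact/val_inj.
have -> : lift ord0 ord0 = 1 :> 'I_3 by exact/val_inj.
have -> : ord0 = 0 :> 'I_3 by exact/val_inj.
have [-> -> ->] := phi_dx tpsi ta tb zl.
(* The mass equation involves all times, [bdens] only those before [T1]; from [T1] on both [psi] and
   its derivative vanish. *)
have [zT|Tz] := ltP z.1 T1; last by rewrite dpsiT// psiT//; ring.
have zD : z \in D by rewrite inE; split => //=; rewrite in_itv /= z0 zT.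
by rewrite /bflux /bdens /Up /patch zD; ring.
Qed.

Definition flux_density (a b : R -> R) (z : R * R3) : R :=
  bflux 0 z * ('D_1 a z.2.1.1 * b z.2.1.2) + bflux 1 z * (a z.2.1.1 * 'D_1 b z.2.1.2).

Lemma integrable_flux_density a b : test_fun a -> test_fun b ->
  mu_tx.-integrable setT (EFin \o flux_density a b).
Proof. exact: integrable_flux. Qed.

(** The bound integrates the modulus over all times, hence is the same for every [t]: this is the
    source of uniformity in time. *)
Lemma prim_mass_flux_le a b t : test_fun a -> test_fun b ->
  `|prim (mass_flux a b) t| <= \int[mu_tx]_z `|flux_density a b z|.
Proof.
move=> ta tb; have iJ := integrable_mass_flux ta tb; have iF := integrable_flux_density ta tb.
apply: (@le_trans _ _ (\int[mu1]_s `|mass_flux a b s|)).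
  rewrite prim_indic; apply: le_Rintegral_dom; last 2 first.
  - exact: integrable_norm.
  - by move=> s; rewrite normrM; case: (s <= t); rewrite ?normr1 ?mulr1// normr0 mulr0.
  apply: (integrable_dom _ (integrable_norm iJ)).
    by apply: measurable_funM; [exact: integrable_EFin_measurable iJ|exact: measurable_le_ind].
  by move=> s; rewrite normrM; case: (s <= t); rewrite ?normr1 ?mulr1// normr0 mulr0.
rewrite (Rfubini1 leb_txE (integrable_norm iF)).
apply: le_Rintegral_ae; first exact: integrable_norm.
  exact: (integrable_fubini1 leb_txE (integrable_norm iF)).
move: (ae_fubini1 leb_txE iF); apply: ae_imp => s is_.
exact: le_normr_Rintegral.
Qed.

(** Young's inequality, from the square of [lam] times one factor minus the other. A large [lam]
    makes the contribution of the test small, and the small velocity pays for it. *)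
Lemma flux_density_le (M lam : R) a b z : `|bdens z| <= M -> 0 < lam ->
  `|flux_density a b z| <= M * (lam * (Up 0 z ^+ 2 + Up 1 z ^+ 2)
     + lam^-1 * (slab_weight l T1 (fun x => 'D_1 a x) b z ^+ 2
                 + slab_weight l T1 a (fun x => 'D_1 b x) z ^+ 2)).
Proof.
move=> bM lam0; have il0 : 0 < lam^-1 by rewrite invr_gt0.
have young (p q : R) : `|p * q| <= lam * p ^+ 2 + lam^-1 * q ^+ 2.
  have H : 0 <= lam^-1 * (lam * `|p| - `|q|) ^+ 2 by rewrite mulr_ge0 ?sqr_ge0// ltW.
  have E : lam^-1 * (lam * `|p| - `|q|) ^+ 2 =
      lam * `|p| ^+ 2 - 2 * (`|p| * `|q|) + lam^-1 * `|q| ^+ 2.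
    by field; rewrite gt_eqF.
  have := mulr_ge0 (normr_ge0 p) (normr_ge0 q).
  by rewrite E !real_normK ?num_real// in H; rewrite normrM; lra.
have UD i f g : bflux i z * (f z.2.1.1 * g z.2.1.2) =
    bdens z * (Up i z * slab_weight l T1 f g z).
  rewrite /bflux -mulrA; congr (_ * _).
  rewrite /Up /patch; case: ifPn => [|_]; last by rewrite !mul0r.
  by rewrite inE => -[/= z1 z2]; rewrite /slab_weight !indicE !mem_set ?mul1r ?mulr1.
rewrite /flux_density (UD 0 (fun x => 'D_1 a x) b) (UD 1 a (fun x => 'D_1 b x)).
rewrite -mulrDr normrM; apply: ler_pM => //.
apply: le_trans (ler_normD _ _) _.
have := young (Up 0 z) (slab_weight l T1 (fun x => 'D_1 a x) b z).
by have := young (Up 1 z) (slab_weight l T1 a (fun x => 'D_1 b x) z); lra.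
Qed.

End MassEquation.

Lemma derive_affine {R : realType} (f : R -> R) (a b x : R) : smooth f ->
  'D_1 (fun y => f (a * y + b)) x = a * 'D_1 f (a * x + b).
Proof.
move=> sf.
have E : (fun h : R => h^-1 *: (((fun x => f (a * x + b)) \o shift x) (h *: 1)
      - f (a * x + b))) =
    (fun h : R => h^-1 *: ((f \o shift (a * x + b)) (h *: a) - f (a * x + b))).
  apply/funext => h /=; congr (_ *: (f _ - _)).
  by rewrite /GRing.scale /=; ring.
have -> : 'D_1 (fun y => f (a * y + b)) x = 'D_a f (a * x + b).
  by rewrite /derive E.
by have [_ ->] := @derive_dir1 R f a (a * x + b) (@smooth_derivable R R f 1 _ sf).
Qed.

Lemma Rintegral_indic_itvoo {R : realType} (a b : R) : a <= b ->
  \int[lebesgue_measure]_s (\1_(`]a, b[%classic) s : R) = b - a.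
Proof.
move=> ab; rewrite /Rintegral integral_indic// setIT.
by have /(congr1 fine) := lebesgue_itvoo ab.
Qed.

(** * The upper bound of the density, by renormalisation *)

Section Truncation.
Context {R : realType}.

(** A positive part made admissible for renormalisation: bounded with bounded derivative, and zero
    exactly when [s <= c]. *)
Definition above (c s : R) : R := flat 0 (s - c).

Lemma above_C1b c : C1b (above c).
Proof.
have E : above c = fun s => flat 0 (1 * s + (- c)).
  by apply/funext => s; rewrite /above mul1r.
have sE : smooth (above c) by rewrite E; apply: smooth_affine; exact: smooth_flat.
split; first exact: sE.
  by exists 0`!%:R => s; rewrite ger0_norm ?flat_ge0// flat_bounded.
exists 2`!%:R => s; rewrite derive1E E derive_affine; last exact: smooth_flat.
by rewrite mul1r derive_flat mul0r subr0 ger0_norm ?flat_ge0// flat_bounded.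
Qed.

Lemma above_eq0 c s : above c s = 0 -> s <= c.
Proof.
move=> h; rewrite leNgt; apply/negP => cs.
have sc : 0 < s - c by lra.
by have := flat0_gt0 0 sc; rewrite -/(above c s) h ltxx.
Qed.

(** The summand 0 gives the argument the affine form of [smooth_affine] and [derive_affine]. The
    transition from 1 to 0 lies between [n.+1] and its double. *)
Definition wide (n : nat) (x : R) : R := cut 1 (n.+1%:R^-1 * x + 0).

Lemma test_fun_wide n : test_fun (wide n).
Proof.
apply: (@test_fun1 _ _ (- (n.+1%:R * 2)) (n.+1%:R * 2)).
  by apply: smooth_affine; exact: smooth_cut.
move=> x; rewrite -ler_norml => xn; apply: cut0; rewrite addr0 normrM ger0_norm ?invr_ge0//.
rewrite mulrC ler_pdivlMr ?ltr0n//; move/negP : xn; rewrite -ltNge => /ltW; lra.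
Qed.

Lemma wide_ge0 n x : 0 <= wide n x. Proof. exact: cut_ge0. Qed.

Lemma wide_eq1 n x : `|x| <= n.+1%:R -> wide n x = 1.
Proof.
move=> xn; apply: cut1; rewrite addr0 normrM ger0_norm ?invr_ge0// mulrC.
by rewrite ler_pdivrMr ?ltr0n// mul1r.
Qed.

Lemma wide_eq0 n x : n.+1%:R * 2 <= `|x| -> wide n x = 0.
Proof.
move=> xn; apply: cut0; rewrite addr0 normrM ger0_norm ?invr_ge0//.
by rewrite mulrC ler_pdivlMr ?ltr0n//; lra.
Qed.

Lemma derive_wide n x : 'D_1 (wide n) x = n.+1%:R^-1 * 'D_1 (cut 1) (n.+1%:R^-1 * x + 0).
Proof. by apply: derive_affine; exact: smooth_cut. Qed.

Lemma derive_wide0 n x : `|x| < n.+1%:R -> 'D_1 (wide n) x = 0.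
Proof.
move=> xn; rewrite derive_wide derive_cut ?mulr0// addr0 normrM ger0_norm ?invr_ge0//.
by rewrite mulrC ltr_pdivrMr ?ltr0n// mul1r.
Qed.

(* The gradient of the cutoff at scale n is of size 1/n on a region of area
   n^2, hence bounded in L^2 of the plane, uniformly in n. *)
Lemma wide_sqr : exists2 M : R, 0 < M &
  [/\ forall n x, `|wide n x| <= M,
      forall n, \int[lebesgue_measure]_x (wide n x ^+ 2) <= M * n.+1%:R &
      forall n, \int[lebesgue_measure]_x ('D_1 (wide n) x ^+ 2) <= M / n.+1%:R].
Proof.
have [M1 [_ [_ b1 _]]] := test_fun_bounded (@test_fun_cut R 1).
have [M2 [_ [_ b2 _]]] := test_fun_bounded (test_fun_derive (@test_fun_cut R 1)).
have M10 : 0 <= M1 := le_trans (normr_ge0 _) (b1 0).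
have M20 : 0 <= M2 := le_trans (normr_ge0 _) (b2 0).
pose M := 6 * (M1 ^+ 2 + M2 ^+ 2) + M1 + 1.
have n1 n : 0 < n.+1%:R :> R by rewrite ltr0n.
(* The interval of half-length [3 * n.+1] leaves a margin around the support of [wide n], so that
   the derivative vanishes outside it too; its length gives the 6 in [M]. *)
have L (n : nat) (f : R -> R) K : test_fun f -> (forall x, `|f x| <= K) ->
    (forall x, n.+1%:R * 3 <= `|x| -> f x = 0) ->
    \int[lebesgue_measure]_x (f x ^+ 2) <= K ^+ 2 * (6 * n.+1%:R).
  move=> tf fK f0.
  have K0 : 0 <= K := le_trans (normr_ge0 _) (fK 0).
  pose A := `](- (n.+1%:R * 3)), (n.+1%:R * 3 : R)[%classic.
  have iA : (@lebesgue_measure R).-integrable setT (EFin \o (\1_A : R -> R)) by exact: integrable_itv.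
  have <- : \int[lebesgue_measure]_x (K ^+ 2 * \1_A x) = K ^+ 2 * (6 * n.+1%:R).
    rewrite RintegralZl//; congr (_ * _).
    by rewrite Rintegral_indic_itvoo; [ring|have := n1 n; lra].
  apply: le_Rintegral => //; [exact: integrable_test_sqr|exact: integrable_scale|].
  move=> x _; have [xn|xn] := leP (n.+1%:R * 3) `|x|.
    by rewrite f0// expr0n /= mulr_ge0 ?sqr_ge0.
  rewrite indicE mem_set ?mulr1; last by rewrite /A /= in_itv /= -ltr_norml.
  by rewrite -[leLHS]real_normK ?num_real// lerXn2r ?nnegrE.
exists M; first by rewrite /M; nra.
split => [n x|n|n].
- by apply: (le_trans (b1 _)); rewrite /M; nra.
- apply: le_trans (L n _ M1 (test_fun_wide n) (fun x => b1 _) _) _.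
    by move=> x xn; apply: wide_eq0; have := n1 n; lra.
  by have := n1 n; rewrite /M; nra.
- have bd x : `|'D_1 (wide n) x| <= M2 / n.+1%:R.
    rewrite derive_wide normrM ger0_norm ?invr_ge0// mulrC.
    by apply: ler_wpM2r => //; rewrite invr_ge0.
  have d0 (x : R) : n.+1%:R * 3 <= `|x| -> 'D_1 (wide n) x = 0.
    move=> xn; rewrite (@near_eq_derive _ _ _ _ (cst (0 : R))); first exact: derive_cst.
    have x2 : n.+1%:R * 2 < `|x| by have := n1 n; lra.
    have : \forall y \near x, n.+1%:R * 2 < `|y| by exact: (cvgr_gt _ (@norm_continuous _ _ x) _ x2).
    by apply: filterS => y /ltW/wide_eq0.
  apply: le_trans (L n _ _ (test_fun_derive (test_fun_wide n)) bd d0) _.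
  have -> : (M2 / n.+1%:R) ^+ 2 * (6 * n.+1%:R) = 6 * M2 ^+ 2 / n.+1%:R.
    by field; rewrite gt_eqF.
  by apply: ler_wpM2r; [rewrite invr_ge0 ltW|rewrite /M; nra].
Qed.

End Truncation.

Lemma Rintegral_tens d1 d2 {T1 : measurableType d1} {T2 : measurableType d2}
    {R : realType} (m1 : {sigma_finite_measure set T1 -> \bar R})
    (m2 : {sigma_finite_measure set T2 -> \bar R})
    (m : {measure set (T1 * T2) -> \bar R}) (f : T1 -> R) (g : T2 -> R) :
  (m : set _ -> _) = (m1 \x m2)%E ->
  m1.-integrable setT (EFin \o f) -> m2.-integrable setT (EFin \o g) ->
  \int[m]_z (f z.1 * g z.2) = (\int[m1]_x f x) * (\int[m2]_y g y).
Proof.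
move=> mE i_f ig; rewrite (Rfubini1 mE (integrable_tens mE i_f ig)) /=.
rewrite -RintegralZr//; congr (Rintegral m1 setT _); apply/funext => x.
by rewrite RintegralZl.
Qed.

Section DensityBound.
Context {R : realType}.
Local Notation R2 := (R * R)%type.
Local Notation R3 := (R * R * R)%type.
Local Notation mR := (measurableTypeR R).
Local Notation mu1 := (@lebesgue_measure R).
Local Notation mu2 := (@leb2 R).
Local Notation mu3 := (@leb3 R).
Local Notation mu_tx := (@leb_tx R).

Lemma Rintegral_slab_weight_sqr (l T1 : R) (a b : R -> R) : 0 < l -> 0 < T1 ->
  test_fun a -> test_fun b ->
  \int[mu_tx]_z (slab_weight l T1 a b z ^+ 2) =
  T1 * ((\int[mu1]_x (a x ^+ 2)) * (\int[mu1]_x (b x ^+ 2)) * (2 * l)).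
Proof.
move=> l0 T0 ta tb; rewrite slab_weight_sqr.
have i1 := integrable_itv (- l) l.
have ia := integrable_test_sqr ta; have ib := integrable_test_sqr tb.
have iab := integrable_tens leb2E ia ib; have ix := integrable_tens leb3E iab i1.
have it : mu1.-integrable setT (EFin \o (\1_(`[0, T1[%classic) : R -> R)).
  apply: (@integrable_bounded_supp _ _ _ mu1 _ _ 1 _ _ (lebesgue_itvcc_fin 0 T1)) => //.
  - by move=> x; rewrite indicE; case: (_ \in _); rewrite ?normr1// normr0.
  - move=> x /= xcd; rewrite indicE memNset//= in_itv /= => /andP[x0 /ltW xT].
    by apply: xcd; rewrite in_itv /= x0.
rewrite [LHS](Rintegral_tens leb_txE it ix) (Rintegral_tens leb3E iab i1).
rewrite (Rintegral_tens leb2E ia ib) Rintegral_indic_itvoo; last lra.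
congr (_ * _); last by congr (_ * _); ring.
rewrite /Rintegral integral_indic// setIT.
by have /(congr1 fine) := lebesgue_measure_itv `[0, T1[; rewrite /= lte_fin T0 /= subr0.
Qed.

Variables (eps l alpha : R) (rhoin : R3 -> R) (momin : R3 -> 'rV[R]_3)
    (rho : R * R3 -> R) (u : R * R3 -> 'rV[R]_3)
    (Du : R * R3 -> 'M[R]_3) (gam : bool -> R * R2 -> 'rV[R]_3).
Hypothesis W : weak_solution_with eps l alpha rhoin momin rho u Du gam.
Hypotheses (l0 : 0 < l).
Variables (T1 : R).
Hypothesis T0 : 0 < T1.
Hypothesis rhoin_oo : LpOn mu3 (Omega l) +oo%E rhoin.
Variable c : R.
Hypothesis rhoin_c : {ae mu3, forall x, Omega l x -> rhoin x <= c}.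

Let D : set (R * R3) := `[0, T1[ `*` Omega l.
Let Up i := (fun z => u z 0 i) \_ D.
Let B := bdens l rho T1 (above c).
Let hb : C1b (above c) \/ above c = id := or_introl (above_C1b c).

(** The indicator of the complement of a square on which the cutoff at scale [n] is constant.
    Consequently [e n] is the tail at infinity of a convergent integral. *)
Let h (n : nat) (z : R * R3) : R :=
  1 - \1_(`](- n%:R), n%:R[%classic) z.2.1.1 * \1_(`](- n%:R), n%:R[%classic) z.2.1.2.

Let e (n : nat) : R := \int[mu_tx]_z ((Up 0 z ^+ 2 + Up 1 z ^+ 2) * h n z).

Let h01 n z : 0 <= h n z <= 1.
Proof.
rewrite /h !indicE; case: (_ \in _); case: (_ \in _);
  by rewrite ?mulr1 ?mulr0 ?subr0 ?subrr ?lexx ?ler01.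
Qed.

Let U2 : mu_tx.-integrable setT (EFin \o (fun z => Up 0 z ^+ 2 + Up 1 z ^+ 2)).
Proof. by apply: integrable_add; exact: Lfun2_integrable_sqr (ws_u_L2 W T0 _). Qed.

Let mh n : measurable_fun (setT : set (mR * (mR * mR * mR))) (h n).
Proof.
apply: measurable_funB => //; apply: measurable_funM.
  apply: (measurableT_comp (f := \1_(`](- n%:R), n%:R[%classic) : R -> R)) => //.
  apply: (measurableT_comp measurable_fst); apply: (measurableT_comp measurable_fst).
  exact: measurable_snd.
apply: (measurableT_comp (f := \1_(`](- n%:R), n%:R[%classic) : R -> R)) => //.
apply: (measurableT_comp measurable_snd); apply: (measurableT_comp measurable_fst).
exact: measurable_snd.
Qed.

Let h_cvg z : h n z @[n --> \oo] --> (0 : R).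
Proof.
apply: cvg_near_cst; near=> n; rewrite /h !indicE !mem_set ?mulr1 ?subrr//.
  rewrite /= in_itv /= -ltr_norml; near: n; exact: nbhs_infty_gtr.
rewrite /= in_itv /= -ltr_norml; near: n; exact: nbhs_infty_gtr.
Unshelve. all: by end_near. Qed.

Let Uh n z : `|(Up 0 z ^+ 2 + Up 1 z ^+ 2) * h n z| <= Up 0 z ^+ 2 + Up 1 z ^+ 2.
Proof.
have /andP[h0 h1] := h01 n z; have U0 : 0 <= Up 0 z ^+ 2 + Up 1 z ^+ 2.
  by rewrite addr_ge0 ?sqr_ge0.
by rewrite ger0_norm ?mulr_ge0// ler_piMr.
Qed.

Let e_cvg : e n @[n --> \oo] --> (0 : R).
Proof.
have mU n : measurable_fun (setT : set (mR * (mR * mR * mR)))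
    (fun z => (Up 0 z ^+ 2 + Up 1 z ^+ 2) * h n z).
  by apply: measurable_funM => //; exact: integrable_EFin_measurable U2.
have Uc z : (Up 0 z ^+ 2 + Up 1 z ^+ 2) * h n z @[n --> \oo] --> (0 : R).
  by rewrite -[X in _ --> X](mulr0 (Up 0 z ^+ 2 + Up 1 z ^+ 2)); apply: cvgMr; exact: h_cvg.
have [_ _] := @Rintegral_dct _ _ _ mu_tx _ (fun=> 0) _ mU (measurable_cst _) Uc U2 Uh.
by rewrite /Rintegral integral0.
Qed.

Let B01 z : 0 <= B z <= 1.
Proof.
rewrite /B /bdens /patch; case: ifPn => _; last by rewrite lexx ler01.
by rewrite /above flat_ge0 flat_bounded.
Qed.

Let flux_int n := flux_density l rho u T1 (above c) (wide n) (wide n).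

Let g0 n := slab_weight l T1 (fun x => 'D_1 (wide n) x) (wide n).
Let g1 n := slab_weight l T1 (wide n) (fun x => 'D_1 (wide n) x).

(** Inside the square the gradient of the cutoff vanishes, and so does the flux; outside it
    [h n z = 1], and [flux_density_le] applies with [M = 1]. *)
Let flux_bound n (lam : R) z : 0 < lam -> `|flux_int n z| <=
  lam * ((Up 0 z ^+ 2 + Up 1 z ^+ 2) * h n z) + lam^-1 * (g0 n z ^+ 2 + g1 n z ^+ 2).
Proof.
move=> lam0; have il0 : 0 < lam^-1 by rewrite invr_gt0.
have /andP[b0 b1] := B01 z.
have [/andP[/= h1 h2]|hn] := boolP ((`|z.2.1.1| < n%:R) && (`|z.2.1.2| < n%:R)).
  have nn : n%:R < n.+1%:R :> R by rewrite ltr_nat.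
  have /andP[hz _] := h01 n z.
  rewrite /flux_int /flux_density !derive_wide0; [|exact: lt_trans nn..].
  rewrite !(mul0r, mulr0, addr0) normr0 addr_ge0//; (apply: mulr_ge0; first exact: ltW).
    by rewrite mulr_ge0// addr_ge0 ?sqr_ge0.
  by rewrite addr_ge0 ?sqr_ge0.
have -> : h n z = 1.
  rewrite /h !indicE !mem_setE /= !in_itv /= -!ltr_norml.
  by move: hn; case: (_ < _) => //=; [move=> /negbTE -> |]; rewrite ?mulr0 ?mul0r subr0.
rewrite mulr1 -[leRHS]mul1r; apply: flux_density_le => //.
by rewrite ger0_norm.
Qed.

(** As [above c] vanishes on the initial density, its moment at scale [n] is made of flux alone. The
    flux tends to 0: the velocity contributes only its tail [e n], and the gradients of the cutoffs
    are bounded in L^2. *)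
Lemma density_bound : {ae mu_tx, forall z, D z -> rho z <= c}.
Proof.
have [M M0 [M1 M2 M3]] := @wide_sqr R.
have tw := @test_fun_wide R; have tdw n := test_fun_derive (tw n).
have key (m : nat) : \int[mu_tx]_z (B z * (wide m z.2.1.1 * wide m z.2.1.2)) = 0.
  have iB n := integrable_bdens W T0 hb (tw n) (tw n).
  set X := Rintegral _ _ _.
  have X0 : 0 <= X.
    apply: Rintegral_ge0 => z _; have /andP[b0 _] := B01 z.
    by apply: mulr_ge0 => //; apply: mulr_ge0; exact: wide_ge0.
  (* In each product of the two bounds of [wide_sqr] the factor [n.+1] cancels, so [K] does not
     depend on [n]. *)
  pose K : R := T1 * (M * M * (2 * l)) + T1 * (M * M * (2 * l)).
  have K0 : 0 <= K by rewrite /K -mulr2n mulrn_wge0// !mulr_ge0// ltW.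
  have iflux n : mu_tx.-integrable setT (EFin \o flux_int n).
    exact: (integrable_flux_density W T0 hb (tw n) (tw n)).
  pose N n := \int[mu_tx]_z `|flux_int n z|.
  have N0 n : 0 <= N n by apply: Rintegral_ge0.
  have Nle n lam : 0 < lam -> N n <= lam * e n + lam^-1 * K.
    move=> lam0.
    have ig0 := integrable_slab_weight_sqr l T1 (tdw n) (tw n).
    have ig1 := integrable_slab_weight_sqr l T1 (tw n) (tdw n).
    have n1 : 0 < n.+1%:R :> R by rewrite ltr0n.
    have MM : M * n.+1%:R * (M / n.+1%:R) = M * M by field; rewrite gt_eqF.
    have A0 : 0 <= \int[mu1]_x (wide n x ^+ 2) by apply: Rintegral_ge0 => x _; exact: sqr_ge0.
    have A1 : 0 <= \int[mu1]_x ('D_1 (wide n) x ^+ 2) by apply: Rintegral_ge0 => x _; exact: sqr_ge0.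
    have AM := ler_pM A0 A1 (M2 n) (M3 n); rewrite MM in AM.
    have l2 : 0 <= 2 * l by rewrite mulr_ge0// ltW.
    have G : \int[mu_tx]_z (g0 n z ^+ 2 + g1 n z ^+ 2) <= K.
      rewrite RintegralD// !Rintegral_slab_weight_sqr// /K.
      have LE := ler_wpM2l (ltW T0) (ler_wpM2r l2 AM).
      move: LE; move: (\int[mu1]_x (wide n x ^+ 2)) (\int[mu1]_x ('D_1 (wide n) x ^+ 2)) => P Q; lra.
    have ie : mu_tx.-integrable setT (EFin \o (fun z => (Up 0 z ^+ 2 + Up 1 z ^+ 2) * h n z)).
      apply: (integrable_dom _ U2); last exact: Uh.
      by apply: measurable_funM => //; exact: integrable_EFin_measurable U2.
    apply: (@le_trans _ _ (lam * e n + lam^-1 * \int[mu_tx]_z (g0 n z ^+ 2 + g1 n z ^+ 2))); last first.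
      by rewrite lerD2l; apply: ler_wpM2l => //; rewrite invr_ge0 ltW.
    rewrite -RintegralZl// -RintegralZl//; last exact: integrable_add.
    rewrite -RintegralD//; [|exact: integrable_scale|by apply: integrable_scale; exact: integrable_add].
    apply: le_Rintegral => //; first exact: integrable_norm.
      by apply: integrable_add; apply: integrable_scale => //; exact: integrable_add.
    by move=> z _; exact: flux_bound.
  (* At such a scale [wide n] equals 1 on the support of [wide m], so the moment at scale [m] is at
     most [M ^+ 2] times that at scale [n]. The factor [T1 + 1] is the length of []-1, T1[], an open
     interval containing the times of the slab. *)
  have Xle n : (2 * m.+1 <= n.+1)%N -> X <= M ^+ 2 * N n * (T1 + 1).
    move=> mn; rewrite /X (Rfubini1 leb_txE (iB m)) /=.
    have -> : M ^+ 2 * N n * (T1 + 1) = \int[mu1]_t (M ^+ 2 * N n * \1_(`](-1), T1[%classic) t).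
      by rewrite RintegralZl ?Rintegral_indic_itvoo ?opprK//; [move: T0; lra|exact: integrable_itv].
    apply: le_Rintegral_ae; first exact: (integrable_fubini1 leb_txE (iB m)).
      by apply: integrable_scale; exact: integrable_itv.
    have t0 : {ae mu1, forall t : R, t != 0}.
      exists [set 0]; split => //; first exact: lebesgue_measure_set1.
      by move=> t /= /negP; rewrite negbK => /eqP.
    have := @ae_imp2 _ _ _ mu1 _ _ _ (fun t a b => conj a b) (ae_fubini1 leb_txE (iB m)) (ae_fubini1 leb_txE (iB n)).
    move: t0 (mass_ae W T0 rhoin_oo hb (tw n) (tw n)); apply: ae_imp3 => t t0 mt [im inn].
    have MN : 0 <= M ^+ 2 * N n by rewrite mulr_ge0 ?sqr_ge0.
    have [tT|tT] := boolP (0 < t < T1); last first.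
      rewrite [leLHS](_ : _ = 0); first by rewrite mulr_ge0.
      rewrite /Rintegral integral0_eq// => x _; rewrite /B /bdens /patch memNset ?mul0r//.
      move=> -[/=]; rewrite in_itv /= le_eqVlt eq_sym (negbTE t0) /= => tT'.
      by rewrite tT' in tT.
    rewrite indicE mem_set ?mulr1; last by rewrite /= in_itv /=; move: tT; lra.
    apply: (@le_trans _ _ (M ^+ 2 * \int[mu3]_x (B (t, x) * (wide n x.1.1 * wide n x.1.2)))).
      rewrite -RintegralZl//; apply: le_Rintegral => //; first exact: integrable_scale.
      move=> x _; have /andP[b0 _] := B01 (t, x); rewrite [leRHS]mulrCA; apply: ler_wpM2l => //.
      have w1 y : wide m y <= M * wide n y.
        have [ym|ym] := leP (m.+1%:R * 2) `|y|.
          by rewrite wide_eq0// mulr_ge0 ?wide_ge0// ltW.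
        rewrite [X in _ * X]wide_eq1 ?mulr1; first exact: le_trans (ler_norm _) (M1 m y).
        by apply: (le_trans (ltW ym)); rewrite -natrM ler_nat mulnC.
      have w2 (p q p' q' : R) : 0 <= p -> 0 <= q -> p <= M * p' -> q <= M * q' ->
          p * q <= M ^+ 2 * (p' * q').
        by move=> p0 q0 hp hq; rewrite expr2 mulrACA; exact: ler_pM.
      exact: (w2 _ _ _ _ (wide_ge0 m _) (wide_ge0 m _) (w1 _) (w1 _)).
    apply: ler_wpM2l; first exact: sqr_ge0.
    rewrite mt// (_ : \int[mu3]_x (bdens_in l rhoin (above c) x * _) = 0) ?add0r; last first.
      rewrite (@Rintegral_ae_eq _ _ _ mu3 _ (fun=> 0)).
        by rewrite /Rintegral integral0.
      move: rhoin_c; apply: ae_imp => x rx; rewrite /bdens_in /patch; case: ifPn; rewrite ?mul0r//.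
      by rewrite inE => /rx rc; rewrite /above flat_le0 ?mul0r// subr_le0.
    exact: le_trans (ler_norm _) (prim_mass_flux_le W T0 hb t (tw n) (tw n)).
  apply/eqP; rewrite eq_le X0 andbT leNgt; apply/negP => Xpos.
  pose C := M ^+ 2 * (T1 + 1) * (1 + K).
  have TT : 0 <= M ^+ 2 * (T1 + 1) by rewrite mulr_ge0 ?sqr_ge0 ?addr_ge0 ?ltW.
  have C0 : 0 <= C by rewrite /C mulr_ge0// addr_ge0.
  (* With [e n <= lam ^- 2] both terms of the bound on [N n] are of order [lam^-1], and
     [X <= C / lam] becomes [X <= C / (C + 1) * X], which is absurd for [X > 0]. *)
  pose lam := (C + 1) / X.
  have lam0 : 0 < lam by rewrite divr_gt0// ltr_wpDl.
  have [n [mn en]] : exists n, (2 * m.+1 <= n.+1)%N /\ e n <= lam ^- 2.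
    have l2 : 0 < lam ^- 2 by rewrite invr_gt0 exprn_gt0.
    have [n0 _ h0] := cvgr_le _ e_cvg _ l2.
    by exists (maxn n0 (2 * m.+1)); split; [exact: leq_trans (leq_maxr _ _) (leqnSn _)|apply: h0 => /=; exact: leq_maxl].
  have := Xle n mn.
  have Nn : N n <= lam^-1 * (1 + K).
    apply: le_trans (Nle n lam lam0) _.
    rewrite [leRHS]mulrDr mulr1 lerD2r.
    apply: le_trans (ler_wpM2l (ltW lam0) en) _.
    by rewrite expr2 invfM mulrA mulfV ?mul1r// gt_eqF.
  have XC : M ^+ 2 * N n * (T1 + 1) <= C / lam.
    have -> : C / lam = M ^+ 2 * (T1 + 1) * (lam^-1 * (1 + K)) by rewrite /C; ring.
    by rewrite mulrAC; apply: ler_wpM2l.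
  have CX : C / lam = C / (C + 1) * X.
    by rewrite /lam; field; rewrite !gt_eqF// ltr_wpDl.
  have : C / (C + 1) < 1 by rewrite ltr_pdivrMr ?mul1r ?ltrDl// ltr_wpDl.
  by rewrite CX in XC; nra.
have aeB (m : nat) : {ae mu_tx, forall z, B z * (wide m z.2.1.1 * wide m z.2.1.2) = 0}.
  have iB := integrable_bdens W T0 hb (tw m) (tw m).
  apply: ae_eq0_Rintegral => // z; have /andP[b0 _] := B01 z.
  by apply: mulr_ge0 => //; apply: mulr_ge0; exact: wide_ge0.
move: (ae_forall_count aeB); apply: ae_imp => z Bz Dz.
apply: above_eq0; have [m mz] : exists m : nat, Num.max `|z.2.1.1| `|z.2.1.2| <= m.+1%:R.
  exists (Num.truncn (Num.max `|z.2.1.1| `|z.2.1.2|)).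
  by apply: ltW; exact: truncnS_gt.
move: mz; rewrite ge_max => /andP[m1 m2].
by have := Bz m; rewrite !wide_eq1// !mulr1 /B /bdens /patch mem_set.
Qed.

End DensityBound.

(** * Vertical averages *)

Lemma ge0_integrable d {T : measurableType d} {R : realType}
    (mu : {measure set T -> \bar R}) (f : T -> R) :
  measurable_fun setT f -> (forall x, 0 <= f x) ->
  (\int[mu]_x (f x)%:E < +oo)%E -> mu.-integrable setT (EFin \o f).
Proof.
move=> mf f0 fin; apply/integrableP; split; first exact/measurable_EFinP.
apply: le_lt_trans fin; rewrite le_eqVlt; apply/orP; left; apply/eqP.
by apply: eq_integral => x _ /=; rewrite ger0_norm.
Qed.

Section SectionIntegrals.
Context d1 d2 {T1 : measurableType d1} {T2 : measurableType d2} {R : realType}.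
Variables (m1 : {sigma_finite_measure set T1 -> \bar R})
          (m2 : {sigma_finite_measure set T2 -> \bar R}).

(** By definition the inner integral is [fine] of a difference of integrals of nonnegative
    functions, each measurable by Tonelli. *)
Lemma measurable_Rintegral2 (F : T1 * T2 -> R) : measurable_fun setT F ->
  measurable_fun setT (fun x => \int[m2]_y F (x, y)).
Proof.
move=> mF; apply: (measurableT_comp (f := fine)) => //.
have mE : measurable_fun setT (EFin \o F) by exact/measurable_EFinP.
have -> : (fun x => \int[m2]_y (F (x, y))%:E)%E =
    (fun x => fubini_F m2 ((EFin \o F)^\+)%E x - fubini_F m2 ((EFin \o F)^\-)%E x)%E.
  apply/funext => x; rewrite [LHS]integralE /fubini_F.
  by congr (_ - _)%E; apply: eq_integral => y _; rewrite ?funeposE ?funenegE.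
apply: emeasurable_funB; apply: measurable_fun_fubini_tonelli_F => //.
  exact: measurable_funepos.
exact: measurable_funeneg.
Qed.

(** A converse of [ae_prod1]; measurability of [A] lets Tonelli compute the measure of its
    complement from the sections. *)
Lemma ae_prod2 (m : {measure set (T1 * T2) -> \bar R}) (A : set (T1 * T2)) :
  (m : set _ -> _) = (m1 \x m2)%E -> measurable A ->
  {ae m1, forall x, {ae m2, forall y, A (x, y)}} -> {ae m, forall z, A z}.
Proof.
move=> mE mA aeA; exists (~` A); split; [exact: measurableC| |by []].
have mnA : measurable (~` A) by exact: measurableC.
have -> : m (~` A) = (\int[m]_z (\1_(~` A) z)%:E)%E by rewrite integral_indic// setIT.
rewrite (tonelli1 mE); [|exact/measurable_EFinP/measurable_indic|by []].
rewrite (@integral_ae_nonmeas _ _ _ m1 _ (fun=> 0%E)); first exact: integral0.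
move: aeA; apply: ae_imp => x aex.
rewrite (@integral_ae_nonmeas _ _ _ m2 _ (fun=> 0%E)); first exact: integral0.
by move: aex; apply: ae_imp => y Ay; rewrite indicE memNset// => /(_ Ay).
Qed.

Lemma ae_prod_swap (m : {measure set (T1 * T2) -> \bar R}) (P : T1 * T2 -> Prop) :
  (m : set _ -> _) = (m1 \x m2)%E -> {ae m, forall z, P z} ->
  {ae m2, forall y, {ae m1, forall x, P (x, y)}}.
Proof.
move=> mE [N [mN N0 PN]].
have iN : m.-integrable setT (EFin \o (\1_N : T1 * T2 -> R)).
  by apply: ge0_integrable => //; rewrite integral_indic// setIT N0.
have I0 : \int[m2]_y \int[m1]_x (\1_N (x, y) : R) = 0.
  rewrite -(Rfubini2 mE iN) /Rintegral integral_indic// setIT.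
  by rewrite (N0 : m N = 0%E).
have ge0 y : 0 <= \int[m1]_x (\1_N (x, y) : R) by apply: Rintegral_ge0.
move: (ae_eq0_Rintegral (integrable_fubini2 mE iN) ge0 I0) (ae_fubini2 mE iN).
apply: ae_imp2 => y Iy iy; have := ae_eq0_Rintegral iy (fun x => ler0n _ _) Iy.
apply: ae_imp => x Nx; apply: contrapT => nP; move/eqP: Nx.
by rewrite indicE mem_set ?oner_eq0//; exact: PN.
Qed.

End SectionIntegrals.

Section VerticalAverage.
Context {R : realType}.
Local Notation R2 := (R * R)%type.
Local Notation R3 := (R * R * R)%type.
Local Notation mR := (measurableTypeR R).
Local Notation mu1 := (@lebesgue_measure R).
Local Notation mu2 := (@leb2 R).
Local Notation mu3 := (@leb3 R).
Local Notation mu_tx := (@leb_tx R).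
Local Notation mu_th := (@leb_th R).

Variable l : R.
Hypothesis l0 : 0 < l.

(** Passes from a function known on the strip only to an extension by zero, whose fibres can be
    integrated over the whole line. *)
Lemma vavgE (f g : R3 -> R) (y : R2) : (forall x, ~ Omega l x -> g x = 0) ->
  {ae mu1, forall s, Omega l (y, s) -> f (y, s) = g (y, s)} ->
  vavg l f y = (2 * l)^-1 * \int[mu1]_s g (y, s).
Proof.
move=> g0 fg; rewrite /vavg; congr (_ * _); rewrite Rintegral_mkcond.
apply: Rintegral_ae_eq; move: fg; apply: ae_imp => s h; rewrite /patch.
have Oe : (s \in `](- l), l[%classic) = `[< Omega l (y, s) >].
  by rewrite mem_setE /= in_itv /=; apply/idP/asboolP.
by rewrite Oe; case: asboolP => [/h//|/g0].
Qed.

Lemma measurable_vert (F : R * R3 -> R) :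
  measurable_fun (setT : set (mR * (mR * mR * mR))) F ->
  measurable_fun (setT : set (mR * (mR * mR))) (fun y => \int[mu1]_s F (y.1, (y.2, s))).
Proof.
move=> mF; apply: (@measurable_Rintegral2 _ _ (mR * (mR * mR))%type mR R mu1
  (fun w => F (w.1.1, (w.1.2, w.2)))).
apply: measurableT_comp; first exact: mF.
have m11 : measurable_fun (setT : set (mR * (mR * mR) * mR)) (fun w => w.1.1).
  exact: measurableT_comp (measurable_fst) (measurable_fst).
have m12 : measurable_fun (setT : set (mR * (mR * mR) * mR)) (fun w => w.1.2).
  exact: measurableT_comp (measurable_snd) (measurable_fst).
have m2 : measurable_fun (setT : set (mR * (mR * mR) * mR)) (fun w => w.2).
  exact: measurable_snd.
exact: measurable_fun_pair m11 (measurable_fun_pair m12 m2).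
Qed.

Section Slice.
Variables (r : R3 -> R) (c : R).
Hypotheses (mr : measurable_fun (setT : set (mR * mR * mR)) r)
  (r0c : forall x, 0 <= r x <= c) (rO : forall x, ~ Omega l x -> r x = 0).

Definition slice (y : R2) : R := (2 * l)^-1 * \int[mu1]_s r (y, s).

Lemma measurable_slice : measurable_fun (setT : set (mR * mR)) slice.
Proof. by apply: measurable_funM; [exact: measurable_cst|exact: (measurable_Rintegral2 mu1 mr)]. Qed.

Let r_itv x : r x = r x * \1_(`](- l), l[%classic) x.2.
Proof.
rewrite indicE mem_setE /= in_itv /=; have [h|h] := boolP (- l < x.2 < l); first by rewrite mulr1.
by rewrite mulr0 rO//; exact/negP.
Qed.

Let c0 : 0 <= c. Proof. by have /andP[] := r0c ((0, 0), 0); exact: le_trans. Qed.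

Lemma integrable_slice_tens (th : R2 -> R) : mu2.-integrable setT (EFin \o th) ->
  mu3.-integrable setT (EFin \o (fun x => r x * th x.1)).
Proof.
move=> ith.
have iT := integrable_tens leb3E ith (integrable_itv (- l) l).
have -> : (fun x => r x * th x.1) = (fun x => r x * (th x.1 * \1_(`](- l), l[%classic) x.2)).
  by apply/funext => x; rewrite {1}r_itv; ring.
apply: (integrable_mul_bounded iT mr (M := c)) => x.
by have /andP[h0 h1] := r0c x; rewrite ger0_norm.
Qed.

Lemma integrable_vert y : mu1.-integrable setT (EFin \o (fun s => r (y, s))).
Proof.
apply: (integrable_dom _ (integrable_scale c (integrable_itv (- l) l))).
  by apply: measurableT_comp; [exact: mr|exact: measurable_pair1].
move=> s; have /andP[h0 h1] := r0c (y, s); rewrite ger0_norm// r_itv.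
by apply: ler_wpM2r.
Qed.

Lemma slice_bound y : 0 <= slice y <= c.
Proof.
have iy := integrable_vert y.
have l2 : 0 < 2 * l by rewrite mulr_gt0.
rewrite /slice mulr_ge0/=; last 2 first.
- by rewrite invr_ge0 ltW.
- by apply: Rintegral_ge0 => s _; have /andP[] := r0c (y, s).
rewrite mulrC ler_pdivrMr//.
have -> : c * (2 * l) = \int[mu1]_s (c * \1_(`](- l), l[%classic) s).
  by rewrite RintegralZl ?Rintegral_indic_itvoo//; [ring|lra|exact: integrable_itv].
apply: le_Rintegral => //; first by apply: integrable_scale; exact: integrable_itv.
by move=> s _; rewrite r_itv; apply: ler_wpM2r => //; have /andP[] := r0c (y, s).
Qed.

Lemma Rintegral_slice (th : R2 -> R) : mu2.-integrable setT (EFin \o th) ->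
  \int[mu2]_y (slice y * th y) = (2 * l)^-1 * \int[mu3]_x (r x * th x.1).
Proof.
move=> ith; have iT := integrable_slice_tens ith.
rewrite (Rfubini1 leb3E iT) -RintegralZl//; last exact: (integrable_fubini1 leb3E iT).
congr (Rintegral mu2 setT _); apply/funext => y; rewrite /slice -mulrA; congr (_ * _).
have iy := integrable_vert y.
by rewrite /= RintegralZr.
Qed.

End Slice.

(** Jensen's inequality for vertical means, that is [cauchy_schwarz1] on each fibre, followed by
    Tonelli. *)
Lemma vert_sqr (F : R * R3 -> R) :
  measurable_fun (setT : set (mR * (mR * mR * mR))) F ->
  mu_tx.-integrable setT (EFin \o (fun z => F z ^+ 2)) ->
  (forall z, ~ Omega l z.2 -> F z = 0) ->
  let G y := (2 * l)^-1 * \int[mu1]_s F (y.1, (y.2, s)) in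
  [/\ measurable_fun (setT : set (mR * (mR * mR))) G,
      mu_th.-integrable setT (EFin \o (fun y => G y ^+ 2)) &
      \int[mu_th]_y (G y ^+ 2) <= (2 * l)^-1 * \int[mu_tx]_z (F z ^+ 2)].
Proof.
move=> mF F2 FO G.
have mG : measurable_fun (setT : set (mR * (mR * mR))) G.
  by apply: measurable_funM; [exact: measurable_cst|exact: measurable_vert].
have mG2 : measurable_fun (setT : set (mR * (mR * mR))) (fun y => G y ^+ 2).
  exact: measurable_funX.
have l2 : 0 < 2 * l by rewrite mulr_gt0.
have il2 : 0 <= (2 * l)^-1 by rewrite invr_ge0 ltW.
have iF := integrable_fubini1 leb_txE F2.
have vert t y : mu1.-integrable setT (EFin \o (fun s => F (t, (y, s)) ^+ 2)) ->
    G (t, y) ^+ 2 <= (2 * l)^-1 * \int[mu1]_s (F (t, (y, s)) ^+ 2).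
  move=> iy; have ll : - l <= l by lra.
  have mFy : measurable_fun (setT : set mR) (fun s => F (t, (y, s))).
    exact: (measurable_fun_pair2 y (measurable_fun_pair2 t mF)).
  have fin : (mu1 `](- l)%R, l[%classic < +oo)%E.
    by rewrite (lebesgue_itvoo ll : (mu1 : measure _ _) _ = _) ltry.
  have out s : ~ `](- l)%R, l[%classic s -> F (t, (y, s)) = 0.
    by move=> sl; apply: FO => /= h; apply: sl; rewrite /= in_itv.
  have := cauchy_schwarz1 (mu := mu1) (measurable_itv `](- l), l[) fin mFy out.
  rewrite (lebesgue_itvoo ll : (mu1 : measure _ _) _ = _) /=.
  have -> : (\int[mu1]_s (F (t, (y, s)) ^+ 2)%:E =
    (\int[mu1]_s (F (t, (y, s)) ^+ 2))%:E)%E by rewrite EFin_Rintegral.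
  rewrite -EFinM lee_fin (_ : l - - l = 2 * l); last ring.
  move=> H; rewrite /G /= exprMn exprVn expr2 invfM -mulrA; apply: ler_wpM2l => //.
  by rewrite mulrC ler_pdivrMr// mulrC.
have le : (\int[mu_th]_y (G y ^+ 2)%:E <= ((2 * l)^-1 * \int[mu_tx]_z (F z ^+ 2))%:E)%E.
  rewrite (tonelli1 leb_thE); [|exact/measurable_EFinP|by move=> z; rewrite lee_fin sqr_ge0].
  have isF := integrable_scale (2 * l)^-1 iF.
  have -> : (((2 * l)^-1 * \int[mu_tx]_z (F z ^+ 2))%:E =
      \int[mu1]_t ((2 * l)^-1 * \int[mu3]_x (F (t, x) ^+ 2))%:E)%E.
    by rewrite -(EFin_Rintegral isF) RintegralZl// (Rfubini1 leb_txE F2).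
  apply: le_integral_ae_nonmeas.
  - by move=> t; apply: integral_ge0 => y _; rewrite lee_fin sqr_ge0.
  - move=> t; rewrite lee_fin mulr_ge0//; apply: Rintegral_ge0 => x _; exact: sqr_ge0.
  move: (ae_fubini1 leb_txE F2); apply: ae_imp => t it.
  have it1 := integrable_scale (2 * l)^-1 (integrable_fubini1 leb3E it).
  have -> : (((2 * l)^-1 * \int[mu3]_x (F (t, x) ^+ 2))%:E =
      \int[mu2]_y ((2 * l)^-1 * \int[mu1]_s (F (t, (y, s)) ^+ 2))%:E)%E.
    rewrite -(EFin_Rintegral it1) RintegralZl//; last exact: (integrable_fubini1 leb3E it).
    by rewrite (Rfubini1 leb3E it).
  apply: le_integral_ae_nonmeas.
  - by move=> y; rewrite lee_fin sqr_ge0.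
  - move=> y; rewrite lee_fin mulr_ge0//; apply: Rintegral_ge0 => x _; exact: sqr_ge0.
  by move: (ae_fubini1 leb3E it); apply: ae_imp => y iy; rewrite lee_fin; exact: vert.
have iG : mu_th.-integrable setT (EFin \o (fun y => G y ^+ 2)).
  by apply: ge0_integrable => // [y|]; [exact: sqr_ge0|exact: le_lt_trans le (ltry _)].
by split=> //; rewrite -lee_fin (EFin_Rintegral iG).
Qed.

End VerticalAverage.

(** * Representatives at every time *)

Lemma seq_cvg {R : realType} (f : R -> R) (t : R) :
  (forall tn : nat -> R, tn n @[n --> \oo] --> t -> f (tn n) @[n --> \oo] --> f t) ->
  f x @[x --> t] --> f t.
Proof.
move=> H; apply/cvgrPdist_lt => e e0; apply: contrapT => nH.
have /choice[tn tnP] : forall n : nat, exists x, `|t - x| < n.+1%:R^-1 /\ e <= `|f t - f x|.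
  move=> n; apply: contrapT => nx; apply: nH.
  apply/nbhs_ballP; exists n.+1%:R^-1 => /=; first by rewrite invr_gt0 ltr0n.
  by move=> x /= tx; rewrite ltNge; apply/negP => ex; apply: nx; exists x.
have tnt : tn n @[n --> \oo] --> t.
  apply/cvgrPdist_lt => d d0; near=> n; apply: lt_trans (proj1 (tnP n)) _.
  by near: n; exact: near_infty_natSinv_lt (PosNum d0).
have /cvgrPdist_lt/(_ e e0) [N _ h] := H tn tnt.
by have := h N (leqnn N); rewrite /= ltNge (proj2 (tnP N)).
Unshelve. all: by end_near. Qed.

Lemma prim_continuous {R : realType} (f : R -> R) :
  (@lebesgue_measure R).-integrable setT (EFin \o f) -> continuous (prim f).
Proof.
move=> i_f t; apply: seq_cvg => tn tnt.
(* The point [t] is removed from the integral: there the truth value of [x <= tn n] may oscillate,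
   elsewhere it is eventually constant. *)
have mne : measurable_fun (setT : set (measurableTypeR R)) (fun s : R => (s != t)%:R : R).
  have -> : (fun s : R => (s != t)%:R : R) = \1_(~` [set t]).
    apply/funext => s; rewrite indicE; congr (_%:R); congr nat_of_bool.
    by apply/idP/idP; rewrite in_setE /= => /eqP.
  by apply: measurable_indic; exact: measurableC.
have E s : prim f s = \int[lebesgue_measure]_x (f x * (x != t)%:R * (x <= s)%R%:R).
  rewrite prim_indic; apply: Rintegral_ae_eq.
  exists [set t]; split => //; first exact: lebesgue_measure_set1.
  move=> x /= H; apply/eqP/negPn/negP => xt; apply: H.
  by rewrite xt mulr1.
have mf := integrable_EFin_measurable i_f.
have mk s : measurable_fun (setT : set (measurableTypeR R))
    (fun x => f x * (x != t)%:R * (x <= s)%R%:R).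
  by apply: measurable_funM; [exact: measurable_funM|exact: measurable_le_ind].
have bd s x : `|f x * (x != t)%:R * (x <= s)%R%:R| <= `|f x|.
  rewrite !normrM -mulrA ler_piMr//.
  by case: (x != t); case: (x <= s); rewrite /= ?normr1 ?normr0 ?mulr1 ?mulr0.
have pt x : f x * (x != t)%:R * (x <= tn n)%R%:R @[n --> \oo] -->
    f x * (x != t)%:R * (x <= t)%R%:R.
  apply: cvg_near_cst; have [->|xt] := eqVneq x t; first by apply: nearW => n; rewrite !mulr0 !mul0r.
  have [lt|gt|e] := ltgtP x t; last by rewrite e eqxx in xt.
    near=> n; suff -> : x <= tn n by [].
    by apply: ltW; near: n; exact: (cvgr_gt _ tnt).
  near=> n; suff /negbTE -> : ~~ (x <= tn n) by [].
  by rewrite -ltNge; near: n; exact: (cvgr_lt _ tnt).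
have [_ _] := Rintegral_dct (fun n => mk (tn n)) (mk t) pt (integrable_norm i_f) (fun n => bd (tn n)).
rewrite -E; under eq_fun do rewrite -E.
exact.
Unshelve. all: by end_near. Qed.

Section TimeSlices.
Context {R : realType}.
Local Notation R2 := (R * R)%type.
Local Notation R3 := (R * R * R)%type.
Local Notation mR := (measurableTypeR R).
Local Notation mu1 := (@lebesgue_measure R).
Local Notation mu2 := (@leb2 R).
Local Notation mu3 := (@leb3 R).
Local Notation mu_tx := (@leb_tx R).
Local Notation mu_th := (@leb_th R).

Variables (eps l alpha : R) (rhoin : R3 -> R) (momin : R3 -> 'rV[R]_3)
    (rho : R * R3 -> R) (u : R * R3 -> 'rV[R]_3)
    (Du : R * R3 -> 'M[R]_3) (gam : bool -> R * R2 -> 'rV[R]_3).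
Hypothesis W : weak_solution_with eps l alpha rhoin momin rho u Du gam.
Hypotheses (l0 : 0 < l).
Variables (T T1 c : R).
Hypotheses (T0 : 0 < T) (TT1 : T < T1) (c0 : 0 < c).
Hypothesis rhoin_oo : LpOn mu3 (Omega l) +oo%E rhoin.
Hypothesis rhoin_c : {ae mu3, forall x, Omega l x -> 0 <= rhoin x <= c}.

Let D : set (R * R3) := `[0, T1[ `*` Omega l.
Let T10 : 0 < T1. Proof. exact: lt_trans TT1. Qed.
Let hid : C1b (id : R -> R) \/ (id : R -> R) = id := or_intror erefl.

(** The density lies between 0 and [c] almost everywhere; clamping it gives bounds at every point
    and hence for every slice and every vertical mean. *)
Definition clamp (x : R) : R := Num.max 0 (Num.min c x).

Lemma clamp_bound x : 0 <= clamp x <= c.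
Proof. by rewrite /clamp le_max lexx /= ge_max (ltW c0) ge_min lexx. Qed.

Lemma clampK x : 0 <= x <= c -> clamp x = x.
Proof. by move=> /andP[x0 xc]; rewrite /clamp min_r// max_r. Qed.

Lemma measurable_clamp d (S : measurableType d) (f : S -> R) :
  measurable_fun setT f -> measurable_fun setT (fun x => clamp (f x)).
Proof. by move=> mf; apply: measurable_maxr => //; exact: measurable_minr. Qed.

Let clamp0 : clamp 0 = 0.
Proof. by rewrite clampK// lexx ltW. Qed.

Definition rhoc (z : R * R3) : R := clamp (bdens l rho T1 id z).

Let mrhoc : measurable_fun (setT : set (mR * (mR * mR * mR))) rhoc.
Proof. by apply: measurable_clamp; exact: (measurable_bdens W T10 hid). Qed.

Let rhocO t x : ~ Omega l x -> rhoc (t, x) = 0.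
Proof. by move=> nO; rewrite /rhoc /bdens /patch memNset ?clamp0// => -[]. Qed.

Lemma rhocE : {ae mu_tx, forall z, rhoc z = bdens l rho T1 id z}.
Proof.
have rc : {ae mu3, forall x, Omega l x -> rhoin x <= c}.
  by move: rhoin_c; apply: ae_imp => x h /h /andP[].
move: (density_bound W l0 T10 rhoin_oo rc) (ws_rho_ge0 W); apply: ae_imp2 => z h1 h2.
rewrite /rhoc /bdens /patch; case: ifPn => [|_]; last exact: clamp0.
rewrite inE => -[/= z1 z2]; rewrite clampK// h1// andbT; apply: h2 => //.
by move: z1; rewrite in_itv /= => /andP[].
Qed.

Definition rbar (t : R) (y : R2) : R := slice l (fun x => rhoc (t, x)) y.

Let mrhoc_t t : measurable_fun (setT : set (mR * mR * mR)) (fun x => rhoc (t, x)).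
Proof. exact: (measurable_fun_pair2 t mrhoc). Qed.

Lemma measurable_rbar t : measurable_fun (setT : set (mR * mR)) (rbar t).
Proof. exact: (measurable_slice l (mrhoc_t t)). Qed.

Lemma rbar_bound t y : 0 <= rbar t y <= c.
Proof.
apply: (slice_bound l0 (mrhoc_t t) (c := c)) => x; first exact: clamp_bound.
exact: rhocO.
Qed.

Definition mass0 (i : box_idx) : R :=
  (2 * l)^-1 * \int[mu3]_x (bdens_in l rhoin id x * theta i x.1).

Definition mflux (i : box_idx) (t : R) : R :=
  (2 * l)^-1 * prim (mass_flux l rho u T1 id (theta1 i) (theta2 i)) t.

Lemma mflux_continuous i : continuous (mflux i).
Proof.
move=> t; apply: cvgMr; apply: prim_continuous.
exact: (integrable_mass_flux W T10 hid (@test_fun_theta1 R i) (@test_fun_theta2 R i)).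
Qed.

(** At such a time [rbar t] itself can serve as representative. These times have full measure in
    []0, T1[], so they accumulate from the right at every point of [[0, T]]. *)
Definition good (t : R) : Prop := [/\ 0 < t < T1,
  forall i, \int[mu2]_y (rbar t y * theta i y) = mass0 i + mflux i t &
  {ae mu2, forall y, rbar t y = vavg_t l rho (t, y)}].

Lemma ae_good : {ae mu1, forall t, 0 < t < T1 -> good t}.
Proof.
have M : {ae mu1, forall t, forall i, 0 < t < T1 ->
    \int[mu3]_x (bdens l rho T1 id (t, x) * (theta1 i x.1.1 * theta2 i x.1.2)) =
    \int[mu3]_x (bdens_in l rhoin id x * (theta1 i x.1.1 * theta2 i x.1.2))
    + prim (mass_flux l rho u T1 id (theta1 i) (theta2 i)) t}.
  apply: ae_forall_count => i.
  exact: (mass_ae W T10 rhoin_oo hid (@test_fun_theta1 R i) (@test_fun_theta2 R i)).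
move: M (ae_prod1 leb_txE rhocE); apply: ae_imp2 => t mt rt tT; split => //.
- move=> i; rewrite (Rintegral_slice (mrhoc_t t) (c := c)) //; last 3 first.
  + by move=> x; exact: clamp_bound.
  + by move=> x; exact: rhocO.
  + exact: integrable_theta.
  rewrite /mass0 /mflux -mulrDr; congr (_ * _); rewrite -mt//.
  by apply: Rintegral_ae_eq; move: rt; apply: ae_imp => x ->.
- move: (ae_prod1 leb3E rt); apply: ae_imp => y ry; apply/esym.
  apply: vavgE; first by move=> x; exact: rhocO.
  move: ry; apply: ae_imp => s -> Os /=; rewrite /bdens /patch mem_set//.
  by split => //=; rewrite in_itv /=; case/andP: tT => /ltW -> ->.
Qed.

(** A Cauchy criterion: [phi] is indexed by pairs of good times. Its moments against [theta] tend to
    0 along the product filter because [mflux i] is continuous, and [weak0_theta] extends this to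
    every integrable [g]. *)
Let rbar_diff_cvg (tj : nat -> R) (t : R) (g : R2 -> R) :
  (forall j, good (tj j)) -> tj j @[j --> \oo] --> t ->
  mu2.-integrable setT (EFin \o g) ->
  cvgn (fun j => \int[mu2]_y (rbar (tj j) y * g y)).
Proof.
move=> gj tjt ig.
pose phi (p : nat * nat) y := rbar (tj p.1) y - rbar (tj p.2) y.
have phiC p y : `|phi p y| <= c.
  have /andP[a1 a2] := rbar_bound (tj p.1) y; have /andP[b1 b2] := rbar_bound (tj p.2) y.
  by rewrite /phi ler_norml; lra.
have mphi p : measurable_fun (setT : set (mR * mR)) (phi p).
  by apply: measurable_funB; exact: measurable_rbar.
have ib t' h : mu2.-integrable setT (EFin \o h) ->
    mu2.-integrable setT (EFin \o (fun y => rbar t' y * h y)).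
  move=> ih; apply: (integrable_mul_bounded ih (measurable_rbar t') (M := c)) => y.
  by have /andP[a1 a2] := rbar_bound t' y; rewrite ger0_norm.
have E p h : mu2.-integrable setT (EFin \o h) -> \int[mu2]_y (phi p y * h y) =
    \int[mu2]_y (rbar (tj p.1) y * h y) - \int[mu2]_y (rbar (tj p.2) y * h y).
  move=> ih; rewrite -RintegralB//; try exact: ib.
  by congr (Rintegral mu2 setT _); apply/funext => y; rewrite /phi mulrBl.
have W0 : weak0 mu2 (filter_prod \oo \oo) phi g.
  apply: (weak0_theta c0 mphi phiC) => // i.
  rewrite /weak0.
  have -> : (fun p => \int[mu2]_y (phi p y * theta i y)) =
      (fun p => mflux i (tj p.1) - mflux i (tj p.2)).
    apply/funext => p; rewrite E; last exact: integrable_theta.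
    have [_ -> _] := gj p.1; have [_ -> _] := gj p.2; ring.
  have fc : mflux i (tj j) @[j --> \oo] --> mflux i t.
    exact: (cvg_comp tj (mflux i) tjt (@mflux_continuous i t)).
  rewrite -(subrr (mflux i t)); apply: cvgB.
    exact: (cvg_comp (fun p : nat * nat => p.1) (fun j => mflux i (tj j)) cvg_fst fc).
  exact: (cvg_comp (fun p : nat * nat => p.2) (fun j => mflux i (tj j)) cvg_snd fc).
apply: cauchy_cvg; apply/cauchy_ballP => e e0.
move: W0; rewrite /weak0 => /cvgrPdist_lt /(_ e e0) [[P Q] /= [hP hQ] PQ].
exists ([set x | exists2 j, P j & x = \int[mu2]_y (rbar (tj j) y * g y)],
        [set x | exists2 j, Q j & x = \int[mu2]_y (rbar (tj j) y * g y)]) => /=.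
  by split; [move: hP|move: hQ]; apply: filterS => j Pj; exists j.
move=> [x y] /= [[j Pj ->] [k Qk ->]].
have := PQ (j, k) (conj Pj Qk); rewrite /= E// sub0r normrN.
exact.
Qed.

Lemma representative_at (t : R) : exists r : R2 -> R,
  [/\ measurable_fun (setT : set (mR * mR)) r, forall y, 0 <= r y <= c,
      0 <= t <= T -> forall i, \int[mu2]_y (r y * theta i y) = mass0 i + mflux i t &
      good t -> r = rbar t].
Proof.
have [gt|ngt] := pselect (good t).
  exists (rbar t); split => //; [exact: measurable_rbar|exact: rbar_bound|].
  by move=> _ i; have [_ ->] := gt.
have [tT|tT] := boolP (0 <= t <= T); last first.
  by exists (fun=> 0); split => // y; rewrite lexx ltW.
have tT1 : 0 < T1 - t by move: TT1 tT; lra.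
(* Approaching from the right also works at [t = 0], and at [t = T] thanks to the margin
   [T < T1]. *)
have /choice[tj tjP] : forall j : nat, exists s, t < s < t + (T1 - t) / j.+1%:R /\ good s.
  move=> j; have j1 : 0 < j.+1%:R :> R by rewrite ltr0n.
  have d0 : 0 < (T1 - t) / j.+1%:R by rewrite divr_gt0.
  have [|s [ts gs]] := @ae_exists_itv R _ t (t + (T1 - t) / j.+1%:R) _ ae_good; first by rewrite ltrDl.
  exists s; split => //; apply: gs.
  have : (T1 - t) / j.+1%:R <= T1 - t by rewrite ler_pdivrMr// ler_peMr ?ler1n// ltW.
  by move: tT ts; set q := _ / _; lra.
have tjt : tj j @[j --> \oo] --> t.
  apply/cvgrPdist_le => e e0.
  have : (T1 - t) / j.+1%:R @[j --> \oo] --> (0 : R).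
    by rewrite -(mulr0 (T1 - t)); apply: cvgMr; exact: cvg_harmonic.
  move=> /cvgrPdist_le /(_ e e0); apply: filterS => j.
  have q0 : 0 <= (T1 - t) / j.+1%:R by rewrite divr_ge0// ltW.
  rewrite sub0r normrN ger0_norm//.
  have [tj1 _] := tjP j; rewrite ler0_norm; last by move: tj1; lra.
  by move: tj1; set q := _ / _; lra.
have [|r [mr r0c rc]] := @weak_star_complete _ _ R mu2 (@gauss2 R) c
  (fun j => rbar (tj j)) (@gauss2_gt0 R) (@integrable_gauss2 R) c0
  (fun j => measurable_rbar (tj j)) (fun j => rbar_bound (tj j)).
  by move=> g ig; exact: (rbar_diff_cvg (fun j => proj2 (tjP j)) tjt ig).
exists r; split => // _ i.
apply: (@cvg_unique _ (@Rhausdorff R) _ _ _ _ (rc _ (@integrable_theta R i))).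
have -> : (fun j => \int[mu2]_y (rbar (tj j) y * theta i y)) = (fun j => mass0 i + mflux i (tj j)).
  by apply/funext => j; have [_ [_ ->]] := tjP j.
apply: cvgD; first exact: cvg_cst.
exact: (cvg_comp tj (mflux i) tjt (@mflux_continuous i t)).
Qed.

Lemma representative : exists rhot : R -> R2 -> R,
  [/\ forall t, measurable_fun (setT : set (mR * mR)) (rhot t),
      forall t y, 0 <= rhot t y <= c,
      forall t i, 0 <= t <= T -> \int[mu2]_y (rhot t y * theta i y) = mass0 i + mflux i t &
      time_repr T (vavg_t l rho) rhot].
Proof.
have /choice[rhot rP] := representative_at.
exists rhot; split.
- by move=> t; have [] := rP t.
- by move=> t; have [] := rP t.
- by move=> t i tT; have [_ _ /(_ tT)] := rP t.
have t0 : {ae mu1, forall t : R, t != 0}.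
  exists [set 0]; split => //; first exact: lebesgue_measure_set1.
  by move=> t /= /negP; rewrite negbK => /eqP.
move: t0 ae_good; apply: ae_imp2 => t t0 gt /andP[t0' tT].
have {}gt : good t by apply: gt; rewrite lt_neqAle eq_sym t0 t0' (le_lt_trans tT).
by have [_ _ _ ->//] := rP t; have [_ _] := gt.
Qed.

End TimeSlices.

(** * Lebesgue spaces on compact sets of the plane *)

Section CompactSets.
Context {R : realType}.
Local Notation R2 := (R * R)%type.
Local Notation mR := (measurableTypeR R).
Local Notation mu1 := (@lebesgue_measure R).
Local Notation mu2 := (@leb2 R).

(** The sigma-algebra on the plane is generated by rectangles, not by the topology; an open set is
    the countable union of the rational boxes it contains. *)
Lemma open_measurable2 (O : set R2) : open O -> measurable (O : set (mR * mR)).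
Proof.
move=> oO; pose box (i : (rat * rat) * (rat * rat)) : set R2 :=
  `]ratr i.1.1, ratr i.1.2[%classic `*` `]ratr i.2.1, ratr i.2.2[%classic.
have mbox i : measurable (box i : set (mR * mR)) by exact: measurableX.
pose F i := if `[< box i `<=` O >] then box i else set0.
have -> : O = \bigcup_i F i.
  apply/seteqP; split => [[x y] Oxy|x [i _]]; last first.
    by rewrite /F; case: asboolP => // sub /sub.
  have /nbhs_ballP[e /= e0 eO] := oO _ Oxy.
  have near_rat (z : R) : exists a b : rat, [/\ ratr a < z, z < ratr b,
      z - e < ratr a & ratr b < z + e].
    have [|a] := @rat_in_itvoo R (z - e) z; first by lra.
    rewrite in_itv /= => /andP[a1 a2].
    have [|b] := @rat_in_itvoo R z (z + e); first by lra.
    by rewrite in_itv /= => /andP[b1 b2]; exists a, b.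
  have [a [b [xa xb ea eb]]] := near_rat x; have [a' [b' [ya yb ea' eb']]] := near_rat y.
  exists ((a, b), (a', b')) => //; rewrite /F asboolT.
    by split; rewrite /= in_itv /= ?xa ?ya.
  move=> [p q] [/=]; rewrite !in_itv /= => /andP[p1 p2] /andP[q1 q2].
  apply: eO; split => /=; rewrite /ball /= ltr_norml; apply/andP; split; lra.
apply: countable_bigcupT_measurable => [|i]; first exact: countableP.
by rewrite /F; case: asboolP.
Qed.

Lemma compact_measurable2 (K : set R2) : compact K -> measurable (K : set (mR * mR)).
Proof.
move=> cK; rewrite -[K]setCK; apply: measurableC; apply: open_measurable2.
by apply: closed_openC; exact: compact_closed.
Qed.

Lemma compact_finite2 (K : set R2) : compact K -> (mu2 K < +oo)%E.
Proof.
move=> cK; have mK := compact_measurable2 cK.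
have [M [_ KM]] := compact_bounded cK.
pose B : set R := `]- (`|M| + 2), `|M| + 2[%classic.
have Mlt : M < `|M| + 1 by have := ler_norm M; lra.
have KB : K `<=` B `*` B.
  move=> [x y] /(KM _ Mlt) /=.
  rewrite (_ : `|(x, y)| = Num.max `|x| `|y|)// ge_max => /andP[hx hy].
  by split; rewrite /B /= in_itv /= -ltr_norml; lra.
have mB1 : measurable (B : set mR) := measurable_itv _.
have mB : measurable (B `*` B : set (mR * mR)) by exact: measurableX.
have ll : - (`|M| + 2) <= `|M| + 2 by have := normr_ge0 M; lra.
have Bfin : mu1 B = (`|M| + 2 - - (`|M| + 2))%:E := lebesgue_itvoo ll.
have BE : mu2 (B `*` B) = (mu1 B * mu1 B)%E := product_measure1E mu1 mu1 mB1 mB1.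
have fin : (mu2 (B `*` B) < +oo)%E by rewrite BE Bfin -EFinM ltry.
exact: le_lt_trans (le_measure mu2 (mem_set mK) (mem_set mB) KB) fin.
Qed.

(** On a set of finite measure the modulus is at most 1 plus its power [q]. The case [q = +oo]
    arises as the conjugate exponent of 1. *)
Lemma LpOn_integrable (K : set R2) (q : \bar R) (g : R2 -> R) : compact K ->
  (1 <= q)%E -> LpOn mu2 K q g -> mu2.-integrable setT (EFin \o (g \_ K)).
Proof.
move=> cK q1 gq; have mK := compact_measurable2 cK; have Kfin := compact_finite2 cK.
have mg := Lfun_measurable gq.
have iK : mu2.-integrable setT (EFin \o (\1_K : R2 -> R)).
  apply: (@integrable_bounded_supp _ _ _ mu2 _ K 1) => //.
  - by move=> x; rewrite indicE; case: (_ \in _); rewrite ?normr1// normr0.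
  - by move=> x nK; rewrite indicE memNset.
have gK x : g \_ K x = g \_ K x * \1_K x.
  by rewrite indicE /patch; case: (x \in K); rewrite ?mulr1 ?mulr0.
case: q q1 gq => [q q1 gq|_ gq|//].
- have iq := Lfun_integrable q1 gq.
  apply: (integrable_dom mg (integrable_add iq iK)) => x /=.
  have [gx|gx] := leP `|g \_ K x| 1.
    apply: (@le_trans _ _ (\1_K x)); last by rewrite lerDr powR_ge0.
    rewrite gK normrM indicE; case: (x \in K); first by rewrite normr1 mulr1.
    by rewrite normr0 mulr0.
  apply: (@le_trans _ _ (`|g \_ K x| `^ q)); last by rewrite lerDl indicE ler0n.
  by rewrite -[leLHS]powRr1//; apply: ler_powR => //; exact: ltW.
- have [M M0 gM] := Lfun_oo_bound gq.
  apply: (integrable_ae_dom mg (integrable_scale M iK)).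
  move: gM; apply: ae_imp => x gx; rewrite gK normrM [`|\1_K x|]ger0_norm ?indicE ?ler0n//.
  by apply: ler_wpM2r.
Qed.

Lemma bounded_LpOn (K : set R2) (p : R) (f : R2 -> R) (M : R) : compact K ->
  1 <= p -> measurable_fun (setT : set (mR * mR)) f -> (forall x, `|f x| <= M) ->
  LpOn mu2 K p%:E f.
Proof.
move=> cK p1 mf fM; have mK := compact_measurable2 cK; have Kfin := compact_finite2 cK.
have mfK : measurable_fun (setT : set (mR * mR)) (f \_ K).
  by apply/(measurable_restrictT _ mK); exact: measurable_funS mf.
have M0 : 0 <= M := le_trans (normr_ge0 _) (fM 0).
have p0 : 0 < p by apply: lt_le_trans p1.
rewrite /LpOn inE; apply/andP; split; rewrite inE//= /finite_norm unlock.
apply: poweR_lty.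
have -> : (fun x => `|(EFin \o f \_ K) x| `^ p)%E =
    EFin \o (fun x => `|f \_ K x| `^ p) by [].
have mpow : measurable_fun (setT : set (mR * mR)) (fun x => `|f \_ K x| `^ p).
  by apply: (measurableT_comp (measurable_powR _)); exact: measurableT_comp.
have ip : mu2.-integrable setT (EFin \o (fun x => `|f \_ K x| `^ p)).
  apply: (@integrable_bounded_supp _ _ _ mu2 _ K (M `^ p)) => // x.
    rewrite ger0_norm ?powR_ge0//; apply: ge0_ler_powR; rewrite ?nnegrE//; first exact: ltW.
    by rewrite /patch; case: ifPn => // _; rewrite normr0.
  by move=> nK; rewrite /patch memNset// normr0 powR0// gt_eqF.
by have := EFin_Rintegral ip; rewrite /comp => <-; rewrite ltry.
Qed.

End CompactSets.

(** * From moments against [theta] to moments against L^1 *)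

Section WeakInTime.
Context {R : realType}.
Local Notation R2 := (R * R)%type.
Local Notation mR := (measurableTypeR R).
Local Notation mu2 := (@leb2 R).
Variables (T c : R).
Hypothesis c0 : 0 < c.

Let integrable_bd (r g : R2 -> R) : measurable_fun (setT : set (mR * mR)) r ->
  (forall y, 0 <= r y <= c) -> mu2.-integrable setT (EFin \o g) ->
  mu2.-integrable setT (EFin \o (fun y => r y * g y)).
Proof.
move=> mr rc ig; apply: (integrable_mul_bounded ig mr (M := c)) => y.
by have /andP[a1 a2] := rc y; rewrite ger0_norm.
Qed.

Let Rintegral_diff (r s g : R2 -> R) : measurable_fun (setT : set (mR * mR)) r ->
  measurable_fun (setT : set (mR * mR)) s ->
  (forall y, 0 <= r y <= c) -> (forall y, 0 <= s y <= c) ->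
  mu2.-integrable setT (EFin \o g) ->
  \int[mu2]_y ((r y - s y) * g y) = \int[mu2]_y (r y * g y) - \int[mu2]_y (s y * g y).
Proof.
move=> mr ms rc sc ig; rewrite -RintegralB//; try exact: integrable_bd.
by congr (Rintegral mu2 setT _); apply/funext => y; rewrite mulrBl.
Qed.

Let diff_bound (r s : R) : 0 <= r <= c -> 0 <= s <= c -> `|r - s| <= c.
Proof. by move=> /andP[a1 a2] /andP[b1 b2]; rewrite ler_norml; lra. Qed.

(** An instance of [weak0_theta] for the differences [rhot s - rhot t], along the neighbourhoods of
    [t] within [[0, T]]. *)
Lemma moments_continuous (rhot : R -> R2 -> R) (F : box_idx -> R -> R) :
  (forall t, measurable_fun (setT : set (mR * mR)) (rhot t)) ->
  (forall t y, 0 <= rhot t y <= c) ->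
  (forall i t, 0 <= t <= T -> \int[mu2]_y (rhot t y * theta i y) = F i t) ->
  (forall i, continuous (F i)) ->
  forall g, mu2.-integrable setT (EFin \o g) ->
  {within `[0, T], continuous (fun t => \int[mu2]_y (rhot t y * g y))}.
Proof.
move=> mr rc rF cF g ig; apply/subspace_continuousP => t; rewrite /= in_itv /= => tT.
pose phi s y := if 0 <= s <= T then rhot s y - rhot t y else 0.
have inT : \forall s \near within `[0, T]%classic (nbhs t), 0 <= s <= T.
  by apply: filterS (withinT _ _) => s; rewrite /= in_itv.
have W0 : weak0 mu2 (within `[0, T]%classic (nbhs t)) phi g.
  apply: (weak0_theta c0) => //.
  - move=> s; rewrite /phi; case: (0 <= s <= T); last exact: measurable_cst.
    exact: measurable_funB.
  - move=> s y; rewrite /phi; case: (0 <= s <= T); last by rewrite normr0 ltW.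
    exact: diff_bound.
  move=> i; apply/cvgrPdist_lt => e e0.
  rewrite near_withinE; have /cvgrPdist_lt/(_ e e0) := @cF i t.
  apply: filterS => s h; rewrite /= in_itv /= => sT; rewrite /phi sT.
  by rewrite Rintegral_diff//; [|exact: integrable_theta]; rewrite !rF// sub0r opprB.
apply/cvgrPdist_lt => e e0; move/cvgrPdist_lt : W0 => /(_ e e0).
apply: filterS2 inT => s sT; rewrite /phi sT.
by rewrite Rintegral_diff// sub0r opprB.
Qed.

(** Convergence along this filter on pairs is convergence in [n] uniformly in [t]. *)
Definition uniformly (S : set (nat * R)) : Prop := \forall n \near \oo, forall t, S (n, t).

#[local] Instance uniformly_filter : Filter uniformly.
Proof.
rewrite /uniformly; split => [|P Q hP hQ|P Q PQ hP]; first by apply: nearW.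
  case: hP => N _ hP; case: hQ => M _ hQ; exists (maxn N M) => // n /= NM t.
  split; [apply: hP|apply: hQ]; apply: leq_trans NM; [exact: leq_maxl|exact: leq_maxr].
by move: hP; apply: filterS => n Pn t; exact: PQ.
Qed.

Lemma moments_uniform (rhot : nat -> R -> R2 -> R) (r0 : R2 -> R) :
  (forall n t, measurable_fun (setT : set (mR * mR)) (rhot n t)) ->
  (forall n t y, 0 <= rhot n t y <= c) ->
  measurable_fun (setT : set (mR * mR)) r0 -> (forall y, 0 <= r0 y <= c) ->
  (forall i e, 0 < e -> \forall n \near \oo, forall t, 0 <= t <= T ->
    `|\int[mu2]_y (rhot n t y * theta i y) - \int[mu2]_y (r0 y * theta i y)| < e) ->
  forall g, mu2.-integrable setT (EFin \o g) ->
  forall e, 0 < e -> \forall n \near \oo, forall t, 0 <= t <= T ->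
    `|\int[mu2]_y (rhot n t y * g y) - \int[mu2]_y (r0 y * g y)| < e.
Proof.
move=> mr rc mr0 r0c H g ig e e0.
(* The filter [uniformly] quantifies over all real times, whereas the estimates hold on [[0, T]]
   only. *)
pose phi (p : nat * R) y := if 0 <= p.2 <= T then rhot p.1 p.2 y - r0 y else 0.
have W0 : weak0 mu2 uniformly phi g.
  apply: (weak0_theta c0) => //.
  - move=> p; rewrite /phi; case: (0 <= p.2 <= T); last exact: measurable_cst.
    exact: measurable_funB.
  - move=> p y; rewrite /phi; case: (0 <= p.2 <= T); last by rewrite normr0 ltW.
    exact: diff_bound.
  move=> i; apply/cvgrPdist_lt => d d0.
  have := H i d d0; apply: filterS => n hn t; rewrite /phi /=.
  have [tT|tT] := boolP (0 <= t <= T); last first.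
    by rewrite /Rintegral integral0_eq ?subr0 ?normr0// => y _; rewrite mul0r.
  by rewrite Rintegral_diff//; [|exact: integrable_theta]; rewrite sub0r normrN; exact: hn.
move/cvgrPdist_lt : W0 => /(_ e e0) hU.
have {hU} : \forall n \near \oo, forall t, `|0 - \int[mu2]_y (phi (n, t) y * g y)| < e := hU.
apply: filterS => n hn t tT.
have := hn t; rewrite /phi /= tT Rintegral_diff// sub0r normrN.
exact.
Qed.

End WeakInTime.

(** * Convergence *)

Section MomentEstimates.
Context {R : realType}.
Local Notation R2 := (R * R)%type.
Local Notation R3 := (R * R * R)%type.
Local Notation mR := (measurableTypeR R).
Local Notation mu1 := (@lebesgue_measure R).
Local Notation mu2 := (@leb2 R).
Local Notation mu3 := (@leb3 R).
Local Notation mu_tx := (@leb_tx R).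
Local Notation mu_th := (@leb_th R).

Variables (eps l alpha : R) (rhoin : R3 -> R) (momin : R3 -> 'rV[R]_3)
    (rho : R * R3 -> R) (u : R * R3 -> 'rV[R]_3)
    (Du : R * R3 -> 'M[R]_3) (gam : bool -> R * R2 -> 'rV[R]_3).
Hypothesis W : weak_solution_with eps l alpha rhoin momin rho u Du gam.
Hypotheses (l0 : 0 < l).
Variables (T1 c : R).
Hypotheses (T10 : 0 < T1) (c0 : 0 < c).
Hypothesis rhoin_oo : LpOn mu3 (Omega l) +oo%E rhoin.
Hypothesis rhoin_c : {ae mu3, forall x, Omega l x -> 0 <= rhoin x <= c}.

Let D : set (R * R3) := `[0, T1[ `*` Omega l.
Let Up i := (fun z => u z 0 i) \_ D.
Let hid : C1b (id : R -> R) \/ (id : R -> R) = id := or_intror erefl.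

(** The squared L^2 norm of the gradient of [theta i], factored by Fubini. *)
Definition theta_energy (i : box_idx) : R :=
  (\int[mu1]_x ('D_1 (theta1 i) x ^+ 2)) * (\int[mu1]_x (theta2 i x ^+ 2)) +
  (\int[mu1]_x (theta1 i x ^+ 2)) * (\int[mu1]_x ('D_1 (theta2 i) x ^+ 2)).

Lemma theta_energy_ge0 i : 0 <= theta_energy i.
Proof.
by apply: addr_ge0; apply: mulr_ge0; apply: Rintegral_ge0 => x _; exact: sqr_ge0.
Qed.

Lemma mflux_le (lam : R) i t : 0 < lam -> `|mflux l rho u T1 i t| <=
  c * (lam * ((2 * l)^-1 * \int[mu_tx]_z (Up 0 z ^+ 2)
            + (2 * l)^-1 * \int[mu_tx]_z (Up 1 z ^+ 2))
       + lam^-1 * (T1 * theta_energy i)).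
Proof.
move=> lam0; have il0 : 0 < lam^-1 by rewrite invr_gt0.
have t1 := @test_fun_theta1 R i; have t2 := @test_fun_theta2 R i.
have dt1 := test_fun_derive t1; have dt2 := test_fun_derive t2.
have l2 : 0 < 2 * l by rewrite mulr_gt0.
rewrite /mflux normrM ger0_norm ?invr_ge0 ?(ltW l2)//.
have iF := integrable_flux_density W T10 hid t1 t2.
have U0 := Lfun2_integrable_sqr (ws_u_L2 W T10 0).
have U1 := Lfun2_integrable_sqr (ws_u_L2 W T10 1).
have g0 := integrable_slab_weight_sqr l T1 dt1 t2.
have g1 := integrable_slab_weight_sqr l T1 t1 dt2.
have iU := integrable_add U0 U1; have ig := integrable_add g0 g1.
have iT := integrable_add (integrable_scale lam iU) (integrable_scale lam^-1 ig).
rewrite mulrC ler_pdivrMr//.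
apply: le_trans (prim_mass_flux_le W T10 hid t t1 t2) _.
apply: (@le_trans _ _ (c * (lam * (\int[mu_tx]_z (Up 0 z ^+ 2) + \int[mu_tx]_z (Up 1 z ^+ 2))
   + lam^-1 * (T1 * theta_energy i * (2 * l))))); last first.
  by rewrite le_eqVlt; apply/orP; left; apply/eqP; field; rewrite !gt_eqF.
have -> : T1 * theta_energy i * (2 * l) =
    \int[mu_tx]_z (slab_weight l T1 (fun x => 'D_1 (theta1 i) x) (theta2 i) z ^+ 2)
    + \int[mu_tx]_z (slab_weight l T1 (theta1 i) (fun x => 'D_1 (theta2 i) x) z ^+ 2).
  rewrite (Rintegral_slab_weight_sqr l0 T10 dt1 t2) (Rintegral_slab_weight_sqr l0 T10 t1 dt2).
  by rewrite /theta_energy -[RHS]mulrDr -[in RHS]mulrDl [RHS]mulrA.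
rewrite -RintegralD// -RintegralD// -RintegralZl// -RintegralZl//.
rewrite -RintegralD//; [|exact: integrable_scale..].
rewrite -RintegralZl//.
apply: le_Rintegral_ae; [exact: integrable_norm|exact: integrable_scale|].
(* [rhocE] is stated for a horizon strictly below [T1]; half of it will do. *)
have h1 : 0 < T1 / 2 by rewrite divr_gt0.
have h2 : T1 / 2 < T1 by rewrite ltr_pdivrMr//; move: T10; lra.
move: (rhocE W l0 h1 h2 c0 rhoin_oo rhoin_c).
apply: ae_imp => z rz; apply: flux_density_le => //.
by have := clamp_bound c0 (bdens l rho T1 id z); rewrite -/(rhoc l rho T1 c z) rz => /andP[? ?]; rewrite ger0_norm.
Qed.

Variables (rho0 : R2 -> R) (rin : R3 -> R) (C : R).
Hypotheses (eps0 : 0 < eps) (C0 : 0 <= C).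
Hypotheses (mrho0 : measurable_fun (setT : set (mR * mR)) rho0)
  (rho0c : forall y, 0 <= rho0 y <= c).
Hypothesis decomp : {ae mu3, forall x, Omega l x -> rhoin x = rho0 x.1 + eps * rin x}.
Hypothesis rinC : {ae mu2, forall y, `|vavg l rin y| <= C}.

(* [rin] need not be measurable: only its vertical average is controlled. *)
Lemma initial_moment i :
  `|mass0 l rhoin i - \int[mu2]_y (rho0 y * theta i y)| <=
  eps * C * \int[mu2]_y `|theta i y|.
Proof.
have it := @integrable_theta R i.
pose r x := clamp c (bdens_in l rhoin id x).
have mr : measurable_fun (setT : set (mR * mR * mR)) r.
  by apply: measurable_clamp; exact: (measurable_bdens_in rhoin_oo hid).
have r0c x : 0 <= r x <= c by exact: clamp_bound.
have rO x : ~ Omega l x -> r x = 0.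
  by move=> nO; rewrite /r /bdens_in /patch memNset// clampK// lexx ltW.
have rE : {ae mu3, forall x, r x = bdens_in l rhoin id x}.
  move: rhoin_c; apply: ae_imp => x rx; rewrite /r /bdens_in /patch.
  by case: ifPn => [|_]; [rewrite inE => /rx; exact: clampK|rewrite clampK// lexx ltW].
have -> : mass0 l rhoin i = \int[mu2]_y (slice l r y * theta i y).
  rewrite (Rintegral_slice mr r0c rO it) /mass0; congr (_ * _).
  by apply: Rintegral_ae_eq; move: rE; apply: ae_imp => x ->.
have bd (f : R2 -> R) : measurable_fun (setT : set (mR * mR)) f -> (forall y, 0 <= f y <= c) ->
    mu2.-integrable setT (EFin \o (fun y => f y * theta i y)).
  move=> mf fc; apply: (integrable_mul_bounded it mf (M := c)) => y.
  by have /andP[a1 a2] := fc y; rewrite ger0_norm.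
have ms := measurable_slice l mr; have sc := slice_bound l0 mr r0c rO.
rewrite -RintegralB//; [|exact: bd..].
have iN := integrable_norm it.
apply: (le_trans (le_normr_Rintegral _ _)) => //.
  by apply: integrable_sub; exact: bd.
rewrite -RintegralZl//; apply: le_Rintegral_ae.
- by apply: integrable_norm; apply: integrable_sub; exact: bd.
- exact: integrable_scale.
move: (ae_prod1 leb3E rE) (ae_prod1 leb3E decomp) rinC; apply: ae_imp3 => y ry dy Cy.
rewrite -mulrBl normrM; apply: ler_wpM2r => //.
have -> : slice l r y - rho0 y = eps * vavg l rin y; last first.
  by rewrite normrM (ger0_norm (ltW eps0)); apply: ler_wpM2l; first exact: ltW.
have l2 : 2 * l != 0 by rewrite mulf_neq0// gt_eqF.
pose it1 (s : R) : R := \1_(`](- l), l[%classic) s.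
have iit : mu1.-integrable setT (EFin \o it1) := integrable_itv (- l) l.
have iry : mu1.-integrable setT (EFin \o (fun s => r (y, s))) := integrable_vert mr r0c rO y.
(* On almost every fibre [rin] coincides with this integrable function, to which linearity of the
   integral applies. *)
have -> : vavg l rin y = (2 * l)^-1 * \int[mu1]_s (eps^-1 * (r (y, s) - rho0 y * it1 s)).
  apply: (@vavgE _ _ _ (fun x => eps^-1 * (r x - rho0 y * it1 x.2))).
    move=> x nO; rewrite rO// /it1 indicE memNset ?mulr0 ?subrr ?mulr0//.
  move: ry dy; apply: ae_imp2 => s rs ds Os.
  have := ds Os; rewrite rs /bdens_in /patch mem_set// => ->.
  rewrite /it1 indicE mem_set; last by rewrite /= in_itv.
  by rewrite /=; field; rewrite gt_eqF.
rewrite RintegralZl//; last by apply: integrable_sub => //; exact: integrable_scale.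
rewrite RintegralB//; last exact: integrable_scale.
rewrite RintegralZl// Rintegral_indic_itvoo; last by move: l0; lra.
by rewrite /slice; field; rewrite !gt_eqF.
Qed.

End MomentEstimates.

Section SolutionPackage.
Context {R : realType}.
Local Notation R2 := (R * R)%type.
Local Notation R3 := (R * R * R)%type.
Local Notation mR := (measurableTypeR R).
Local Notation mu1 := (@lebesgue_measure R).
Local Notation mu2 := (@leb2 R).
Local Notation mu3 := (@leb3 R).
Local Notation mu_tx := (@leb_tx R).
Local Notation mu_th := (@leb_th R).

(** Both integrands agree wherever [rhoin] is nonnegative, also at 0 since [0^-1 = 0]. Undoing the
    vertical mean costs the factor [2 * l], which the means of the solution will absorb. *)
Lemma energy_bound (l : R) (rhoin : R3 -> R) (momin : R3 -> 'rV[R]_3) (C : R) :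
  0 < l -> {ae mu3, forall x, Omega l x -> 0 <= rhoin x} ->
  mu3.-integrable (Omega l) (fun x => (normsq (momin x) / rhoin x)%:E) ->
  (((2 * l)^-1)%:E * \int[mu1]_(s in `](- l)%R, l[)
       \int[mu2]_xh (normsq ((Num.sqrt (rhoin (xh, s)))^-1 *: momin (xh, s)))%:E
     <= C%:E)%E ->
  (\int[mu3]_(x in Omega l) (normsq (momin x) / rhoin x)%:E <= (2 * l * C)%:E)%E.
Proof.
move=> l0 rho_ge0 iE hC; have l2 : 0 < 2 * l by rewrite mulr_gt0.
have mO := measurable_Omega l.
pose F := (fun x => normsq (momin x) / rhoin x) \_ (Omega l).
have mF : measurable_fun (setT : set (mR * mR * mR)) F.
  by have /integrableP[/measurable_EFinP mF _] := iE; exact/(measurable_restrictT _ mO).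
have FN x : (Omega l x -> 0 <= rhoin x) -> `|F x| =
    ((fun x => normsq ((Num.sqrt (rhoin x))^-1 *: momin x)) \_ (Omega l)) x.
  move=> h; rewrite /F /patch; case: ifPn => [|_]; last by rewrite normr0.
  rewrite inE => /h r0; rewrite ger0_norm ?divr_ge0 ?normsq_ge0//.
  rewrite /normsq /dot mulrC mulr_sumr; apply: eq_bigr => i _.
  rewrite !mxE [RHS]mulrACA; congr (_ * _).
  by rewrite -expr2 exprVn sqr_sqrtr.
apply: (@le_trans _ _ (\int[mu3]_x `|F x|%:E)%E).
  rewrite integral_mkcond -[X in (X <= _)%E](@integral_ae_nonmeas _ _ _ mu3 (EFin \o (fun x => `|F x|))).
    by [].
  move: rho_ge0; apply: ae_imp => x rx; rewrite /= /F /patch; case: ifPn => [|_]; last by rewrite normr0.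
  by rewrite inE => /rx r0; rewrite ger0_norm ?divr_ge0 ?normsq_ge0.
rewrite (tonelli2 leb3E); [|exact/measurable_EFinP/measurableT_comp|by []].
have -> : (2 * l * C)%:E = ((2 * l)%:E * C%:E)%E by rewrite EFinM.
rewrite -lee_pdivrMl//.
apply: le_trans hC; apply: lee_wpmul2l; first by rewrite lee_fin invr_ge0 ltW.
rewrite [leRHS]integral_mkcond; apply: le_integral_ae_nonmeas.
- by move=> s; apply: integral_ge0.
- by apply: erestrict_ge0 => s _; apply: integral_ge0 => y _; rewrite lee_fin normsq_ge0.
move: (ae_prod_swap leb3E rho_ge0); apply: ae_imp => s hs.
rewrite /patch mem_setE in_itv /=; case: ifPn => sl.
  apply: le_integral_ae_nonmeas => //.
    by move=> y; rewrite lee_fin normsq_ge0.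
  by move: hs; apply: ae_imp => y /FN ->; rewrite /patch mem_set.
rewrite integral0_eq// => y _; rewrite /F /patch memNset ?normr0//.
exact/negP.
Qed.

Variables (eps l alpha : R) (rhoin : R3 -> R) (momin : R3 -> 'rV[R]_3)
    (rho : R * R3 -> R) (u : R * R3 -> 'rV[R]_3)
    (Du : R * R3 -> 'M[R]_3) (gam : bool -> R * R2 -> 'rV[R]_3).
Hypothesis W : weak_solution_with eps l alpha rhoin momin rho u Du gam.
Hypotheses (l0 : 0 < l) (alpha0 : 0 < alpha).
Variables (T c C : R).
Hypotheses (T0 : 0 < T) (c0 : 0 < c).
Hypothesis hE :
  (\int[mu3]_(x in Omega l) (normsq (momin x) / rhoin x)%:E <= (2 * l * C)%:E)%E.

Let T10 : 0 < T + 1. Proof. by rewrite addr_gt0. Qed.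
Let TT1 : T < T + 1. Proof. by rewrite ltrDl. Qed.
Let Dt : set (R * R2) := `[0, T] `*` setT.

(** The bound of [velocity_estimate] for the energy [2 * l * C], divided by the thickness
    [2 * l]. *)
Definition velocity_gap : R := (2 * l / alpha + 8 * l ^+ 2) * C.

Lemma mean_velocity i :
  (2 * l)^-1 * \int[mu_tx]_z (((fun z => u z 0 i) \_ (`[0, T + 1[ `*` Omega l)) z ^+ 2)
  <= velocity_gap.
Proof.
have l2 : 0 < 2 * l by rewrite mulr_gt0.
rewrite mulrC ler_pdivrMr//.
apply: le_trans (velocity_estimate W l0 alpha0 T10 hE i) _.
by rewrite le_eqVlt; apply/orP; left; apply/eqP; rewrite /velocity_gap; ring.
Qed.

Let measurable_Dt : measurable (Dt : set (mR * (mR * mR))).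
Proof. exact: measurableX. Qed.

Lemma mean_velocity_sqr i :
  let f := (vavg_t l (fun z => u z 0 i)) \_ Dt in
  [/\ measurable_fun (setT : set (mR * (mR * mR))) f,
      mu_th.-integrable setT (EFin \o (fun y => f y ^+ 2)) &
      \int[mu_th]_y (f y ^+ 2) <= velocity_gap].
Proof.
move=> f; pose Up := (fun z => u z 0 i) \_ (`[0, T + 1[ `*` Omega l).
have mU := Lfun_measurable (ws_u_L2 W T10 i).
have U2 := Lfun2_integrable_sqr (ws_u_L2 W T10 i).
have UO z : ~ Omega l z.2 -> Up z = 0 by move=> nO; rewrite /Up /patch memNset// => -[].
have [mG G2 GU] := vert_sqr l0 mU U2 UO.
set G := fun y => _ in mG G2 GU.
have fE : f = G \_ Dt.
  apply/funext => -[t y]; rewrite /f /patch; case: ifPn => //.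
  rewrite inE /= => -[/=]; rewrite in_itv /= => /andP[t0 tT] _.
  apply: (@vavgE _ _ _ (fun x => Up (t, x))) => [x nO|]; first exact: UO.
  apply: aeW => s Os; rewrite /Up /patch mem_set//; split => //=.
  by rewrite in_itv /= t0 (le_lt_trans tT).
have fG y : f y ^+ 2 <= G y ^+ 2.
  by rewrite fE /patch; case: ifPn => // _; rewrite expr0n /= sqr_ge0.
have mf : measurable_fun (setT : set (mR * (mR * mR))) f.
  by rewrite fE; apply/(measurable_restrictT _ measurable_Dt); exact: measurable_funS mG.
have if2 : mu_th.-integrable setT (EFin \o (fun y => f y ^+ 2)).
  apply: (integrable_dom _ G2); first exact: measurable_funX.
  by move=> y; rewrite ger0_norm ?sqr_ge0.
split => //; apply: le_trans (mean_velocity i); apply: le_trans GU.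
exact: le_Rintegral.
Qed.

Hypothesis rhoin_oo : LpOn mu3 (Omega l) +oo%E rhoin.
Hypothesis rhoin_c : {ae mu3, forall x, Omega l x -> 0 <= rhoin x <= c}.
Variables (rho0 : R2 -> R) (rin : R3 -> R) (Cr : R).
Hypotheses (eps0 : 0 < eps) (Cr0 : 0 <= Cr).
Hypotheses (mrho0 : measurable_fun (setT : set (mR * mR)) rho0)
  (rho0c : forall y, 0 <= rho0 y <= c).
Hypothesis decomp : {ae mu3, forall x, Omega l x -> rhoin x = rho0 x.1 + eps * rin x}.
Hypothesis rinC : {ae mu2, forall y, `|vavg l rin y| <= Cr}.

(** The discrepancy of the initial data, then the flux. The weight [lam] stays free, since it must
    be chosen according to the accuracy wanted. *)
Definition moment_gap (lam : R) (i : box_idx) : R :=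
  eps * Cr * \int[mu2]_y `|theta i y| +
  c * (lam * (velocity_gap + velocity_gap) + lam^-1 * ((T + 1) * theta_energy i)).

Lemma density_package : exists rhot : R -> R2 -> R,
  [/\ forall t, measurable_fun (setT : set (mR * mR)) (rhot t),
      forall t y, 0 <= rhot t y <= c,
      time_repr T (vavg_t l rho) rhot,
      exists2 F : box_idx -> R -> R, forall i, continuous (F i) &
        forall i t, 0 <= t <= T -> \int[mu2]_y (rhot t y * theta i y) = F i t &
      forall lam i t, 0 < lam -> 0 <= t <= T ->
        `|\int[mu2]_y (rhot t y * theta i y) - \int[mu2]_y (rho0 y * theta i y)|
          <= moment_gap lam i].
Proof.
have [rhot [mr rc rF rr]] := representative W l0 T0 TT1 c0 rhoin_oo rhoin_c.
exists rhot; split => //.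
  exists (fun i t => mass0 l rhoin i + mflux l rho u (T + 1) i t); last by move=> i t; exact: rF.
  move=> i t; apply: cvgD; first exact: cvg_cst.
  exact: (mflux_continuous W T0 TT1).
move=> lam i t lam0 tT; rewrite rF// addrAC; apply: le_trans (ler_normD _ _) _.
apply: lerD; first exact: (initial_moment l0 c0 rhoin_oo rhoin_c eps0 mrho0 rho0c decomp rinC).
apply: le_trans (mflux_le W l0 T10 c0 rhoin_oo rhoin_c i t lam0) _.
apply: ler_wpM2l; first exact: ltW.
rewrite lerD2r; apply: ler_wpM2l; first exact: ltW.
by apply: lerD; exact: mean_velocity.
Qed.

(** The bound is read off the representative at almost every time, then carried to space-time by
    [ae_prod2]. *)
Lemma mean_density (rhot : R -> R2 -> R) :
  (forall t y, 0 <= rhot t y <= c) -> time_repr T (vavg_t l rho) rhot ->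
  measurable_fun (setT : set (mR * (mR * mR))) ((vavg_t l rho) \_ Dt) /\
  {ae mu_th, forall y, `|((vavg_t l rho) \_ Dt) y| <= c}.
Proof.
move=> rc rr; pose B := bdens l rho (T + 1) id.
have mB : measurable_fun (setT : set (mR * (mR * mR * mR))) B.
  exact: (measurable_bdens W T10 (or_intror erefl)).
have mV : measurable_fun (setT : set (mR * (mR * mR))) ((vavg_t l rho) \_ Dt).
  have -> : (vavg_t l rho) \_ Dt =
      (fun y => (2 * l)^-1 * \int[mu1]_s B (y.1, (y.2, s))) \_ Dt.
    apply/funext => -[t y]; rewrite /patch; case: ifPn => //.
    rewrite inE /= => -[/=]; rewrite in_itv /= => /andP[t0 tT] _.
    apply: (@vavgE _ _ _ (fun x => B (t, x))) => [x nO|].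
      by rewrite /B /bdens /patch memNset// => -[].
    apply: aeW => s Os; rewrite /B /bdens /patch mem_set//; split => //=.
    by rewrite in_itv /= t0 (le_lt_trans tT).
  apply/(measurable_restrictT _ measurable_Dt); apply: measurable_funTS.
  by apply: measurable_funM; [exact: measurable_cst|exact: measurable_vert].
split => //.
have mA : measurable ([set y | `|((vavg_t l rho) \_ Dt) y| <= c] : set (mR * (mR * mR))).
  have mN : measurable_fun (setT : set (mR * (mR * mR))) (fun y => `|((vavg_t l rho) \_ Dt) y|).
    exact: measurableT_comp.
  have := mN measurableT _ (measurable_itv `]-oo, c]); rewrite setTI.
  by congr measurable; apply/seteqP; split => y /=; rewrite in_itv.
apply: (ae_prod2 leb_thE mA).
move: rr; apply: ae_imp => t rt; have [tT|tT] := boolP (0 <= t <= T); last first.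
  apply: aeW => y /=; rewrite /patch memNset ?normr0 ?ltW//.
  by move=> -[/=]; rewrite in_itv /= (negbTE tT).
move: (rt tT); apply: ae_imp => y ry /=; rewrite /patch.
case: ifPn => _; last by rewrite normr0 ltW.
by rewrite -ry; have /andP[r0 r1] := rc t y; rewrite ger0_norm.
Qed.

End SolutionPackage.

Lemma Rintegral_dct_ae d {T : measurableType d} {R : realType}
    (mu : {measure set T -> \bar R}) (f_ : nat -> T -> R) (f g : T -> R) :
  (forall n, measurable_fun setT (f_ n)) -> measurable_fun setT f ->
  mu.-integrable setT (EFin \o g) ->
  {ae mu, forall x, f_ n x @[n --> \oo] --> f x /\ forall n, `|f_ n x| <= g x} ->
  \int[mu]_x f_ n x @[n --> \oo] --> \int[mu]_x f x.
Proof.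
move=> mf_ mf ig [N [mN N0 PN]].
have mI : measurable_fun setT (\1_(~` N) : T -> R) by apply: measurable_indic; exact: measurableC.
have E h : \int[mu]_x h x = \int[mu]_x (h x * \1_(~` N) x).
  apply: Rintegral_ae_eq; exists N; split => // x /= hx; apply: contrapT => Nx.
  by apply: hx; rewrite indicE mem_set// mulr1.
have good x : ~ N x -> f_ n x @[n --> \oo] --> f x /\ forall n, `|f_ n x| <= g x.
  by move=> Nx; apply: contrapT => h; exact: Nx (PN x h).
rewrite E; under eq_fun do rewrite E.
have [||||//] := @Rintegral_dct _ _ _ mu (fun n x => f_ n x * \1_(~` N) x)
  (fun x => f x * \1_(~` N) x) (fun x => `|g x|) _ _ _ (integrable_norm ig).
- by move=> n; exact: measurable_funM.
- exact: measurable_funM.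
- move=> x; have [Nx|Nx] := pselect (N x).
    rewrite indicE memNset; last by move=> /(_ Nx).
    by rewrite mulr0; under eq_fun do rewrite mulr0; exact: cvg_cst.
  by apply: cvgMl; have [] := good x Nx.
- move=> n x; have [Nx|Nx] := pselect (N x).
    by rewrite indicE memNset ?mulr0 ?normr0// => /(_ Nx).
  rewrite indicE mem_set// mulr1; apply: le_trans (ler_norm _).
  by have [_] := good x Nx.
Qed.

Lemma Rintegral_restrict d {T : measurableType d} {R : realType}
    (mu : {measure set T -> \bar R}) (D : set T) (f g : T -> R) :
  \int[mu]_(x in D) (f x * g x) = \int[mu]_x (f x * (g \_ D) x).
Proof.
rewrite Rintegral_mkcond; congr (Rintegral mu setT _); apply/funext => x.
by rewrite /patch; case: ifPn => _; rewrite ?mulr0.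
Qed.

(** * The two modes of convergence of the density *)

Section Assembly.
Context {R : realType}.
Local Notation R2 := (R * R)%type.
Local Notation mR := (measurableTypeR R).
Local Notation mu1 := (@lebesgue_measure R).
Local Notation mu2 := (@leb2 R).
Local Notation mu_th := (@leb_th R).
Variables (T c : R) (rhobar : nat -> R * R2 -> R) (rhot : nat -> R -> R2 -> R) (rho0 : R2 -> R).
Hypotheses (T0 : 0 < T) (c0 : 0 < c).
Hypotheses (mrt : forall n t, measurable_fun (setT : set (mR * mR)) (rhot n t))
  (rtc : forall n t y, 0 <= rhot n t y <= c)
  (rtr : forall n, time_repr T (rhobar n) (rhot n))
  (mr0 : measurable_fun (setT : set (mR * mR)) rho0) (r0c : forall y, 0 <= rho0 y <= c).
Hypothesis rtF : forall n, exists2 F : box_idx -> R -> R, forall i, continuous (F i) &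
  forall i t, 0 <= t <= T -> \int[mu2]_y (rhot n t y * theta i y) = F i t.
Hypothesis rt_cvg : forall i e, 0 < e -> \forall n \near \oo, forall t, 0 <= t <= T ->
    `|\int[mu2]_y (rhot n t y * theta i y) - \int[mu2]_y (rho0 y * theta i y)| < e.

Let Dt : set (R * R2) := `[0, T] `*` setT.

Hypothesis mV : forall n,
  measurable_fun (setT : set (mR * (mR * mR))) (rhobar n \_ Dt).
Hypothesis Vc : forall n, {ae mu_th, forall y, `|(rhobar n \_ Dt) y| <= c}.

Let c_norm r : 0 <= r <= c -> `|r| <= c.
Proof. by move=> /andP[r0 rc]; rewrite ger0_norm. Qed.

(** A test in the conjugate space, extended by zero outside the compact set, is integrable on the
    plane, so every exponent reduces to L^1 duality. *)
Lemma density_cvg_C0Lpw (K : set R2) (p : R) : compact K -> 1 <= p ->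
  cvg_C0Lpw T K p%:E rhot (fun _ => rho0).
Proof.
move=> cK p1.
have conj g : LpOn mu2 K (hoelder_conjugate p%:E) g -> mu2.-integrable setT (EFin \o (g \_ K)).
  by apply: LpOn_integrable => //; exact: hoelder_conj_ge1.
split.
- move=> n; split => [t _|g /conj ig].
    exact: (bounded_LpOn cK p1 (mrt n t) (fun y => c_norm (rtc n t y))).
  have -> : (fun t => \int[mu2]_(x in K) (rhot n t x * g x)) =
      (fun t => \int[mu2]_x (rhot n t x * (g \_ K) x)).
    by apply/funext => t; exact: Rintegral_restrict.
  have [F cF rF] := rtF n.
  exact: (moments_continuous c0 (mrt n) (rtc n) rF cF ig).
- split => [t _|g _]; last by apply: continuous_subspaceT => t; exact: cvg_cst.
  exact: (bounded_LpOn cK p1 mr0 (fun y => c_norm (r0c y))).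
move=> g /conj ig P /uniform_nbhs[E [entE EP]].
move: entE; rewrite -entourage_ballE => -[e /= e0 eE].
have := moments_uniform c0 mrt rtc mr0 r0c rt_cvg ig e0.
apply: filterS => n hn; apply: EP => t; rewrite /= in_itv /= => tT.
apply: eE; rewrite /= /ball /= distrC.
rewrite (Rintegral_restrict mu2 K rho0 g) (Rintegral_restrict mu2 K (rhot n t) g).
exact: hn.
Qed.

(** For almost every [t] the slice of the test is integrable and its pairing converges by
    [moments_uniform]; dominated convergence in time concludes, with [c] times the L^1 norm of the
    slice as majorant. *)
Lemma density_cvg_weak_star : cvg_weak_star mu_th Dt rhobar (fun y => rho0 y.2).
Proof.
have mDt : measurable (Dt : set (mR * (mR * mR))) by exact: measurableX.
have mr02 : measurable_fun (setT : set (mR * (mR * mR))) (fun y : R * R2 => rho0 y.2).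
  exact: measurableT_comp mr0 measurable_snd.
split=> [n| |g].
- exact: bounded_Lfun_oo (mV n) (Vc n).
- apply: (@bounded_Lfun_oo _ _ _ _ _ c).
    by apply/(measurable_restrictT _ mDt); exact: measurable_funTS.
  by apply: aeW => y; rewrite /patch; case: ifPn => _; [exact: c_norm|rewrite normr0 ltW].
move=> /Lfun1_integrable iG; set G := g \_ Dt in iG.
have mG := integrable_EFin_measurable iG.
have GD y : G y = G y * \1_Dt y.
  by rewrite indicE /G /patch; case: (y \in Dt); rewrite ?mulr1 ?mulr0.
pose V n y := (rhobar n \_ Dt) y * G y.
have iV n : mu_th.-integrable setT (EFin \o V n).
  apply: (integrable_ae_dom _ (integrable_scale c (integrable_norm iG))).
    exact: measurable_funM.
  by move: (Vc n); apply: ae_imp => y h; rewrite normrM; exact: ler_wpM2r.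
have iV0 : mu_th.-integrable setT (EFin \o (fun y => rho0 y.2 * G y)).
  apply: (integrable_mul_bounded iG mr02 (M := c)) => y; exact: c_norm.
rewrite Rintegral_restrict -/G (Rfubini1 leb_thE iV0).
have -> : (fun n => \int[mu_th]_(x in Dt) (rhobar n x * g x)) =
    (fun n => \int[mu1]_t \int[mu2]_y V n (t, y)).
  apply/funext => n; rewrite -(Rfubini1 leb_thE (iV n)) Rintegral_mkcond.
  congr (Rintegral mu_th setT _); apply/funext => y; rewrite /V /G /patch.
  by case: ifPn => _; rewrite ?mulr0.
have rr : {ae mu1, forall t, forall n, 0 <= t <= T ->
    {ae mu2, forall y, rhot n t y = rhobar n (t, y)}} by apply: ae_forall_count.
have iG1 := integrable_fubini1 leb_thE (integrable_norm iG).
apply: (@Rintegral_dct_ae _ _ _ mu1 (fun n t => \int[mu2]_y V n (t, y))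
  (fun t => \int[mu2]_y (rho0 y * G (t, y))) (fun t => c * \int[mu2]_y `|G (t, y)|)).
- by move=> n; exact: integrable_EFin_measurable (integrable_fubini1 leb_thE (iV n)).
- exact: integrable_EFin_measurable (integrable_fubini1 leb_thE iV0).
- exact: integrable_scale.
move: rr (ae_fubini1 leb_thE iG); apply: ae_imp2 => t rt iGt.
have iGn := integrable_norm iGt.
have VE n : \int[mu2]_y V n (t, y) = \int[mu2]_y (rhot n t y * G (t, y)).
  apply: Rintegral_ae_eq; have [tT|tT] := boolP (0 <= t <= T); last first.
    apply: aeW => y; rewrite /V GD indicE memNset ?mulr0//.
    by move=> -[/=]; rewrite in_itv /= (negbTE tT).
  move: (rt n tT); apply: ae_imp => y ->; rewrite /V /patch mem_set.
    by [].
  by split => //=; rewrite ?in_itv.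
split.
  under eq_fun do rewrite VE.
  apply/cvgrPdist_lt => e e0.
  have [tT|tT] := boolP (0 <= t <= T).
    have := moments_uniform c0 mrt rtc mr0 r0c rt_cvg iGt e0.
    by apply: filterS => n hn; rewrite distrC; exact: hn.
  apply: nearW => n.
  have G0 y : G (t, y) = 0.
    rewrite GD indicE memNset ?mulr0//.
    by move=> -[/=]; rewrite in_itv /= (negbTE tT).
  have Z (f : R2 -> R) : \int[mu2]_y (f y * G (t, y)) = 0.
    by rewrite /Rintegral integral0_eq// => y _; rewrite G0 mulr0.
  by rewrite !Z subrr normr0.
move=> n; rewrite VE -RintegralZl//.
apply: le_Rintegral_dom; last first.
- by move=> y; rewrite normrM; apply: ler_wpM2r => //; exact: c_norm.
- exact: integrable_scale.
apply: (integrable_mul_bounded iGt (mrt n t) (M := c)) => y; exact: c_norm.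
Qed.

End Assembly.

Lemma sqrt_cvg0 {R : realType} (a b : nat -> R) : (forall n, 0 <= a n <= b n) ->
  b n @[n --> \oo] --> (0 : R) -> Num.sqrt (a n) @[n --> \oo] --> (0 : R).
Proof.
move=> ab b0; have a0 : a n @[n --> \oo] --> (0 : R).
  by apply: (squeeze_cvgr _ (cvg_cst 0) b0); apply: nearW.
rewrite -[X in _ --> X](sqrtr0 R).
by apply: (cvg_comp a Num.sqrt a0); exact: sqrt_continuous.
Qed.

Lemma velocity_gap_cvg {R : realType} (l alpha : nat -> R) (C : R) :
  (forall n, 0 < l n) -> (forall n, 0 < alpha n) ->
  l n @[n --> \oo] --> (0 : R) -> alpha n / l n @[n --> \oo] --> +oo%R ->
  velocity_gap (l n) (alpha n) C @[n --> \oo] --> (0 : R).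
Proof.
move=> l0 a0 lc ac.
have r0 : (alpha n / l n)^-1 @[n --> \oo] --> (0 : R).
  apply/gtr0_cvgV0; last exact: ac.
  by apply: nearW => n; rewrite divr_gt0.
have -> : (fun n => velocity_gap (l n) (alpha n) C) =
    (fun n => (2 * (alpha n / l n)^-1 + 8 * (l n * l n)) * C).
  apply/funext => n; rewrite /velocity_gap invf_div expr2.
  by congr (_ * _); congr (_ + _); rewrite mulrA.
rewrite -[X in _ --> X](mul0r C); apply: cvgMl.
rewrite -[X in _ --> X](addr0 0); apply: cvgD.
  by rewrite -[X in _ --> X](mulr0 2); apply: cvgMr.
rewrite -[X in _ --> X](mulr0 8); apply: cvgMr.
by rewrite -[X in _ --> X](mulr0 0); apply: cvgM.
Qed.

Theorem theorem3p2 (R : realType)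
  (eps : nat -> R)
  (eps_in01 : forall n, 0 < eps n <= 1)
  (eps_cvg0 : eps n @[n --> \oo] --> (0 : R))
  (ell alpha : R -> R)
  (ell_gt0 : forall n, 0 < ell (eps n))
  (alpha_gt0 : forall n, 0 < alpha (eps n))
  (ell_mono : forall m n, eps m <= eps n -> ell (eps m) <= ell (eps n))
  (ell_cvg0 : ell (eps n) @[n --> \oo] --> (0 : R))
  (lambda_cvg : alpha (eps n) / ell (eps n) @[n --> \oo] --> +oo%R)
  (rho0 : R * R -> R)
  (rhoin : R -> R * R * R -> R)
  (momin : R -> R * R * R -> 'rV[R]_3)
  (hadm : admissible (range eps) ell rho0 rhoin momin)
  (hnonconst : ~ constant_fun rho0)
  (rho : R -> R * (R * R * R) -> R)
  (u : R -> R * (R * R * R) -> 'rV[R]_3)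
  (hsol : forall n, weak_solution (eps n) (ell (eps n)) (alpha (eps n))
            (rhoin (eps n)) (momin (eps n)) (rho (eps n)) (u (eps n))) :
  forall T : R, 0 < T ->
  exists sub : nat -> nat, {homo sub : m n / (m < n)%N} /\
    let e k := eps (sub k) in
    let rhobar k := vavg_t (ell (e k)) (rho (e k)) in
    let ubar i k := vavg_t (ell (e k)) (fun z => u (e k) z 0 i) in
    [/\ cvg_weak_star (@leb_th R) (`[0, T] `*` setT) rhobar (fun y => rho0 y.2),
        exists2 rhot : nat -> R -> R * R -> R,
          forall k, time_repr T (rhobar k) (rhot k) &
          forall (K : set (R * R)) (p : R), compact K -> 1 <= p ->
            cvg_C0Lpw T K p%:E rhot (fun _ => rho0) &
        forall i, cvg_strong (@leb_th R) (`[0, T] `*` setT) 2%:E (ubar i)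
                    (fun _ => 0)].
Proof.
move=> T T0; case: hadm => rin [rhostar A].
have rs0 := ad_rhostar A; have c0 : 0 < 2 * rhostar by rewrite mulr_gt0.
have [C hC] := ad_energy A; have [Cr hCr] := ad_rin_Linfty A.
have En n : range eps (eps n) by exists n.
have mrho0 : measurable_fun (setT : set (measurableTypeR R * measurableTypeR R)) rho0.
  by have [/Lfun_measurable] := ad_rho0_W2 A.
have rho0c y : 0 <= rho0 y <= 2 * rhostar.
  by have /andP[h0 h1] := ad_rho0_bd A y; rewrite h0 /=; lra.
have eps0 n : 0 < eps n by have /andP[] := eps_in01 n.
have rhoin_oo n := ad_rhoin_Linfty A (En n).
have rhoin_c n := ad_rhoin_bd A (En n).
have rinC n : {ae @leb2 R, forall y, `|vavg (ell (eps n)) (rin (eps n)) y| <= `|Cr|}.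
  have [_ h] := hCr _ (En n); apply: Lnorm_oo_bound => //.
  by apply: le_trans h _; rewrite lee_fin ler_norm.
have hE n : (\int[@leb3 R]_(x in Omega (ell (eps n)))
    (normsq (momin (eps n) x) / rhoin (eps n) x)%:E <= (2 * ell (eps n) * C)%:E)%E.
  apply: (energy_bound (ell_gt0 n) _ (ad_min_L1 A (En n)) (hC _ (En n))).
  by move: (rhoin_c n); apply: ae_imp => x h /h /andP[].
pose gap n := velocity_gap (ell (eps n)) (alpha (eps n)) C.
have gap0 : gap n @[n --> \oo] --> (0 : R).
  exact: (velocity_gap_cvg C ell_gt0 alpha_gt0 ell_cvg0 lambda_cvg).
have /choice[rhot rP] n : exists rhot : R -> R * R -> R,
  [/\ forall t, measurable_fun (setT : set (measurableTypeR R * measurableTypeR R)) (rhot t),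
      forall t y, 0 <= rhot t y <= 2 * rhostar,
      time_repr T (vavg_t (ell (eps n)) (rho (eps n))) rhot,
      exists2 F : box_idx -> R -> R, forall i, continuous (F i) &
        forall i t, 0 <= t <= T -> \int[@leb2 R]_y (rhot t y * theta i y) = F i t &
      forall lam i t, 0 < lam -> 0 <= t <= T ->
        `|\int[@leb2 R]_y (rhot t y * theta i y) - \int[@leb2 R]_y (rho0 y * theta i y)|
          <= moment_gap (eps n) (ell (eps n)) (alpha (eps n)) T (2 * rhostar) C `|Cr| lam i].
  have [Du [gam W]] := hsol n.
  exact: (density_package W (ell_gt0 n) (alpha_gt0 n) T0 c0 (hE n) (rhoin_oo n) (rhoin_c n)
    (eps0 n) mrho0 rho0c (ad_decomp A (En n)) (rinC n)).
have mrt n := let: And5 h _ _ _ _ := rP n in h.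
have rtc n := let: And5 _ h _ _ _ := rP n in h.
have rtr n := let: And5 _ _ h _ _ := rP n in h.
have rtF n := let: And5 _ _ _ h _ := rP n in h.
have rt_cvg i e : 0 < e -> \forall n \near \oo, forall t, 0 <= t <= T ->
    `|\int[@leb2 R]_y (rhot n t y * theta i y) - \int[@leb2 R]_y (rho0 y * theta i y)| < e.
  move=> e0; have K0 := @theta_energy_ge0 R i.
  pose K := 2 * rhostar * ((T + 1) * theta_energy i).
  have K0' : 0 <= K by rewrite /K mulr_ge0 ?(ltW c0)// mulr_ge0// addr_ge0// ltW.
  (* This makes the part of the gap carrying [lam^-1] smaller than [e / 2], whatever the index; with
     [lam] now fixed, [rest n] collects the terms that vanish as [n] grows. *)
  pose lam := (K + 1) / (e / 2).
  have lam0 : 0 < lam by rewrite divr_gt0 ?divr_gt0// ltr_wpDl.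
  have Klam : lam^-1 * K < e / 2.
    rewrite /lam invf_div mulrAC ltr_pdivrMr ?ltr_wpDl//.
    by rewrite ltr_pM2l ?divr_gt0// ltrDl.
  pose rest n := eps n * `|Cr| * \int[@leb2 R]_y `|theta i y|
    + 2 * rhostar * (lam * (gap n + gap n)).
  have rest0 : rest n @[n --> \oo] --> (0 : R).
    rewrite -[X in _ --> X](addr0 0); apply: cvgD.
      rewrite -[X in _ --> X](mul0r (\int[@leb2 R]_y `|theta i y|)); apply: cvgMl.
      by rewrite -[X in _ --> X](mul0r `|Cr|); apply: cvgMl.
    rewrite -[X in _ --> X](mulr0 (2 * rhostar)); apply: cvgMr.
    rewrite -[X in _ --> X](mulr0 lam); apply: cvgMr.
    by rewrite -[X in _ --> X](addr0 0); apply: cvgD.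
  have e2 : 0 < e / 2 by rewrite divr_gt0.
  have : \forall n \near \oo, rest n < e / 2 by exact: (cvgr_lt _ rest0 _ e2).
  apply: filterS => n hn t tT.
  have [_ _ _ _ h] := rP n; apply: le_lt_trans (h lam i t lam0 tT) _.
  have -> : moment_gap (eps n) (ell (eps n)) (alpha (eps n)) T (2 * rhostar) C `|Cr| lam i
    = rest n + lam^-1 * K.
    by rewrite /moment_gap /rest /K /gap mulrDr addrA [lam^-1 * (2 * _ * _)]mulrCA.
  by rewrite [ltRHS](splitr e) ltrD.
have mean n : measurable_fun
    (setT : set (measurableTypeR R * (measurableTypeR R * measurableTypeR R)))
    (vavg_t (ell (eps n)) (rho (eps n)) \_ (`[0, T] `*` setT)) /\
    {ae @leb_th R, forall y,
      `|(vavg_t (ell (eps n)) (rho (eps n)) \_ (`[0, T] `*` setT)) y| <= 2 * rhostar}.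
  have [Du [gam W]] := hsol n.
  exact: (mean_density W T0 c0 (rtc n) (rtr n)).
exists id; split => //=; split.
- exact: (density_cvg_weak_star c0 mrt rtc rtr mrho0 rho0c rt_cvg
    (fun n => proj1 (mean n)) (fun n => proj2 (mean n))).
- exists rhot; first exact: rtr.
  move=> K p cK p1; exact: (density_cvg_C0Lpw c0 mrt rtc mrho0 rho0c rtF rt_cvg cK p1).
move=> i.
have vel n : let f := vavg_t (ell (eps n)) (fun z => u (eps n) z 0 i) \_ (`[0, T] `*` setT) in
    [/\ measurable_fun (setT : set (measurableTypeR R * (measurableTypeR R * measurableTypeR R))) f,
      (@leb_th R).-integrable setT (EFin \o (fun y => f y ^+ 2)) &
      \int[@leb_th R]_y (f y ^+ 2) <= gap n].
  have [Du [gam W]] := hsol n.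
  exact: (mean_velocity_sqr W (ell_gt0 n) (alpha_gt0 n) T0 (hE n) i).
have Z : ((fun=> 0 : R) \_ (`[0, T] `*` setT) : R * (R * R) -> R) = fun=> 0.
  by apply/funext => y; rewrite /patch; case: ifPn.
split.
- by move=> n; have [mf f2 _] := vel n; exact: Lfun2I.
- rewrite /LpOn Z; apply: Lfun2I; first exact: measurable_cst.
  have -> : EFin \o (fun _ : R * (R * R) => 0 ^+ 2 : R) = cst 0%E.
    by apply/funext => y; rewrite /= expr0n.
  exact: integrable0.
pose f n := vavg_t (ell (eps n)) (fun z => u (eps n) z 0 i) \_ (`[0, T] `*` setT).
have N n : Lnorm (@leb_th R) 2%:E (EFin \o ((vavg_t (ell (eps n)) (fun z => u (eps n) z 0 i)
    \- (fun=> 0)) \_ (`[0, T] `*` setT))) = (Num.sqrt (\int[@leb_th R]_y (f n y ^+ 2)))%:E.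
  have [mf f2 _] := vel n; rewrite -LnormE2//; congr Lnorm; congr (_ \o _).
  by apply/funext => y; rewrite /f /patch; case: ifPn => // _; rewrite /= subr0.
under eq_fun do rewrite N.
apply: cvg_EFin; first by apply: nearW.
apply: sqrt_cvg0 gap0 => n; have [_ _ ->] := vel n; rewrite andbT.
by apply: Rintegral_ge0 => y _; exact: sqr_ge0.
Qed.
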